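(* For any non-negative integers $b$ and $d$ there exists an integer $h(b,d)$ such that the following holds. If $\mathcal{F}$ is a finite family of subsets of $\mathbb{R}^d$ such that $\tilde\beta_i\left(\bigcap\mathcal{G}\right) \le b$ for every proper subfamily $\mathcal{G} \subsetneq \mathcal{F}$ and every $0 \le i \le \lceil d/2 \rceil-1$, then $\mathcal{F}$ has Helly number at most $h(b,d)$.
   Context: $\tilde\beta_i(X)$ denotes the $i$-th reduced Betti number of a space $X$ computed with singular homology with coefficients in $\mathbb{Z}_2$. For a family $\mathcal{G}$ of subsets of $\mathbb{R}^d$, $\bigcap\mathcal{G}=\bigcap_{U\in\mathcal{G}}U$, with the convention $\bigcap\emptyset=\mathbb{R}^d$. The Helly number of a family $\mathcal{F}$ of sets is defined as follows: if $\bigcap\mathcal{F}=\emptyset$, it is the largest size of a subfamily $\mathcal{G}\subseteq\mathcal{F}$ such that $\bigcap\mathcal{G}=\emptyset$ but every proper subfamily of $\mathcal{G}$ has nonempty intersection; if $\bigcap\mathcal{F}\neq\emptyset$, the Helly number is $1$. *)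

(* Defs.v *)
From Stdlib Require Import Reals Lra List Arith ClassicalEpsilon.
Import ListNotations.
Open Scope R_scope.

Definition point := nat -> R.
Definition pset := point -> Prop.

Definition inRd (d : nat) (x : point) : Prop := forall i, (d <= i)%nat -> x i = 0.

Fixpoint supdist (n : nat) (x y : point) : R :=
  match n with
  | O => 0
  | S k => Rmax (supdist k x y) (Rabs (x k - y k))
  end.

Fixpoint sum_first (n : nat) (t : point) : R :=
  match n with
  | O => 0
  | S k => sum_first k t + t k
  end.

Definition std_simplex (k : nat) (t : point) : Prop :=
  (forall i, (i <= k)%nat -> 0 <= t i) /\
  (forall i, (k < i)%nat -> t i = 0) /\
  sum_first (S k) t = 1.

Definition zero_point : point := fun _ => 0.

(* singular k-simplex in X (a subset of R^d): a continuous map Delta^k -> X,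
   normalised to be zero_point outside Delta^k so that maps agreeing on
   Delta^k are literally equal. *)
Definition sing_simplex (d : nat) (X : pset) (k : nat) (s : point -> point) : Prop :=
  (forall t, std_simplex k t -> X (s t) /\ inRd d (s t)) /\
  (forall t, ~ std_simplex k t -> s t = zero_point) /\
  (forall t, std_simplex k t -> forall eps, 0 < eps ->
     exists delta, 0 < delta /\
       forall u, std_simplex k u -> supdist (S k) u t < delta ->
         supdist d (s u) (s t) < eps).

Definition face_incl (j : nat) (t : point) : point :=
  fun i => if Nat.ltb i j then t i else if Nat.eqb i j then 0 else t (Nat.pred i).

Definition pdec (P : Prop) : bool :=
  if excluded_middle_informative P then true else false.

Definition face (k j : nat) (s : point -> point) : point -> point :=
  fun t => if pdec (std_simplex (Nat.pred k) t) then s (face_incl j t) else zero_point.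

(* Z_2-chains are represented by finite lists of simplices, a simplex
   occurring in the chain iff it occurs an odd number of times in the list. *)
Definition chain := list (point -> point).

Definition count_cl (s : point -> point) (c : chain) : nat :=
  length (filter (fun s' => pdec (s' = s)) c).

Definition chain_zero (c : chain) : Prop :=
  forall s, Nat.even (count_cl s c) = true.

Definition bdry (k : nat) (c : chain) : chain :=
  flat_map (fun s => map (fun j => face k j s) (seq 0 (S k))) c.

Definition is_chain (d : nat) (X : pset) (k : nat) (c : chain) : Prop :=
  Forall (sing_simplex d X k) c.

(* reduced cycles: kernel of the boundary map (the augmentation in degree 0) *)
Definition is_rcycle (d : nat) (X : pset) (k : nat) (c : chain) : Prop :=
  is_chain d X k c /\
  match k with
  | O => Nat.even (length c) = true
  | S _ => chain_zero (bdry k c)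
  end.

Definition is_bdry (d : nat) (X : pset) (k : nat) (c : chain) : Prop :=
  exists w, is_chain d X (S k) w /\ chain_zero (bdry (S k) w ++ c).

Fixpoint select {A} (m : list bool) (l : list (list A)) : list A :=
  match m, l with
  | b :: m', x :: l' => (if b then x else []) ++ select m' l'
  | _, _ => []
  end.

(* reduced Betti number  ~beta_k(X) <= b  (Z_2 coefficients):
   the Z_2-vector space H~_k(X) has dimension at most b, i.e. any b+1
   reduced k-cycles are linearly dependent modulo boundaries. *)
Definition rbetti_le (d : nat) (X : pset) (k b : nat) : Prop :=
  forall zs : list chain, length zs = S b -> Forall (is_rcycle d X k) zs ->
    exists m : list bool, length m = S b /\ In true m /\
      is_bdry d X k (select m zs).

(* intersection of a family of subsets of R^d; the empty family gives R^d *)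
Definition inter (d : nat) (G : list pset) : pset :=
  fun x => inRd d x /\ forall U, In U G -> U x.

Definition nonempty (X : pset) : Prop := exists x, X x.

Definition subfam (G F : list pset) : Prop := incl G F.
Definition proper_subfam (G F : list pset) : Prop :=
  incl G F /\ exists U, In U F /\ ~ In U G.

Definition helly_le (d : nat) (F : list pset) (h : nat) : Prop :=
  (nonempty (inter d F) -> (1 <= h)%nat) /\
  (~ nonempty (inter d F) ->
     forall G, NoDup G -> subfam G F -> ~ nonempty (inter d G) ->
       (forall G', proper_subfam G' G -> nonempty (inter d G')) ->
       (length G <= h)%nat).

(* Main.v *)
From HB Require Import structures.
From mathcomp Require all_boot all_order all_algebra boolp Rstruct.
From mathcomp Require ring lra zify.
From Stdlib Require Reals List Lra Lia Classical ClassicalEpsilon FunctionalExtensionality.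
Require Import Defs.

(** Suppose that the intersection of [U_1, ..., U_n] is empty while every proper subfamily
    intersects, and put [k] for half of [d] rounded up.  For a set [A] of indices let [X A] be
    the intersection of the [U_i] with [i] outside [A]: it is nonempty for nonempty [A], and
    disjoint [A], [B] give disjoint [X A], [X B].

    By induction on [l <= k], if [n] is large there is a chain map from the [l]-skeleton of a
    simplex to singular chains that carries disjoint faces into disjoint sets.  To pass from
    [l] to [l + 1], Ramsey's theorem makes the linear relations between the homology classes of
    the boundaries of [l + 1]-faces independent of the chosen vertices; after adding spare
    vertices, all these boundaries become homologous, so any even sum of them bounds.  Replacing
    every [l]-face by the cone over its boundary turns the boundary of an [l + 1]-face into
    such an even sum.

    For [l = k] and [2k + 3] vertices this contradicts a homological van Kampen-Flores theorem.
    The singular chains are replaced by fine affine ones, moved into general position in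
    [R^(2k)].  The number mod 2 of crossings between images of pairs of disjoint [k]-faces does
    not change under a chain homotopy made one face at a time, and it is odd for points on the
    moment curve. *)

Set Implicit Arguments.
Unset Strict Implicit.
Unset Printing Implicit Defensive.

(** The sets [X A] need not be path-connected, so a continuous map of a skeleton is out of reach;
    bounded Betti numbers supply chain maps mod 2 with odd augmentation instead. Any [b + 1] cycles
    are dependent in homology. Once the coefficients do not depend on the vertices, one cycle can be
    varied while the others stay fixed, and its class cannot change. That class may be nonzero,
    hence only even sums bound. The fixed cycles must live over the face at hand, so every face owns
    spare vertices, on both sides because the position of the varied cycle is not under control.

    The number [2k + 3] is that of van Kampen and Flores: the [k]-skeleton of the [2k + 2]-simplex
    does not embed in [R^(2k)].

    Affine approximations may leave the sets [X A], which are arbitrary. But the images of disjoint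
    faces are compact and disjoint, hence a positive distance apart, and fine approximations cannot
    cross. The homotopy to the moment curve works with abstract vertex tuples: it needs disjoint
    vertex sets in general position, not disjoint images. *)

Module ConstrainedMaps.
Import all_boot boolp zify.
Close Scope R_scope.
Local Open Scope nat_scope.

(** * Chains mod 2 *)

Definition xs (T : Type) (f : T -> bool) (c : seq T) := \big[addb/false]_(s <- c) f s.

(* Equality of chains mod 2 is tested against all functionals, so that linear maps respect it
   for free. *)
Definition ceq (T : Type) (c1 c2 : seq T) := forall f, xs f c1 = xs f c2.

Section Xs.
Variable T : Type.
Implicit Types (f g : T -> bool) (c : seq T).

Lemma xs_nil f : xs f [::] = false. Proof. by rewrite /xs big_nil. Qed.
Lemma xs_cons f s c : xs f (s :: c) = f s (+) xs f c. Proof. by rewrite /xs big_cons. Qed.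
Lemma xs1 f s : xs f [:: s] = f s. Proof. by rewrite xs_cons xs_nil addbF. Qed.
Lemma xs_cat f c1 c2 : xs f (c1 ++ c2) = xs f c1 (+) xs f c2. Proof. by rewrite /xs big_cat. Qed.
Lemma xs_add f g c : xs (fun s => f s (+) g s) c = xs f c (+) xs g c.
Proof. by rewrite /xs big_split. Qed.
Lemma eq_xs f g c : f =1 g -> xs f c = xs g c.
Proof. by move=> fg; rewrite /xs; apply: eq_bigr => s _. Qed.
Lemma eq_xs_in f g c : List.Forall (fun s => f s = g s) c -> xs f c = xs g c.
Proof. by elim=> [|s c' e _ IH]; rewrite ?xs_nil // !xs_cons e IH. Qed.
Lemma xs0 f c : (forall s, f s = false) -> xs f c = false.
Proof. by move=> f0; rewrite /xs big1. Qed.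
Lemma xs_true c : xs (fun=> true) c = odd (size c).
Proof. by elim: c => [|s c IH]; rewrite ?xs_nil // xs_cons IH. Qed.
End Xs.

Lemma xs_map (S T : Type) (f : T -> bool) (g : S -> T) c : xs f (map g c) = xs (f \o g) c.
Proof. by rewrite /xs big_map. Qed.

Lemma xs_flatten (S T : Type) (f : T -> bool) (g : S -> seq T) c :
  xs f (flatten (map g c)) = xs (fun s => xs f (g s)) c.
Proof. by elim: c => [|s c IH] /=; rewrite ?xs_nil // xs_cat xs_cons IH. Qed.

Lemma flat_mapE (S T : Type) (g : S -> seq T) c : List.flat_map g c = flatten (map g c).
Proof. by elim: c => //= s c ->. Qed.

Lemma xs_exchange (S T : Type) (F : S -> T -> bool) c1 c2 :
  xs (fun s => xs (F s) c2) c1 = xs (fun t => xs (F ^~ t) c1) c2.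
Proof. exact: exchange_big. Qed.

Lemma pdecP (P : Prop) : reflect P (pdec P).
Proof. by rewrite /pdec; case: ClassicalEpsilon.excluded_middle_informative => h; constructor. Qed.

Lemma Forall_cat (T : Type) (P : T -> Prop) c1 c2 :
  List.Forall P (c1 ++ c2) <-> List.Forall P c1 /\ List.Forall P c2.
Proof. exact: List.Forall_app. Qed.

Lemma Forall_flatten (S T : Type) (P : T -> Prop) (g : S -> seq T) c :
  List.Forall (fun s => List.Forall P (g s)) c -> List.Forall P (flatten (map g c)).
Proof. by elim=> //= s c' h _ IH; apply/Forall_cat. Qed.

Lemma Forall_map (S T : Type) (P : T -> Prop) (g : S -> T) c :
  List.Forall P (map g c) <-> List.Forall (fun s => P (g s)) c.
Proof. exact: List.Forall_map. Qed.

Lemma Forall_inP (T : eqType) (P : T -> Prop) (c : seq T) :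
  List.Forall P c <-> {in c, forall x, P x}.
Proof.
split=> [|h]; first by elim=> // x s px _ IH y; rewrite inE => /predU1P [->|/IH].
elim: c h => // x c IH h; constructor; first by apply: h; rewrite inE eqxx.
by apply: IH => y yc; apply: h; rewrite inE yc orbT.
Qed.

Lemma evenE n : PeanoNat.Nat.even n = ~~ odd n.
Proof. by elim: n => // n IH; rewrite PeanoNat.Nat.even_succ -PeanoNat.Nat.negb_even IH. Qed.

Lemma count_clE s c : count_cl s c = count (fun s' => pdec (s' = s)) c.
Proof. by rewrite /count_cl; elim: c => //= a c IH; case: ifP => _ /=; rewrite IH. Qed.

Lemma odd_countE (T : Type) (p : pred T) c : odd (count p c) = xs p c.
Proof. by elim: c => [|a c IH]; rewrite ?xs_nil // xs_cons /= oddD IH; case: (p a). Qed.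

Lemma chain_zeroP c : chain_zero c <-> ceq c [::].
Proof.
split=> [h f|h s]; last first.
  by rewrite evenE count_clE odd_countE h xs_nil.
have {}h s : xs (fun s' => pdec (s' = s)) c = false.
  by have := h s; rewrite evenE count_clE odd_countE => /negbTE.
rewrite xs_nil.
have [m] := ubnP (size c); elim: m c h => // m IH [|a c] h /=; first by rewrite xs_nil.
rewrite ltnS => sc.
pose eqa s := pdec (s = a).
have splitc g : xs g c = xs g (filter eqa c) (+) xs g (filter (predC eqa) c).
  elim: (c) => [|b c' IH'] /=; rewrite ?xs_nil //.
  by case: (eqa b); rewrite /= !xs_cons IH'; case: (g b); do 2!case: (xs _ _).
have eqs g : xs g (filter eqa c) = g a && odd (size (filter eqa c)).
  elim: (c) => [|b c' IH'] /=; rewrite ?xs_nil ?andbF //.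
  case E: (eqa b) => //=; rewrite xs_cons IH'; have/pdecP -> := E.
  by case: (g a); case: (odd _).
have oda : odd (size (filter eqa c)) = true.
  have := h a; rewrite xs_cons.
  have -> : pdec (a = a) by apply/pdecP.
  have := splitc (fun s' => pdec (s' = a)); rewrite eqs.
  have -> : pdec (a = a) by apply/pdecP.
  have -> : xs (fun s' => pdec (s' = a)) [seq x <- c | predC eqa x] = false.
    elim: (c) => [|b c' IH'] /=; rewrite ?xs_nil //.
    by case E: (eqa b) => //=; rewrite xs_cons IH' addbF; exact: E.
  by move=> ->; case: odd.
rewrite xs_cons splitc eqs oda andbT addbA addbb /=.
apply: IH; last by rewrite size_filter; apply: leq_ltn_trans (count_size _ _) sc.
move=> s.
case: (pdecP (a = s)) => [<-|nas].
  elim: (c) => [|b c' IH'] /=; rewrite ?xs_nil //.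
  by case E: (eqa b) => //=; rewrite xs_cons IH' addbF; exact: E.
have := h s; rewrite xs_cons splitc eqs.
by have -> : pdec (a = s) = false by apply/pdecP.
Qed.

Lemma odd_sum_const (I : finType) (P : pred I) (b : bool) :
  \big[addb/false]_(x | P x) b = b && odd #|P|.
Proof.
rewrite big_const; elim: #|P| => [|n IH] /=; first by rewrite andbF.
by rewrite IH; case: (odd n); rewrite ?andbT ?andbF ?addbb ?addbF.
Qed.

Section SetSums.
Variable I : finType.
Implicit Types (A B : {set I}).

(** The terms at [(x, y)] and [(y, x)] cancel; this is the source of the vanishing of iterated
    boundaries of faces. *)
Lemma sum_sym0 (P G : I -> I -> bool) :
  (forall x y, P x y = P y x) -> (forall x, P x x = false) ->
  (forall x y, P x y -> G x y = G y x) ->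
  \big[addb/false]_x \big[addb/false]_(y | P x y) G x y = false.
Proof.
move=> Ps Pirr Gs.
pose lt (x y : I) := (enum_rank x < enum_rank y)%N.
rewrite (eq_bigr (fun x => \big[addb/false]_(y | P x y && lt x y) G x y (+)
   \big[addb/false]_(y | P x y && lt y x) G x y)); last first.
  move=> x _; rewrite (bigID (lt x)) /=; congr addb; apply: eq_bigl => y.
  case Pxy: (P x y) => //=; rewrite /lt -leqNgt leq_eqVlt.
  case: eqP => //= /val_inj/enum_rank_inj e; by rewrite e Pirr in Pxy.
rewrite big_split /= [X in _ (+) X](exchange_big_dep xpredT) //=.
rewrite -big_split big1 //= => x _.
rewrite [X in _ (+) X](_ : _ = \big[addb/false]_(y | P x y && lt x y) G x y) ?addbb //.
by apply: eq_big => [y|y]; rewrite Ps // => /andP[/Gs].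
Qed.

Lemma xs_flatten_enum (T : Type) (f : T -> bool) (F : I -> seq T) A :
  xs f (flatten [seq F x | x <- enum A]) = \big[addb/false]_(x in A) xs f (F x).
Proof. by rewrite xs_flatten /xs big_enum. Qed.

Definition sbd A : seq {set I} := [seq A :\ x | x <- enum A].

Lemma xs_sbd g A : xs g (sbd A) = \big[addb/false]_(x in A) g (A :\ x).
Proof. by rewrite /xs big_map big_enum. Qed.

Lemma sum_in_dep A (G : I -> I -> bool) :
  \big[addb/false]_(x in A) \big[addb/false]_(y in A :\ x) G x y =
  \big[addb/false]_x \big[addb/false]_(y | [&& x \in A, y \in A & x != y]) G x y.
Proof.
rewrite big_mkcond; apply: eq_bigr => x _; case: ifP => xA; last by rewrite big_pred0.
by apply: eq_bigl => y; rewrite !inE andbC eq_sym.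
Qed.

Lemma sum_in_sym0 A (G : I -> I -> bool) :
  (forall x y, x \in A -> y \in A -> G x y = G y x) ->
  \big[addb/false]_(x in A) \big[addb/false]_(y in A :\ x) G x y = false.
Proof.
move=> Gs; rewrite sum_in_dep; apply: sum_sym0 => [x y|x|x y /and3P[*]].
- by rewrite eq_sym; case: (_ \in _); case: (_ \in _).
- by rewrite eqxx !andbF.
- exact: Gs.
Qed.

Lemma sbd_sbd0 A (g : {set I} -> bool) :
  \big[addb/false]_(x in A) \big[addb/false]_(y in A :\ x) g (A :\ x :\ y) = false.
Proof. by apply: sum_in_sym0 => x y _ _; rewrite setDDl setUC -setDDl. Qed.
End SetSums.

(** * Ramsey's theorem *)

Section Ramsey.
Variables (T : eqType) (C : finType) (q : nat) (col : seq T -> C).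

(** As in the proof of Erdos and Rado, the colour of a subsequence of [q + 1] elements depends on
    its first element only and is recorded next to it. *)
Fixpoint end_homogeneous (L : seq (T * C)) : Prop :=
  if L is xc :: L' then
    (forall Z, subseq Z (map fst L') -> size Z = q -> col (xc.1 :: Z) = xc.2)
    /\ end_homogeneous L'
  else True.

Lemma end_homogeneous_col L c Z :
  end_homogeneous L -> subseq Z (map fst [seq xc <- L | xc.2 == c]) ->
  size Z = q.+1 -> col Z = c.
Proof.
elim: L Z => [|[x c'] L IH] Z /=; first by move=> _ /eqP ->.
move=> [hx hL]; case: eqP => [ec|_] /=; last exact: (IH _ hL).
case: Z => // y Z /=; case: eqP => [-> sZ [sz]|_ sZ]; last exact: (IH (y :: Z) hL sZ).
by rewrite -ec; apply: hx => //; apply: subseq_trans sZ _; apply/map_subseq/filter_subseq.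
Qed.

Lemma pigeon_col (L : seq (T * C)) m :
  #|C| * m < size L -> exists c, m < size [seq xc <- L | xc.2 == c].
Proof.
move=> h; apply/existsP; apply: contraLR h; rewrite negb_exists -leqNgt => /forallP h.
have -> : size L = \sum_(c : C) size [seq xc <- L | xc.2 == c].
  elim: L {h} => [|[x c'] L IH] /=; first by rewrite big1.
  rewrite (eq_bigr (fun c => (c' == c) + size [seq xc <- L | xc.2 == c])); last first.
    by move=> c _; case: eqP.
  by rewrite big_split /= -IH (bigD1 c') //= eqxx big1 ?addn0 // => c; rewrite eq_sym => /negbTE ->.
rewrite -sum_nat_const; apply: leq_sum => c _; have := h c; by rewrite -leqNgt.
Qed.
End Ramsey.

(** Applying the case [q] to the colourings [Z -> col (x :: Z)] for one head [x] after another
    yields an end-homogeneous sequence; the pigeonhole principle then makes the recorded colours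
    equal. Sets are subsequences because the colours used later depend on the order of the
    vertices. *)
Lemma ramsey (C : finType) q m : exists N, forall (T : eqType) (X : seq T) (col : seq T -> C),
  N <= size X -> exists Y c, [/\ subseq Y X, size Y = m &
    forall Z, subseq Z Y -> size Z = q -> col Z = c].
Proof.
elim: q m => [|q IHq] m.
  exists m => T X col hX; exists (take m X), (col [::]); split.
  - exact: take_subseq.
  - by rewrite size_takel.
  - by move=> Z _ /size0nil ->.
have [N hN] : exists N, forall (T : eqType) (X : seq T) (col : seq T -> C), N <= size X ->
    exists L, [/\ subseq (map fst L) X, size L = (#|C| * m).+1 & end_homogeneous q col L].
  elim: (#|C| * m).+1 => [|p [N IHp]]; first by exists 0 => T X col _; exists [::]; rewrite sub0seq.
  have [N' hN'] := IHq N; exists N'.+1 => T [|x X] // col; rewrite ltnS => hX.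
  have [Y [c [YX sY hY]]] := hN' T X (fun Z => col (x :: Z)) hX.
  have [|L [LY sL hL]] := IHp T Y col; first by rewrite sY.
  exists ((x, c) :: L); split => /=; first by rewrite eqxx (subseq_trans LY).
    by rewrite sL.
  by split=> // Z ZL sZ; apply: hY => //; apply: subseq_trans ZL LY.
exists N => T X col /hN -/(_ col) [L [LX sL hL]].
have [|c hc] := @pigeon_col T C L m; first by rewrite sL.
exists (take m (map fst [seq xc <- L | xc.2 == c])), c; split.
- apply: subseq_trans (take_subseq _ _) _; apply: subseq_trans LX.
  exact/map_subseq/filter_subseq.
- by rewrite size_takel // size_map ltnW.
- move=> Z ZY sZ; apply: end_homogeneous_col hL _ sZ.
  exact: subseq_trans ZY (take_subseq _ _).
Qed.

(** * Constrained chain maps *)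

Definition point0 : point -> point := fun=> zero_point.

(* In degree 0 every simplex is sent to the generator [point0] of degree -1. *)
Definition abd (k : nat) (c : chain) : chain :=
  if k is 0 then map (fun=> point0) c else bdry k c.

Lemma xs_bdry f k c : xs f (bdry k c) = xs (fun s => xs f (bdry k [:: s])) c.
Proof.
rewrite /bdry flat_mapE xs_flatten; apply: eq_xs => s.
by rewrite /= List.app_nil_r.
Qed.

Lemma xs_abd f k c : xs f (abd k c) = xs (fun s => xs f (abd k [:: s])) c.
Proof.
case: k => [|k] /=; last exact: xs_bdry.
by rewrite xs_map; apply: eq_xs => s; rewrite xs1.
Qed.

Lemma xs_abd_flatten (S : Type) f k (g : S -> chain) c :
  xs f (abd k (flatten (map g c))) = xs (fun s => xs f (abd k (g s))) c.
Proof. by rewrite xs_abd xs_flatten; apply: eq_xs => s; rewrite -xs_abd. Qed.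

Section Boundaries.
Variables (d : nat).
Implicit Types (X Y : pset) (c : chain).

(** The generator of degree -1 turns the parity condition in degree 0 into a boundary condition, so
    all degrees can be treated alike. *)
Lemma is_rcycleP X k c : is_rcycle d X k c <-> is_chain d X k c /\ ceq (abd k c) [::].
Proof.
rewrite /is_rcycle; case: k => [|k] /=; last by rewrite chain_zeroP.
split=> -[cc h]; split=> //.
  move=> f; rewrite xs_map xs_nil; move: h; rewrite evenE -[length c]/(size c) => /negbTE.
  rewrite -xs_true /comp; case: (f point0) => [->//|_].
  exact: xs0.
have := h xpredT; rewrite xs_map xs_nil evenE => e.
by rewrite -[length c]/(size c) -xs_true; rewrite /comp in e; rewrite e.
Qed.

Lemma is_bdryP X k c :
  is_bdry d X k c <-> exists2 w, is_chain d X k.+1 w & ceq (bdry k.+1 w) c.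
Proof.
split=> [[w [cw /chain_zeroP h]]|[w cw h]].
  by exists w => // f; have := h f; rewrite xs_cat xs_nil; case: xs; case: xs.
by exists w; split=> //; apply/chain_zeroP => f; rewrite xs_cat h addbb xs_nil.
Qed.

Lemma sing_simplex_sub X Y k s :
  (forall x, X x -> Y x) -> sing_simplex d X k s -> sing_simplex d Y k s.
Proof. by move=> XY [h1 h2]; split=> // t /h1 [/XY]. Qed.

Lemma is_chain_sub X Y k c : (forall x, X x -> Y x) -> is_chain d X k c -> is_chain d Y k c.
Proof. by move=> XY; apply: List.Forall_impl => s; apply: sing_simplex_sub. Qed.

Lemma is_bdry_sub X Y k c : (forall x, X x -> Y x) -> is_bdry d X k c -> is_bdry d Y k c.
Proof. by move=> XY [w [cw h]]; exists w; split=> //; apply: is_chain_sub cw. Qed.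

Lemma is_bdry_ceq X k c c' : ceq c c' -> is_bdry d X k c -> is_bdry d X k c'.
Proof. by move=> cc /is_bdryP [w cw h]; apply/is_bdryP; exists w => // f; rewrite h. Qed.

Lemma is_bdry_cat X k c c' : is_bdry d X k c -> is_bdry d X k c' -> is_bdry d X k (c ++ c').
Proof.
move=> /is_bdryP [w cw h] /is_bdryP [w' cw' h']; apply/is_bdryP.
exists (w ++ w'); first exact/Forall_cat.
by move=> f; rewrite xs_bdry !xs_cat -!xs_bdry h h'.
Qed.

Lemma is_bdry_flatten (S : eqType) X k (g : S -> chain) (l : seq S) :
  {in l, forall s, is_bdry d X k (g s)} -> is_bdry d X k (flatten (map g l)).
Proof.
elim: l => [_|s l IH h] /=.
  by apply/is_bdryP; exists [::]; [constructor|move=> f].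
apply: is_bdry_cat; first by apply: h; rewrite inE eqxx.
by apply: IH => t tl; apply: h; rewrite inE tl orbT.
Qed.
End Boundaries.

Section Systems.
Variables (d k b : nat).

(** These properties survive the passage to fewer vertices, where each face is replaced by a set of
    old vertices. The Betti bound excludes the empty face, whose set is at the outset the
    intersection of the whole family. *)
Record good_system n (X : {set 'I_n} -> pset) : Prop := GoodSystem {
  sys_mono : forall A B : {set 'I_n}, A \subset B -> forall x, X A x -> X B x;
  sys_disj : forall A B : {set 'I_n}, [disjoint A & B] -> forall x, X A x -> ~ X B x;
  sys_betti : forall A : {set 'I_n}, A != set0 -> forall i, i < k -> rbetti_le d (X A) i b }.

(* Sending the empty face to the generator of degree -1 forces an odd number of points in the
   image of each vertex. *)
Record carried_map l n (X : {set 'I_n} -> pset) (g : {set 'I_n} -> chain) : Prop := CarriedMap {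
  cmap0 : g set0 = [:: point0];
  cmap_chain : forall A : {set 'I_n}, 0 < #|A| <= l.+1 -> is_chain d (X A) #|A|.-1 (g A);
  cmap_bdry : forall A : {set 'I_n}, 0 < #|A| <= l.+1 -> forall f,
    xs f (abd #|A|.-1 (g A)) = \big[addb/false]_(x in A) xs f (g (A :\ x)) }.

Definition gbd n (g : {set 'I_n} -> chain) (A : {set 'I_n}) : chain := flatten (map g (sbd A)).

Lemma xs_gbd n g (A : {set 'I_n}) f :
  xs f (gbd g A) = \big[addb/false]_(x in A) xs f (g (A :\ x)).
Proof. by rewrite xs_flatten xs_sbd. Qed.

Lemma gbd_cycle l n X g (A : {set 'I_n}) : good_system X -> carried_map l X g ->
  #|A| = l.+2 -> is_rcycle d (X A) l (gbd g A).
Proof.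
move=> sX cg cA.
have cA1 x : x \in A -> #|A :\ x| = l.+1 by move=> xA; have := cardsD1 x A; rewrite xA cA; lia.
apply/is_rcycleP; split.
  apply: Forall_flatten; apply/Forall_inP => B /mapP [x]; rewrite mem_enum => xA ->.
  apply: (is_chain_sub (sys_mono sX (subsetDl A [set x]))).
  by have := cmap_chain cg (A := A :\ x); rewrite (cA1 _ xA) leqnn; apply.
move=> f; rewrite xs_abd_flatten xs_sbd xs_nil -[RHS](sbd_sbd0 A (fun B => xs f (g B))).
apply: eq_bigr => x xA; have := cmap_bdry cg (A := A :\ x); rewrite (cA1 _ xA) leqnn /= => -> //.
Qed.

Lemma xs_select f (m : seq bool) (l : seq chain) : size m = size l ->
  xs f (select m l) = \big[addb/false]_(i < size m) (nth false m i && xs f (nth [::] l i)).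
Proof.
elim: m l => [|a m IH] [|c l] //= => [_|[sm]]; first by rewrite big_ord0 xs_nil.
by rewrite big_ord_recl xs_cat IH //=; case: a; rewrite ?xs_nil.
Qed.

Lemma xs_select_iota f (m : seq bool) (F : nat -> chain) n : size m = n ->
  xs f (select m [seq F i | i <- iota 0 n]) =
  \big[addb/false]_(i < n) (nth false m i && xs f (F i)).
Proof.
move=> sm; rewrite xs_select ?size_map ?size_iota // sm; apply: eq_bigr => i _.
by rewrite (nth_map 0) ?size_iota // nth_iota.
Qed.

(** The [l + 2] entries are the vertices of an [l + 1]-face, whose boundary is carried to an
    [l]-cycle. *)
Definition block l (T : Type) (Z : seq T) i := take l.+2 (drop (i * l.+2) Z).

(** The boundaries of the [b + 1] blocks are cycles in one set whose Betti number is at most [b];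
    the coefficients of a dependency serve as the colour of [Z]. *)
Lemma exists_color l n (X : {set 'I_n} -> pset) g (Z : seq 'I_n) :
  l < k -> good_system X -> carried_map l X g -> uniq Z -> size Z = l.+2 * b.+1 ->
  exists m : b.+1.-tuple bool, true \in m /\
    is_bdry d (X [set x in Z]) l
      (select m [seq gbd g [set x in block l Z i] | i <- iota 0 b.+1]).
Proof.
move=> lk sX cg uZ sZ.
have Z0 : [set x in Z] != set0.
  by case: Z sZ {uZ} => // x Z _; apply/set0Pn; exists x; rewrite !inE eqxx.
have [||m [sm [tm hm]]] := sys_betti sX Z0 lk (zs := [seq gbd g [set x in block l Z i] | i <- iota 0 b.+1]).
- by rewrite [LHS](size_map _ (iota 0 b.+1)) size_iota.
- apply/Forall_map/Forall_inP => i; rewrite mem_iota add0n /= => ib.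
  have sb : size (block l Z i) = l.+2.
    rewrite /block size_takel // size_drop sZ.
    have := leq_mul (leqnn l.+2) (ltn0Sn 0); nia.
  have ub : uniq (block l Z i) by rewrite take_uniq // drop_uniq.
  have sub : [set x in block l Z i] \subset [set x in Z].
    by apply/subsetP => x; rewrite !inE => /mem_take/mem_drop.
  have /is_rcycleP [h1 h2] := @gbd_cycle l n X g [set x in block l Z i] sX cg
     (etrans (cardsE _) (etrans (card_uniqP ub) sb)).
  apply/is_rcycleP; split=> //; apply: is_chain_sub h1; exact: sys_mono sX _ _ sub.
have sm' : size m == b.+1 by apply/eqP.
have tm' : true \in m.
  by elim: {hm sm sm'} m tm => //= a m IH [->|/IH mt]; rewrite inE ?eqxx // mt orbT.
by exists (Tuple sm').
Qed.
End Systems.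

Lemma setU1_sub (I : finType) (x : I) (A : {set I}) (C : {pred I}) :
  x \in C -> A \subset C -> x |: A \subset C.
Proof. by move=> xC /subsetP AC; apply/subsetP => y /setU1P[->|/AC]. Qed.

(** * From the [l]-skeleton to the [l + 1]-skeleton *)

Section Step.
Variables (d k b l N n : nat) (X : {set 'I_n} -> pset) (g : {set 'I_n} -> chain).
Hypotheses (lk : l < k) (sX : good_system d k b X) (cg : carried_map d l X g).

Let q := l.+2 * b.+1.
Let es := enum {set 'I_N}.
Let T := size es.
(** Besides the [N] vertices and an apex for each of the [T] faces, either end holds [q] spare
    vertices per face, enough whichever block is to vary. *)
Let M := q * T + (N + T + q * T).

Variables (Y : seq 'I_n) (mu : b.+1.-tuple bool).
Hypotheses (uY : uniq Y) (sY : size Y = M) (tmu : true \in mu).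
Hypothesis hY : forall Z, subseq Z Y -> size Z = q ->
  is_bdry d (X [set x in Z]) l
      (select mu [seq gbd g [set x in block l Z i] | i <- iota 0 b.+1]).

Lemma T_gt0 : 0 < T.
Proof. by rewrite /T -cardE; apply/card_gt0P; exists set0. Qed.

Lemma idx_lt (s : {set 'I_N}) : index s es < T.
Proof. by rewrite index_mem mem_enum. Qed.

Lemma nth_es s : nth set0 es (index s es) = s.
Proof. by rewrite nth_index // mem_enum. Qed.

(* The face of the new simplex to which the [j]-th element of [Y] is allotted: the middle part
   of [Y] holds the vertices and the apexes, both ends hold spare vertices. *)
Definition owner j : {set 'I_N} :=
  if j < q * T then nth set0 es (j %/ q)
  else if j < q * T + N then [set i | val i == j - q * T]
  else if j < q * T + (N + T) then nth set0 es (j - q * T - N)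
  else nth set0 es ((j - (q * T + (N + T))) %/ q).

(** Entries owned by the empty face are left out: they would lie over every face and spoil
    disjointness. *)
Definition spread (s : {set 'I_N}) : {set 'I_n} :=
  [set x in Y | (owner (index x Y) != set0) && (owner (index x Y) \subset s)].

Definition y0 : 'I_n. Proof. by case: Y sY => [|y //]; have := T_gt0; rewrite /M /=; lia. Qed.

Definition vtx (i : 'I_N) := nth y0 Y (q * T + i).
Definition apx (s : {set 'I_N}) := nth y0 Y (q * T + (N + index s es)).

Lemma owner_vtx i : owner (index (vtx i) Y) = [set i].
Proof.
have iN := ltn_ord i.
rewrite index_uniq //; last by rewrite sY /M; have := T_gt0; lia.
rewrite /owner ifN ?ifT; try lia.
by apply/setP => j; rewrite !inE addKn.
Qed.

Lemma owner_apx s : owner (index (apx s) Y) = s.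
Proof.
have iN := idx_lt s.
rewrite index_uniq //; last by rewrite sY /M; lia.
rewrite /owner 2?ifN ?ifT; try lia.
by rewrite (_ : _ - _ = index s es) ?nth_es //; lia.
Qed.

Definition mid := take (N + T) (drop (q * T) Y).

Lemma nth_mid j : j < N + T -> nth y0 Y (q * T + j) \in mid.
Proof.
move=> jN; rewrite -nth_drop -(@nth_take (N + T)) //; apply: mem_nth.
by rewrite size_takel // size_drop sY /M; lia.
Qed.
Lemma vtx_mid i : vtx i \in mid.
Proof. by apply: nth_mid; have := ltn_ord i; lia. Qed.
Lemma apx_mid s : apx s \in mid.
Proof. by apply: nth_mid; have := idx_lt s; lia. Qed.
Lemma mid_sub x : x \in mid -> x \in Y.
Proof. by move=> /mem_take/mem_drop. Qed.

Lemma vtx_inj : injective vtx.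
Proof.
move=> i j /(congr1 (fun x => owner (index x Y))); rewrite !owner_vtx => /setP /(_ i).
by rewrite !inE eqxx => /esym/eqP.
Qed.

Lemma apx_neq s i : apx s != vtx i.
Proof.
have := ltn_ord i; have := idx_lt s => h1 h2.
rewrite /apx /vtx nth_uniq // ?sY /M; last 2 [lia|lia].
by apply/eqP; lia.
Qed.

Lemma vtx_spread i (s : {set 'I_N}) : i \in s -> vtx i \in spread s.
Proof.
move=> si; rewrite inE mid_sub ?vtx_mid // owner_vtx sub1set si andbT /=.
by apply/set0Pn; exists i; rewrite inE.
Qed.

Lemma apx_spread (r s : {set 'I_N}) : r != set0 -> r \subset s -> apx r \in spread s.
Proof. by move=> r0 rs; rewrite inE mid_sub ?apx_mid // owner_apx r0 rs. Qed.

Lemma spread_mono (s t : {set 'I_N}) : s \subset t -> spread s \subset spread t.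
Proof.
move=> st; apply/subsetP => x; rewrite !inE => /and3P[-> -> /=].
by move=> h; apply: subset_trans h st.
Qed.

Lemma spread_sys : good_system d k b (fun s => X (spread s)).
Proof.
split=> [A B AB|A B AB|A A0 i ik].
- exact/(sys_mono sX)/spread_mono.
- apply: (sys_disj sX); rewrite -setI_eq0; apply/eqP/setP => x; rewrite !inE.
  apply/negP => /andP[/and3P[_ n0 oA] /and3P[_ _ oB]]; case/negP: n0.
  by rewrite -subset0 -(disjoint_setI0 AB) subsetI oA.
- apply: (sys_betti sX) ik; have /set0Pn [j jA] := A0.
  by apply/set0Pn; exists (vtx j); apply: vtx_spread.
Qed.

(** The block that varies: its coefficient in the common relation is nonzero. *)
Let a := index true mu.
Lemma a_lt : a < b.+1.
Proof. by rewrite -(size_tuple mu) index_mem. Qed.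

Definition fillL s := take (a * l.+2) (drop (q * index s es) (take (q * T) Y)).
Definition fillR s :=
  take ((b - a) * l.+2) (drop (q * index s es) (drop (N + T) (drop (q * T) Y))).

Lemma q_idx s : q * index s es + q <= q * T.
Proof. by rewrite -mulnSr leq_mul2l idx_lt orbT. Qed.

Lemma aq : a * l.+2 + ((b - a) * l.+2 + l.+2) = q.
Proof. by rewrite /q mulnC; have := a_lt; nia. Qed.

Lemma size_fillL s : size (fillL s) = a * l.+2.
Proof.
have := q_idx s; have := aq => h1 h2; rewrite size_takel // size_drop size_takel ?sY /M; lia.
Qed.
Lemma size_fillR s : size (fillR s) = (b - a) * l.+2.
Proof.
have := q_idx s; have := aq => h1 h2; rewrite size_takel // !size_drop sY /M; lia.
Qed.

Lemma owner_fillL s x : x \in fillL s -> x \in Y /\ owner (index x Y) = s.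
Proof.
move=> xL; split; first by move: xL => /mem_take/mem_drop/mem_take.
move: xL => /(nthP y0) [j]; rewrite size_fillL => jl <-.
have h1 := q_idx s; have h2 := aq.
rewrite nth_take // nth_drop nth_take; last by lia.
rewrite index_uniq ?sY //; last by rewrite /M; lia.
rewrite /owner ifT; last by lia.
by rewrite mulnC divnMDl ?divn_small ?addn0 ?nth_es //; lia.
Qed.

Lemma owner_fillR s x : x \in fillR s -> x \in Y /\ owner (index x Y) = s.
Proof.
move=> xR; split; first by move: xR => /mem_take/mem_drop/mem_drop/mem_drop.
move: xR => /(nthP y0) [j]; rewrite size_fillR => jl <-.
have h1 := q_idx s; have h2 := aq.
rewrite nth_take // !nth_drop index_uniq ?sY //; last by rewrite /M; lia.
rewrite /owner !ifN; try lia.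
rewrite (_ : _ - _ = index s es * q + j); last by lia.
by rewrite divnMDl ?divn_small ?addn0 ?nth_es //; lia.
Qed.

(** Position [a] is left empty: [filler s] is the part of the relation that the varied block does
    not touch. *)
Definition fillB s i :=
  if i < a then gbd g [set x in block l (fillL s) i]
  else if i == a then [::] else gbd g [set x in block l (fillR s) (i - a.+1)].

Definition filler s : chain := select mu [seq fillB s i | i <- iota 0 b.+1].

(* [A] is inserted as block number [a] between the spare vertices of [s], so that all other
   blocks, hence the class of the boundary of [A], do not depend on [A]. *)
Lemma facet_cycle_bdry s (A : {set 'I_n}) : s != set0 -> A \subset mid -> A \subset spread s ->
  #|A| = l.+2 -> is_bdry d (X (spread s)) l (gbd g A ++ filler s).
Proof.
move=> s0 Amid As cA.
pose LA := [seq x <- mid | x \in A].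
have umid : uniq mid by rewrite take_uniq // drop_uniq.
have LAE : LA =i A.
  by move=> x; rewrite mem_filter andb_idr // => /(subsetP Amid).
have sLA : size LA = l.+2 by rewrite -cA -(card_uniqP (filter_uniq _ umid)); apply: eq_card.
pose Z := fillL s ++ LA ++ fillR s.
have ZY : subseq Z Y.
  rewrite -(cat_take_drop (q * T) Y) -(cat_take_drop (N + T) (drop (q * T) Y)).
  apply: cat_subseq; first exact: subseq_trans (take_subseq _ _) (drop_subseq _ _).
  apply: cat_subseq; first exact: filter_subseq.
  exact: subseq_trans (take_subseq _ _) (drop_subseq _ _).
have sZ : size Z = q by rewrite !size_cat size_fillL size_fillR sLA -aq; lia.
have Zs : [set x in Z] \subset spread s.
  apply/subsetP => x; rewrite inE !mem_cat => /or3P[||].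
  - by move=> /owner_fillL [xY ox]; rewrite inE xY ox s0 subxx.
  - by rewrite LAE => /(subsetP As).
  - by move=> /owner_fillR [xY ox]; rewrite inE xY ox s0 subxx.
have := is_bdry_sub (sys_mono sX Zs) (hY ZY sZ); apply: is_bdry_ceq => f.
have a_ltb := a_lt.
have smu : size mu = b.+1 by rewrite size_tuple.
rewrite xs_cat /filler !xs_select_iota //.
rewrite (bigD1 (Ordinal a_ltb)) //= [in RHS](bigD1 (Ordinal a_ltb)) //= addbA.
have -> : nth false mu a = true by rewrite nth_index.
rewrite /fillB ltnn eqxx xs_nil addbF /=.
congr addb.
  congr (xs f (gbd g _)); apply/setP => x; rewrite !inE /block.
  by rewrite drop_size_cat ?size_fillL // take_size_cat.
apply: eq_bigr => -[i im]; rewrite -val_eqE /= => ia; congr andb.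
rewrite (negbTE ia).
case: ltnP => [lt_ia|le_ai]; congr (xs f (gbd g _)); apply/setP => x; rewrite !inE; congr (_ \in _).
  rewrite /block /Z drop_cat size_fillL ifT; last by nia.
  by rewrite takel_cat // size_drop size_fillL; nia.
have {}ia : a < i by lia.
rewrite /block /Z catA drop_cat size_cat size_fillL sLA ifN; last by rewrite -leqNgt; nia.
by congr (take _ (drop _ _)); nia.
Qed.

(** All the [gbd A] are homologous to the same chain [filler s], and an even number of copies of it
    cancels. *)
Lemma even_sum_bdry s (As : seq {set 'I_n}) : s != set0 -> ~~ odd (size As) ->
  {in As, forall A : {set 'I_n}, [/\ A \subset mid, A \subset spread s & #|A| = l.+2]} ->
  is_bdry d (X (spread s)) l (flatten (map (gbd g) As)).
Proof.
move=> s0 ev h.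
apply: (@is_bdry_ceq _ _ _ (flatten [seq gbd g A ++ filler s | A <- As])); last first.
  by apply: is_bdry_flatten => A /h [h1 h2 h3]; apply: facet_cycle_bdry.
move=> f; rewrite !xs_flatten; under eq_xs do rewrite xs_cat.
rewrite xs_add [X in _ (+) X](_ : _ = false) ?addbF //.
case: (xs f (filler s)); last exact: xs0.
by rewrite xs_true (negbTE ev).
Qed.

(** The apex is owned by [s], which keeps the cone inside [spread s]; one apex shared by all faces
    would destroy disjointness. *)
Definition cone (s : {set 'I_N}) (u : 'I_N) : {set 'I_n} := apx s |: vtx @: (s :\ u).

Lemma card_vtx (s : {set 'I_N}) : #|vtx @: s| = #|s|.
Proof. exact: card_imset vtx_inj. Qed.

Lemma apx_notin r (s : {set 'I_N}) : apx r \notin vtx @: s.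
Proof. by apply/imsetP => -[i _ e]; have := apx_neq r i; rewrite e eqxx. Qed.

Lemma vtxD1 (s : {set 'I_N}) u : vtx @: s :\ vtx u = vtx @: (s :\ u).
Proof.
apply/setP => x; rewrite !inE; apply/andP/imsetP => [[xu /imsetP[i si e]]|[i]].
  by exists i => //; rewrite !inE si andbT; apply: contraNneq xu => <-; rewrite e.
rewrite !inE => /andP[iu si] ->; split; last exact: imset_f.
by apply: contraNneq iu => /vtx_inj ->.
Qed.

Lemma apxD1 r (s : {set 'I_N}) : (apx r |: vtx @: s) :\ apx r = vtx @: s.
Proof. by rewrite setU1K ?apx_notin. Qed.

Lemma apx_vtxD1 r (s : {set 'I_N}) u :
  (apx r |: vtx @: s) :\ vtx u = apx r |: vtx @: (s :\ u).
Proof.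
rewrite -vtxD1; apply/setP => x; rewrite !inE; case: (x =P apx r) => [->|] //=.
by rewrite apx_neq.
Qed.

Lemma sum_vtx (s : {set 'I_N}) (h : {set 'I_n} -> bool) :
  \big[addb/false]_(x in vtx @: s) h (vtx @: s :\ x) =
  \big[addb/false]_(u in s) h (vtx @: (s :\ u)).
Proof.
rewrite big_imset /=; last by move=> *; apply: vtx_inj.
by apply: eq_bigr => u _; rewrite vtxD1.
Qed.

Lemma sum_apx r (s : {set 'I_N}) (h : {set 'I_n} -> bool) :
  \big[addb/false]_(x in apx r |: vtx @: s) h ((apx r |: vtx @: s) :\ x) =
  h (vtx @: s) (+) \big[addb/false]_(u in s) h (apx r |: vtx @: (s :\ u)).
Proof.
rewrite big_setU1 ?apx_notin //= apxD1; congr addb.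
rewrite big_imset /=; last by move=> *; apply: vtx_inj.
by apply: eq_bigr => u _; rewrite apx_vtxD1.
Qed.

Definition lower_map (s : {set 'I_N}) : chain :=
  if #|s| <= l then g (vtx @: s) else flatten [seq g (cone s u) | u <- enum s].

(** The facet [s :\ u] and the cone over its boundary together form the boundary of [B u]; summed
    over [u], the facets make up the boundary of [vtx @: s]. With the facets of [D] this gives
    [1 + (l + 2) + (l + 3)] boundaries, an even number. *)
Lemma lower_map_fills (s : {set 'I_N}) : #|s| = l.+2 ->
  exists2 w, is_chain d (X (spread s)) l.+1 w &
    ceq (bdry l.+1 w) (flatten [seq lower_map (s :\ u) | u <- enum s]).
Proof.
move=> cs; apply/is_bdryP.
have s0 : s != set0 by rewrite -card_gt0 cs.
have /set0Pn [u0 u0s] := s0.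
have cs1 u : u \in s -> #|s :\ u| = l.+1 by move=> us; have := cardsD1 u s; rewrite us cs; lia.
pose B u : {set 'I_n} := apx (s :\ u) |: vtx @: (s :\ u).
pose D : {set 'I_n} := apx (s :\ u0) |: vtx @: s.
have cB u : u \in s -> #|B u| = l.+2 by move=> us; rewrite cardsU1 apx_notin card_vtx cs1.
have cD : #|D| = l.+3 by rewrite cardsU1 apx_notin card_vtx cs.
(* The facets of [D] have boundaries with sum 0 and make the number of summands even. *)
pose As := vtx @: s :: [seq B u | u <- enum s] ++ sbd D.
have vtx_sub (t : {set 'I_N}) : t \subset s -> (vtx @: t \subset mid) && (vtx @: t \subset spread s).
  move=> ts; apply/andP; split; apply/subsetP => _ /imsetP [i it ->]; rewrite ?vtx_mid //.
  by apply: vtx_spread; apply: (subsetP ts).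
have apx_sub u : u \in s -> (apx (s :\ u) \in mid) && (apx (s :\ u) \in spread s).
  move=> us; rewrite apx_mid /= apx_spread ?subD1set //.
  by rewrite -card_gt0 cs1.
have Dsub : (D \subset mid) && (D \subset spread s).
  case/andP: (apx_sub _ u0s) => h1 h2; case/andP: (vtx_sub _ (subxx s)) => h3 h4.
  by rewrite !setU1_sub.
apply: (@is_bdry_ceq _ _ _ (flatten (map (gbd g) As))); last first.
  apply: even_sum_bdry => //.
    by rewrite /= size_cat !size_map -!cardE cs cD oddD /=; case: odd.
  move=> A; rewrite inE mem_cat => /or3P[/eqP->|/mapP[u]|/mapP[x]].
  - by case/andP: (vtx_sub _ (subxx s)) => -> ->; rewrite card_vtx.
  - rewrite mem_enum => us ->; rewrite cB //.
    case/andP: (apx_sub _ us) => h1 h2; case/andP: (vtx_sub _ (subD1set s u)) => h3 h4.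
    by rewrite !setU1_sub.
  - rewrite mem_enum => xD ->; case/andP: Dsub => D1 D2.
    have DD := subD1set D x.
    rewrite (subset_trans DD D1) (subset_trans DD D2); split=> //.
    by have := cardsD1 x D; rewrite xD cD; lia.
move=> f; set h := fun A => xs f (g A).
rewrite (@xs_flatten _ _ f (gbd g) As) (@xs_flatten _ _ f (fun u => lower_map (s :\ u)) (enum s)).
rewrite /As xs_cons xs_cat xs_sbd xs_map.
under [X in _ (+) (_ (+) X)]eq_bigr do rewrite xs_gbd.
rewrite (sbd_sbd0 D h) addbF xs_gbd (sum_vtx _ h) /xs !big_enum -big_split /=.
apply: eq_bigr => u us; rewrite -/(xs _ _) xs_gbd (sum_apx _ _ h) addbA addbb /=.
rewrite /lower_map cs1 // ltnn -/(xs f _) (@xs_flatten _ _ f (fun w => g (cone (s :\ u) w))) /xs big_enum /=; apply: eq_bigr => w _.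
by rewrite /h /cone.
Qed.

Lemma step_map : exists g', carried_map d l.+1 (fun s => X (spread s)) g'.
Proof.
have /choice [W hW] : forall s : {set 'I_N}, exists w : chain, #|s| = l.+2 ->
    is_chain d (X (spread s)) l.+1 w /\
    ceq (bdry l.+1 w) (flatten [seq lower_map (s :\ u) | u <- enum s]).
  move=> s; case: (#|s| =P l.+2) => [cs|cs]; last by exists [::].
  by have [w h1 h2] := lower_map_fills cs; exists w.
exists (fun s : {set 'I_N} => if #|s| == l.+2 then W s else lower_map s); split.
- by rewrite cards0 /= /lower_map cards0 leq0n imset0 (cmap0 cg).
- move=> s; case: eqP => [e _|ne sl]; first by have [] := hW _ e; rewrite e.
  rewrite /lower_map; case: ifPn => [sl'|]; last rewrite -ltnNge => sl'.
    rewrite -card_vtx; apply: (is_chain_sub (X := X (vtx @: s))).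
      apply: (sys_mono sX); apply/subsetP => _ /imsetP [i si ->]; exact: vtx_spread.
    by apply: (cmap_chain cg); rewrite card_vtx; lia.
  have cs : #|s| = l.+1 by lia.
  rewrite cs; apply: Forall_flatten; apply/Forall_inP => u; rewrite mem_enum => us.
  have cc : #|cone s u| = l.+1.
    by rewrite /cone cardsU1 apx_notin card_vtx -cs (cardsD1 u s) us.
  apply: (is_chain_sub (X := X (cone s u))).
    apply: (sys_mono sX); rewrite subUset sub1set apx_spread // -?card_gt0 ?cs //=.
    by apply/subsetP => _ /imsetP [i /setD1P[_ si] ->]; exact: vtx_spread.
  by have := cmap_chain cg (A := cone s u); rewrite cc leqnn; apply.
- move=> s sl f; case: eqP => [cs|cs].
    have [_ eW] := hW _ cs; rewrite {1}cs /= eW.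
    rewrite (@xs_flatten _ _ f (fun u => lower_map (s :\ u)) (enum s)) /xs big_enum /=.
    by apply: eq_bigr => u us; rewrite ifN //; apply/eqP => e;
      have := cardsD1 u s; rewrite us cs e; lia.
  transitivity (\big[addb/false]_(x in s) xs f (lower_map (s :\ x))); last first.
    apply: eq_bigr => u us; rewrite ifN //; apply/eqP => e.
    by have := cardsD1 u s; rewrite us e; lia.
  rewrite {1}/lower_map; case: ifPn => [sl'|]; last rewrite -ltnNge => sl'.
    rewrite -card_vtx (cmap_bdry cg) ?card_vtx; last by lia.
    rewrite (sum_vtx _ (fun A => xs f (g A))); apply: eq_bigr => u us.
    by rewrite /lower_map ifT //; have := cardsD1 u s; rewrite us; lia.
  have {}cs : #|s| = l.+1 by lia.
  rewrite cs xs_abd_flatten /xs big_enum /=.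
  have cc u : u \in s -> #|cone s u| = l.+1.
    by move=> us; rewrite /cone cardsU1 apx_notin card_vtx -cs (cardsD1 u s) us.
  under eq_bigr => u us.
    rewrite -/(xs _ _).
    have := cmap_bdry cg (A := cone s u); rewrite cc // leqnn /= => -> //.
    rewrite (sum_apx _ _ (fun A => xs f (g A))).
    over.
  (* A term [apx s |: vtx @: (s :\ u :\ w)] comes from both orders of [u] and [w]. *)
  rewrite big_split /= sum_in_sym0 ?addbF; last first.
    by move=> u w _ _; rewrite setDDl (setUC [set u]) -setDDl.
  apply: eq_bigr => u us; rewrite /lower_map ifT //.
  by move: (cardsD1 u s); rewrite us cs add1n => -[<-].
Qed.
End Step.

Lemma carried_map_step d k b l N : l < k -> exists n0, forall n X g, n0 <= n ->
  @good_system d k b n X -> carried_map d l X g ->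
  exists X' g', @good_system d k b N X' /\ carried_map d l.+1 X' g'.
Proof.
move=> lk.
pose T := size (enum {set 'I_N}).
have [n0 hn0] := ramsey (b.+1.-tuple bool) (l.+2 * b.+1)
  (l.+2 * b.+1 * T + (N + T + l.+2 * b.+1 * T)).
exists n0 => n X g n0n sX cg.
have /choice [col hcol] : forall Z : seq 'I_n, exists m : b.+1.-tuple bool,
    uniq Z -> size Z = l.+2 * b.+1 -> true \in m /\
    is_bdry d (X [set x in Z]) l
      (select m [seq gbd g [set x in block l Z i] | i <- iota 0 b.+1]).
  move=> Z; have [[uZ sZ]|h] := pselect (uniq Z /\ size Z = l.+2 * b.+1); last first.
    by exists [tuple of nseq _ true] => uZ sZ; case: h.
  by have [m hm] := exists_color lk sX cg uZ sZ; exists m.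
have [|Y [mu [YX sY hY]]] := hn0 _ (enum 'I_n) col; first by rewrite size_enum_ord.
have uY : uniq Y by apply: subseq_uniq YX (enum_uniq _).
have hZ Z : subseq Z Y -> size Z = l.+2 * b.+1 -> true \in mu /\
    is_bdry d (X [set x in Z]) l
      (select mu [seq gbd g [set x in block l Z i] | i <- iota 0 b.+1]).
  move=> ZY sZ; have := hcol Z (subseq_uniq ZY uY) sZ.
  by rewrite hY.
(* [Y] contains at least one set of [l.+2 * b.+1] vertices, so the common colour is actually
   attained and therefore has a nonzero entry. *)
have Y_ge : l.+2 * b.+1 <= size Y.
  rewrite sY; have : 0 < T by rewrite /T -cardE; apply/card_gt0P; exists set0.
  nia.
have [tmu _] := hZ (take (l.+2 * b.+1) Y) (take_subseq _ _) (size_takel Y_ge).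
have hY' Z ZY sZ := (hZ Z ZY sZ).2.
have [g' hg'] := step_map lk sX cg uY sY tmu hY'.
exists (fun s => X (spread b l Y s)), g'; split=> //.
by eapply spread_sys; eassumption.
Qed.

(** * The system of a minimal family with empty intersection *)

Section Initial.
Variables (d k b : nat) (G : seq pset).
Hypotheses (nG : List.NoDup G) (eG : ~ nonempty (inter d G))
  (mG : forall G', proper_subfam G' G -> nonempty (inter d G'))
  (bG : forall G', proper_subfam G' G -> forall i, i < k -> rbetti_le d (inter d G') i b).

Let U j : pset := nth (fun=> True) G j.

Lemma In_U (V : pset) : List.In V G <-> exists2 j, j < size G & U j = V.
Proof.
rewrite /U; elim: (G) => [|W H IH] /=; first by split=> // -[].
split=> [[->|/IH [j jH e]]|[[|j] jH e]]; [by exists 0|by exists j.+1|by left|].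
by right; apply/IH; exists j.
Qed.

Lemma U_inj i j : i < size G -> j < size G -> U i = U j -> i = j.
Proof.
rewrite /U => iG jG e; elim: (G) nG i j iG jG e => [//|W H IH] /List.NoDup_cons_iff [WH nH].
have nthIn i : i < size H -> List.In (nth (fun=> True) H i) H.
  by elim: (H) i => // V H' IH' [|i] /=; [left|move/IH'; right].
move=> [|i] [|j] //= iG jG e.
- by case: WH; rewrite e; apply: nthIn.
- by case: WH; rewrite -e; apply: nthIn.
- by congr S; apply: IH.
Qed.

Variables (N : nat) (NG : N <= size G).

(** Only the first [N] members become vertices; the remaining ones occur in [others A] for every
    [A]. *)
Definition others (A : {set 'I_N}) : seq pset :=
  [seq U j | j <- iota 0 (size G) & j \notin [seq val i | i <- enum A]].

Lemma mem_val (A : {set 'I_N}) i : (val i \in [seq val i | i <- enum A]) = (i \in A).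
Proof. by rewrite mem_map ?mem_enum //; apply: val_inj. Qed.

Lemma In_others (A : {set 'I_N}) V : List.In V (others A) <->
  exists j, [/\ j < size G, j \notin [seq val i | i <- enum A] & U j = V].
Proof.
rewrite /others; split.
  move/List.in_map_iff => [j [e]] hj; exists j; move: hj.
  have mem_In (s : seq nat) : List.In j s -> j \in s.
    by elim: s => //= a s IH [->|/IH js]; rewrite inE ?eqxx // js orbT.
  by move/mem_In; rewrite mem_filter mem_iota => /andP[-> /andP[_]].
move=> [j [jG jA <-]]; apply: (List.in_map U).
have In_mem (s : seq nat) : j \in s -> List.In j s.
  by elim: s => //= a s IH; rewrite inE => /predU1P[->|/IH]; [left|right].
by apply: In_mem; rewrite mem_filter jA mem_iota.
Qed.

Lemma others_proper (A : {set 'I_N}) : A != set0 -> proper_subfam (others A) G.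
Proof.
move=> /set0Pn [i iA]; have iG : val i < size G := leq_trans (ltn_ord i) NG.
split=> [V|]; first by move=> /In_others [j [jG _ <-]]; apply/In_U; exists j.
exists (U (val i)); split; first by apply/In_U; exists (val i).
move=> /In_others [j [jG jA /(U_inj jG iG) e]].
by rewrite e mem_val iA in jA.
Qed.

(** Every index is missing from one of two disjoint sets, so a common point of their intersections
    would lie in all members of [G]. *)
Lemma initial_system : good_system d k b (fun A : {set 'I_N} => inter d (others A)).
Proof.
split.
- move=> A B /subsetP AB x [xd h]; split=> // V /In_others [j [jG jB <-]].
  apply: h; apply/In_others; exists j; split=> //.
  by apply: contra jB => /mapP [i]; rewrite mem_enum => iA ->; rewrite mem_val AB.
- move=> A B AB x [xd hA] [_ hB]; apply: eG; exists x; split=> // V /In_U [j jG <-].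
  case: (boolP (j \in [seq val i | i <- enum A])) => [/mapP [i]|jA]; last first.
    by apply: hA; apply/In_others; exists j.
  rewrite mem_enum => iA e; apply: hB; apply/In_others; exists j; split=> //.
  by rewrite e mem_val; rewrite disjoint_subset in AB; apply: (subsetP AB).
- by move=> A /others_proper; apply: bG.
Qed.

Definition const_simplex (p : point) : point -> point :=
  fun t => if pdec (std_simplex 0 t) then p else zero_point.

Lemma supdistxx n x : supdist n x x = Rdefinitions.IZR BinNums.Z0.
Proof.
by elim: n => //= n ->; rewrite RIneq.Rminus_diag Rbasic_fun.Rabs_R0 Rbasic_fun.Rmax_left //; apply: RIneq.Rle_refl.
Qed.

Lemma const_simplexP (X : pset) p : X p -> inRd d p -> sing_simplex d X 0 (const_simplex p).
Proof.
move=> Xp dp; rewrite /const_simplex; split; last split.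
- by move=> t /pdecP ->.
- by move=> t ht; case: pdecP.
- move=> t /pdecP ht e e0; exists e; split=> // u /pdecP hu _.
  by rewrite ht hu supdistxx.
Qed.

Lemma initial_map : exists g, carried_map d 0 (fun A : {set 'I_N} => inter d (others A)) g.
Proof.
have /choice [p hp] : forall i : 'I_N, exists x, inter d (others [set i]) x.
  by move=> i; apply: mG; apply: others_proper; apply/set0Pn; exists i; rewrite inE.
exists (fun A : {set 'I_N} => if [pick i in A] is Some i then [:: const_simplex (p i)] else [:: point0]).
split.
- by case: pickP => // i; rewrite inE.
- move=> A cA; have /cards1P [i ->] : #|A| == 1 by lia.
  rewrite cards1; case: pickP => [j|/(_ i)]; rewrite inE ?eqxx // => /eqP ->.
  by constructor=> //; apply: const_simplexP => //; have [] := hp i.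
- move=> A cA f; have /cards1P [i ->] : #|A| == 1 by lia.
  rewrite cards1 big_set1 setDv; case: pickP => [j|/(_ i)]; rewrite inE ?eqxx // => /eqP ->.
  by case: pickP => [j'|_]; rewrite ?inE // !xs1.
Qed.
End Initial.

(** The induction runs over all [N] at once because each step consumes vertices: to have [N] of them
    at level [l + 1], Ramsey's theorem demands many more at level [l]. *)
Lemma constrained_map d b k l : l <= k -> forall N, exists n0, forall G : seq pset,
  List.NoDup G -> ~ nonempty (inter d G) ->
  (forall G', proper_subfam G' G -> nonempty (inter d G')) ->
  (forall G', proper_subfam G' G -> forall i, i < k -> rbetti_le d (inter d G') i b) ->
  n0 <= size G ->
  exists X g, @good_system d k b N X /\ carried_map d l X g.
Proof.
elim: l => [_ N|l IH lk N].
  exists N => G nG eG mG bG NG; exists (fun A => inter d (others G A)).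
  have [g cg] := initial_map nG mG NG; exists g; split=> //.
  exact: initial_system.
have [n1 hn1] := carried_map_step d b N lk.
have [n0 hn0] := IH (ltnW lk) n1.
exists n0 => G nG eG mG bG /(hn0 G nG eG mG bG) [X [g [sX cg]]].
exact: hn1 sX cg.
Qed.
End ConstrainedMaps.

Module GeneralPosition.
Import all_boot all_order all_algebra boolp ring lra zify ConstrainedMaps.
Import Order.TTheory GRing.Theory Num.Theory.
Close Scope R_scope.
Local Open Scope ring_scope.

(** * General position and crossing simplices *)

Section TupleBoundary.
Variable V : Type.
Implicit Types (P : seq V) (c : seq (seq V)).

(** Affine simplices are ordered vertex tuples. The boundary of a one-element tuple is the empty
    tuple, the generator of degree -1. *)
Fixpoint tbd P : seq (seq V) := if P is x :: P' then P' :: map (cons x) (tbd P') else [::].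

Definition cbd c := flatten (map tbd c).

Lemma xs_cbd f c : xs f (cbd c) = xs (fun P => xs f (tbd P)) c.
Proof. exact: xs_flatten. Qed.

Lemma tbd_tbd f P : xs f (cbd (tbd P)) = false.
Proof.
elim: P f => [|x P IH] f; first by rewrite /cbd xs_nil.
rewrite /= /cbd /= xs_cat -map_comp xs_flatten.
rewrite [X in _ (+) X](eq_xs (g := fun P' => f P' (+) xs (fun Q => f (x :: Q)) (tbd P'))); last first.
  by move=> P'; rewrite /= xs_cons xs_map.
by rewrite xs_add -xs_cbd IH addbF addbb.
Qed.

Lemma cbd_cbd f c : xs f (cbd (cbd c)) = false.
Proof.
rewrite !xs_cbd -(xs0 (f := fun=> false) c) //; apply: eq_xs => P.
by rewrite -xs_cbd tbd_tbd.
Qed.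

Lemma size_tbd P : List.Forall (fun Q => (size Q).+1 = size P) (tbd P).
Proof.
elim: P => [|x P IH] /=; constructor=> //; apply/Forall_map.
by apply: List.Forall_impl IH => Q /= ->.
Qed.

End TupleBoundary.

Lemma xs_cbd_cone (V : Type) (f : seq V -> bool) u c :
  xs f (cbd (map (cons u) c)) = xs f c (+) xs (f \o cons u) (cbd c).
Proof.
rewrite !xs_cbd xs_map -xs_add; apply: eq_xs => P.
by rewrite /= xs_cons xs_map.
Qed.

Lemma tbd_map (V W : Type) (f : V -> W) P : tbd (map f P) = map (map f) (tbd P).
Proof. by elim: P => //= x P ->; rewrite -!map_comp. Qed.

Lemma cbd_map (V W : Type) (f : V -> W) c : cbd (map (map f) c) = map (map f) (cbd c).
Proof.
rewrite /cbd map_flatten -!map_comp; congr flatten; apply: eq_map => P /=; exact: tbd_map.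
Qed.

Lemma sub_tbd (V : eqType) (P Q : seq V) : Q \in tbd P -> {subset Q <= P}.
Proof.
elim: P Q => //= x P IH Q; rewrite inE => /predU1P [->|/mapP [Q' /IH h ->]] y.
  by rewrite inE => ->; rewrite orbT.
by rewrite !inE => /predU1P [->|/h ->]; rewrite ?eqxx ?orbT.
Qed.

Section GeneralPosition.
Variables (R : realFieldType) (n : nat) (V : eqType).
Implicit Types (kap : V -> nat -> R) (S L P Q : seq V).

(** Coordinate 0 is the homogenizing one: where [kap x 0] is 1, these are the affine dependencies of
    points of [R^n]. *)
Definition dependency kap S (lam : V -> R) :=
  forall i, (i <= n)%N -> \sum_(x <- S) lam x * kap x i = 0.

Definition general_position kap L := forall S, uniq S -> {subset S <= L} ->
  (size S <= n.+1)%N -> forall lam, dependency kap S lam -> {in S, forall x, lam x = 0}.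

Lemma left_kernel p q (A : 'M[R]_(q, p)) : (p < q)%N -> exists2 v : 'rV_q, v != 0 & v *m A = 0.
Proof.
move=> pq; have : kermx A != 0.
  by rewrite -mxrank_eq0 mxrank_ker subn_eq0 -ltnNge (leq_ltn_trans (rank_leq_col A)).
by case/rowV0Pn => v /sub_kermxP vA v0; exists v.
Qed.

Lemma exists_dependency kap S : uniq S -> (n.+1 < size S)%N ->
  exists lam, dependency kap S lam /\ exists2 x, x \in S & lam x != 0.
Proof.
case: S => // x0 S; set S' := x0 :: S => uS sS.
have [v v0 vA] := left_kernel (\matrix_(j < size S', i < n.+1) kap (nth x0 S' j) i) sS.
exists (fun x => v 0 (inord (index x S'))); split=> [i iN|].
  rewrite (big_nth x0) big_mkord; have /rowP /(_ (inord i)) := vA.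
  rewrite !mxE => e; apply: etrans e; apply: eq_bigr => j _.
  by rewrite mxE index_uniq // inordK // inord_val.
have /rV0Pn [j vj] := v0; exists (nth x0 S' j); first by rewrite mem_nth.
by rewrite index_uniq // inord_val.
Qed.

Definition ev (a : nat -> R) (c : nat -> R) := \sum_(i < n.+1) a i * c i.

Lemma exists_functional kap S : (size S <= n)%N ->
  exists a : nat -> R, {in S, forall x, ev a (kap x) = 0} /\ exists2 i, (i <= n)%N & a i != 0.
Proof.
move=> sS.
have [v v0 vA] := left_kernel (\matrix_(i < n.+1, j < size S) kap (tnth (in_tuple S) j) i)
  (sS : size S < n.+1)%N.
exists (fun i => v 0 (inord i)); split=> [x xS|].
  have /rowP /(_ (Ordinal (etrans (index_mem x S) xS))) := vA.
  rewrite !mxE => e; apply: etrans e; apply: eq_bigr => i _; rewrite mxE inord_val (tnth_nth x) /=.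
  by rewrite nth_index.
have /rV0Pn [j vj] := v0; exists (nat_of_ord j); first by rewrite -ltnS.
by rewrite inord_val.
Qed.

Lemma ev_dependency kap S lam a : dependency kap S lam ->
  \sum_(x <- S) lam x * ev a (kap x) = 0.
Proof.
move=> h; under eq_bigr do rewrite mulr_sumr.
rewrite exchange_big /= big1 // => i _.
under eq_bigr do rewrite mulrCA.
by rewrite -mulr_sumr h ?mulr0 // -ltnS.
Qed.

Lemma exists_small_nonroot (p : {poly R}) (e : R) : p != 0 -> 0 < e ->
  exists2 t, 0 < t < e & p.[t] != 0.
Proof.
move=> p0 e0; pose rs := [seq e / j.+2%:R | j <- iota 0 (size p)].
have : ~~ all (root p) rs.
  apply/negP => ar; have := max_poly_roots p0 ar.
  rewrite size_map size_iota ltnn map_inj_uniq ?iota_uniq; first by move=> /(_ isT).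
  move=> i j /(mulfI (lt0r_neq0 e0)) /invr_inj /eqP; rewrite eqr_nat => /eqP.
  by case.
rewrite -has_predC => /hasP [t /mapP [j _ ->] pt]; exists (e / j.+2%:R) => //.
have j0 : 0 < j.+2%:R :> R by rewrite ltr0n.
rewrite divr_gt0 //= ltr_pdivrMr // -[ltLHS]mulr1 ltr_pM2l //.
by rewrite ltr1n.
Qed.

(* The new vertex moves along the curve [(t, t^2, ..., t^n)], which leaves every hyperplane
   except for finitely many [t]. *)
Lemma extend_general_position kap L y (c : nat -> R) (e : R) :
  uniq L -> y \notin L -> general_position kap L -> c 0%N = 1 -> 0 < e ->
  exists kap', [/\ forall x, x != y -> kap' x = kap x, kap' y 0%N = c 0%N,
    forall i, (i <= n)%N -> `|kap' y i - c i| < e & general_position kap' (y :: L)].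
Proof.
move=> uL yL gL c0 e0.
pose ct (t : R) (i : nat) := c i + (if i is 0%N then 0 else t ^+ i).
(* The mask [m] encodes a subset of [L]. If it has at most [n] points, the nonroots of its
   polynomial put the new point off a hyperplane through them. *)
have hm (m : (size L).-tuple bool) : exists p : {poly R}, p != 0 /\ forall t, p.[t] != 0 ->
    (size (mask m L) <= n)%N -> exists a, {in mask m L, forall x, ev a (kap x) = 0} /\ ev a (ct t) != 0.
  case: (leqP (size (mask m L)) n) => [sm|_]; last by exists 1; rewrite oner_neq0.
  have [a [h [i0 i0n ai0]]] := exists_functional kap sm.
  pose p : {poly R} := (ev a c)%:P + \poly_(i < n.+1) (if i is 0%N then 0 else a i).
  have pE t : p.[t] = ev a (ct t).
    rewrite hornerD hornerC horner_poly -big_split /=; apply: eq_bigr => -[[|i] ?] _ /=.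
      by rewrite /ct; ring.
    by rewrite /ct; ring.
  exists p; split; last by move=> t; rewrite pE; exists a.
  have coefp i : (i <= n)%N -> p`_i = (if i is 0%N then ev a c else a i).
    by move=> iN; rewrite coefD coefC coef_poly ltnS iN; case: i iN => [|i] _; rewrite ?addr0 ?add0r.
  apply/eqP => p0; have aS i : (i < n)%N -> a i.+1 = 0.
    by move=> iN; have := coefp i.+1 iN; rewrite p0 coef0.
  (* The constant coefficient has become [a 0 * c 0], and [c 0] is 1. *)
  have a0 : a 0%N = 0.
    have := coefp 0%N isT; rewrite p0 coef0 /ev big_ord_recl big1 ?addr0 ?c0 ?mulr1 //.
    by move=> i _; rewrite lift0 aS ?mul0r.
  by case: i0 i0n ai0 => [|i0] i0n; rewrite ?a0 ?aS ?eqxx.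
have /choice [pp hpp] := hm.
pose p := \prod_(m : (size L).-tuple bool) pp m.
have p0 : p != 0 by apply/prodf_neq0 => m _; have [] := hpp m.
(* For [t < 1] all powers [t ^+ i] with [i > 0] are at most [t], hence below [e]. *)
have e1 : 0 < Num.min e 1 by rewrite lt_min e0 ltr01.
have [t /andP[t0 te] pt] := exists_small_nonroot p0 e1.
have ppt m : (pp m).[t] != 0.
  by move: pt; rewrite /p horner_prod => /prodf_neq0; apply.
pose kap' x := if x == y then ct t else kap x.
have kapE x : x != y -> kap' x = kap x by rewrite /kap' => /negbTE ->.
exists kap'; split=> //.
- by rewrite /kap' eqxx /ct addr0.
- move=> i iN; rewrite /kap' eqxx /ct [c i + _]addrC addrK.
  move: te; rewrite lt_min => /andP[te t1]; case: i iN => [|i] _; first by rewrite normr0.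
  rewrite ger0_norm ?exprn_ge0 ?ltW //; apply: le_lt_trans te.
  by rewrite exprS ler_piMr ?exprn_ile1 ?ltW.
move=> S uS SL sS lam dep.
have SyL x : x \in S -> x != y -> x \in L by move=> /SL; rewrite inE => /predU1P [->|//]; rewrite eqxx.
have gS S1 : uniq S1 -> {subset S1 <= S} -> y \notin S1 -> (size S1 <= n.+1)%N ->
    dependency kap' S1 lam -> {in S1, forall x, lam x = 0}.
  move=> uS1 S1S yS1 sS1 dep1.
  have S1y x : x \in S1 -> x != y by move=> xS; apply: contraNneq yS1 => <-.
  apply: gL => //; first by move=> x xS; apply: SyL (S1S _ xS) (S1y _ xS).
  move=> i iN; rewrite -[RHS](dep1 i iN) big_seq [RHS]big_seq; apply: eq_bigr => x xS.
  by rewrite kapE // S1y.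
case: (boolP (y \in S)) => yS; last exact: gS.
pose S1 := rem y S.
have sS1 : size S1 = (size S).-1 by rewrite size_rem.
have yS1 : y \notin S1 by rewrite mem_rem_uniqF.
have S1S : {subset S1 <= S} by move=> x /mem_rem.
have pS : perm_eq S (y :: S1) by exact: perm_to_rem.
have n1 : (size S1 <= n)%N by rewrite sS1; case: (size S) sS.
(* A functional that vanishes on the other points of [S] but not at [y] isolates the coefficient of
   [y]. *)
have lamy : lam y = 0.
  have sm0 : size (map (mem S1) L) == size L by rewrite size_map.
  pose m := Tuple sm0.
  have mE x : (x \in mask m L) = (x \in S1).
    rewrite -filter_mask mem_filter andb_idr // => /[dup] /S1S xS xS1.
    by apply: SyL => //; apply: contraNneq yS1 => <-.
  have sm : (size (mask m L) <= n)%N.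
    rewrite (leq_trans _ n1) //; apply: uniq_leq_size; first exact: mask_uniq.
    by move=> x; rewrite mE.
  have [_ /(_ t (ppt _) sm) [a [h ay]]] := hpp m.
  have := ev_dependency a dep; rewrite (perm_big _ pS) big_cons /= big1_seq ?addr0.
    by rewrite /kap' eqxx => /eqP; rewrite mulf_eq0 (negbTE ay) orbF => /eqP.
  move=> x /andP[_ xS1]; rewrite kapE ?h ?mulr0 ?mE //.
  by apply: contraNneq yS1 => <-.
have dep1 : dependency kap' S1 lam.
  by move=> i iN; have := dep i iN; rewrite (perm_big _ pS) big_cons /= lamy mul0r add0r.
move=> x; rewrite (perm_mem pS) inE => /predU1P [->//|].
apply: gS => //; first exact: rem_uniq.
exact: ltnW.
Qed.

(** Testing a dependency against the polynomial with roots at all parameters but one isolates the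
    remaining coefficient. *)
Lemma moment_general_position (t : V -> R) L : {in L &, injective t} ->
  general_position (fun x i => t x ^+ i) L.
Proof.
move=> tI S uS SL sS lam dep x0 x0S.
have dep_poly (p : {poly R}) : (size p <= n.+1)%N -> \sum_(x <- S) lam x * p.[t x] = 0.
  move=> sp; under eq_bigr do rewrite (horner_coef_wide _ sp) mulr_sumr.
  rewrite exchange_big /= big1 // => i _.
  under eq_bigr do rewrite mulrCA.
  by rewrite -mulr_sumr dep ?mulr0 // -ltnS.
pose p := \prod_(x <- rem x0 S) ('X - (t x)%:P).
have := dep_poly p; rewrite size_prod_XsubC size_rem // prednK; last by case: (S) x0S.
move=> /(_ sS); rewrite (perm_big _ (perm_to_rem x0S)) big_cons big1_seq /= ?addr0.
  move/eqP;  rewrite mulf_eq0 => /predU1P [//|].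
  rewrite horner_prod prodf_seq_eq0 => /hasP [x xS]; rewrite hornerXsubC subr_eq0.
  move=> /eqP te; have e : x0 = x by apply: tI => //; apply: SL => //; apply: mem_rem xS.
  by move: xS; rewrite -e mem_rem_uniqF.
move=> x /= xS; rewrite horner_prod (perm_big _ (perm_to_rem xS)) big_cons /=.
by rewrite hornerXsubC subrr mul0r mulr0.
Qed.
End GeneralPosition.

Lemma exists_argmin (R : realDomainType) (T : eqType) (f : T -> R) (s : seq T) (x0 : T) :
  x0 \in s -> exists2 j, j \in s & {in s, forall y, f j <= f y}.
Proof.
elim: s x0 => // x s IH x0 _; case: s IH => [|y s] IH.
  by exists x; rewrite ?inE // => z; rewrite inE => /eqP ->.
have [j js hj] := IH y (mem_head _ _).
case: (leP (f x) (f j)) => h.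
  exists x; first exact: mem_head.
  by move=> z; rewrite inE => /predU1P [->//|/hj]; apply: le_trans.
exists j; first by rewrite inE js orbT.
by move=> z; rewrite inE => /predU1P [->|/hj//]; apply: ltW.
Qed.

(** * Crossings of simplices in general position *)

Section Crossing.
Variables (R : realFieldType) (n : nat) (V : eqType).
Implicit Types (kap : V -> nat -> R) (S L P Q E : seq V).

Lemma dependencyD kap S lam mu (a b : R) : dependency n kap S lam -> dependency n kap S mu ->
  dependency n kap S (fun x => a * lam x + b * mu x).
Proof.
move=> h1 h2 i iN; under eq_bigr do rewrite mulrDl -!mulrA.
by rewrite big_split /= -!mulr_sumr h1 ?h2 // !mulr0 addr0.
Qed.

(** Geometrically, the origin lies in the relative interior of the convex hull of the vectors of [E]
    other than [x]. *)
Definition positive_face kap E x : bool :=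
  `[< exists nu, [/\ dependency n kap E nu, nu x = 0 & {in E, forall y, y != x -> 0 < nu y}] >].

(* The dependencies of n + 3 points form a plane, and the nonnegative ones a planar cone, which
   has either no or exactly two extreme rays. *)
Lemma positive_faces_even kap E : uniq E -> general_position n kap E -> size E = n.+3 ->
  xs (positive_face kap E) E = false.
Proof.
move=> uE gE sE.
have two_zeros nu a b : dependency n kap E nu -> a \in E -> b \in E -> a != b ->
    nu a = 0 -> nu b = 0 -> {in E, forall x, nu x = 0}.
  move=> dep aE bE ab na nb.
  have pE : perm_eq E (a :: b :: rem b (rem a E)).
    apply: perm_trans (perm_to_rem aE) _; rewrite perm_cons; apply: perm_to_rem.
    by rewrite mem_rem_uniq // !inE eq_sym ab.
  move=> x; rewrite (perm_mem pE) !inE => /or3P[/eqP->//|/eqP->//|].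
  apply: gE; rewrite ?rem_uniq //.
  - by move=> y /mem_rem/mem_rem.
  - by rewrite size_rem ?size_rem ?sE // mem_rem_uniq // !inE eq_sym ab.
  - by move=> i iN; have := dep i iN; rewrite (perm_big _ pE) !big_cons /= na nb !mul0r !add0r.
case: (boolP (has (positive_face kap E) E)) => [/hasP [x xE fx]|/hasPn h]; last first.
  by apply: big1_seq => x /= /h /negbTE.
have /asboolP [lam [dl lx lpos]] := fx.
have srem z : z \in E -> size (rem z E) = n.+2 by move=> zE; rewrite size_rem ?sE.
have [z zE zx] : exists2 z, z \in E & z != x.
  have := srem x xE; have mr := mem_rem_uniq x uE.
  case: (rem x E) mr => // z r mr _; exists z; last by have := mr z; rewrite !inE eqxx => /esym/andP[].
  by have := mr z; rewrite !inE eqxx => /esym/andP[].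
(* A second dependency, independent of [lam] because it does not vanish at [x]. *)
have [mu [dmu mux]] : exists mu, dependency n kap E mu /\ mu x = 1.
  have [mu0 [dmu0 [y yE my]]] : exists lam, dependency n kap (rem z E) lam /\
      exists2 x, x \in rem z E & lam x != 0.
    by apply: exists_dependency; rewrite ?rem_uniq ?srem.
  pose mu1 y := if y == z then 0 else mu0 y.
  have dmu1 : dependency n kap E mu1.
    move=> i iN; rewrite (perm_big _ (perm_to_rem zE)) big_cons /= /mu1 eqxx mul0r add0r.
    rewrite -[RHS](dmu0 i iN) big_seq [RHS]big_seq; apply: eq_bigr => w.
    by rewrite mem_rem_uniq // !inE => /andP[/negbTE ->].
  have mx : mu1 x != 0.
    apply/eqP => mx; have yE' := mem_rem yE.
    have := two_zeros mu1 z x dmu1 zE xE zx _ mx y yE'; rewrite /mu1 eqxx => /(_ erefl).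
    by case: eqP => [e|_ e]; [move: yE; rewrite e mem_rem_uniqF | rewrite e eqxx in my].
  exists (fun y => (mu1 x)^-1 * mu1 y + 0 * mu1 y); split; first exact: dependencyD.
  by rewrite mulVf // mul0r addr0.
have zr : z \in rem x E by rewrite mem_rem_uniq // !inE zx.
(* Subtracting the largest multiple of [lam] that keeps [mu] nonnegative gives the second ray, which
   vanishes at [j]. *)
have [j jr jmin] := exists_argmin (fun y => mu y / lam y) zr.
have /andP[jx jE] : (j != x) && (j \in E) by move: jr; rewrite mem_rem_uniq // !inE.
pose s := mu j / lam j.
have lj : 0 < lam j by apply: lpos.
pose mu' y := 1 * mu y + - s * lam y.
have dmu' : dependency n kap E mu' by apply: dependencyD.
have mu'x : mu' x = 1 by rewrite /mu' mux lx; ring.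
have mu'j : mu' j = 0 by rewrite /mu' /s; field; rewrite lt0r_neq0.
have mu'pos : {in E, forall y, y != j -> 0 < mu' y}.
  move=> y yE yj; case: (eqVneq y x) => [->|yx]; first by rewrite mu'x.
  rewrite lt_neqAle; apply/andP; split.
    rewrite eq_sym; apply/eqP => my.
    have := two_zeros mu' y j dmu' yE jE yj my mu'j x xE; rewrite mu'x => /eqP.
    by rewrite oner_eq0.
  have yr : y \in rem x E by rewrite mem_rem_uniq // !inE yx.
  have ly : 0 < lam y by apply: lpos.
  have := jmin y yr; rewrite -/s ler_pdivlMr // /mu' => h; lra.
have fj : positive_face kap E j by apply/asboolP; exists mu'.
rewrite /xs (perm_big _ (perm_to_rem xE)) big_cons (perm_big _ (perm_to_rem jr)) big_cons fx fj.
rewrite big1_seq // => k /=.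
rewrite mem_rem_uniq ?rem_uniq // inE /= => /andP[kj].
rewrite mem_rem_uniq // inE /= => /andP[kx kE].
apply/negP => /asboolP [nu [dnu nuk nupos]].
(* [rho] vanishes at [x] and [j], hence on all of [E], whereas at [k] its first term [nu k] is zero
   and the two others are negative. *)
pose rho y := 1 * (1 * nu y + - nu x * mu' y) + - (nu j / lam j) * lam y.
have drho : dependency n kap E rho by do 2!apply: dependencyD => //.
have rx : rho x = 0 by rewrite /rho mu'x lx; ring.
have rj : rho j = 0 by rewrite /rho mu'j; field; rewrite lt0r_neq0.
have := two_zeros rho x j drho xE jE _ rx rj k kE; rewrite eq_sym => /(_ jx).
rewrite /rho nuk => h.
have p1 : 0 < nu x * mu' k.
  by rewrite mulr_gt0 ?mu'pos // nupos // eq_sym.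
have p2 : 0 < (nu j / lam j) * lam k.
  by rewrite mulr_gt0 ?lpos // divr_gt0 // nupos // eq_sym.
have e : nu x * mu' k + (nu j / lam j) * lam k = 0 by rewrite -[RHS]oppr0 -h; ring.
by have := addr_gt0 p1 p2; rewrite e ltxx.
Qed.

(* A tuple with a repeated vertex crosses nothing, which makes degenerate tuples negligible. *)
Definition cross kap P Q : bool :=
  uniq (P ++ Q) && `[< exists w : V -> R, {in P ++ Q, forall x, 0 < w x} /\
    forall i, (i <= n)%N -> \sum_(x <- P) w x * kap x i = \sum_(x <- Q) w x * kap x i >].

Lemma crossC kap P Q : cross kap P Q = cross kap Q P.
Proof.
rewrite /cross uniq_catC; congr andb; apply: asbool_equiv_eq.
by split=> -[w [h1 h2]]; exists w; split=> [x|i /h2 ->//]; rewrite mem_cat orbC -mem_cat => /h1.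
Qed.

Lemma perm_cross kap P P' Q : perm_eq P P' -> cross kap P Q = cross kap P' Q.
Proof.
move=> pP; rewrite /cross (perm_uniq (perm_cat pP (perm_refl Q))); congr andb.
apply: asbool_equiv_eq; split=> -[w [h1 h2]]; exists w; split=> [x|i iN].
- by rewrite mem_cat -(perm_mem pP) -mem_cat => /h1.
- by rewrite -(perm_big _ pP) h2.
- by rewrite mem_cat (perm_mem pP) -mem_cat => /h1.
- by rewrite (perm_big _ pP) h2.
Qed.

Lemma xs_tbd_uniq (f : seq V -> bool) P : uniq P -> xs f (tbd P) = xs (fun x => f (rem x P)) P.
Proof.
elim: P f => [|x P IH] f /=; first by rewrite !xs_nil.
move=> /andP[xP uP]; rewrite !xs_cons /= eqxx xs_map (IH _ uP); congr addb.
apply: eq_xs_in; apply/Forall_inP => y yP /=.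
by case: eqP => [e|//]; rewrite e yP in xP.
Qed.

(** Only deleting one of two equal entries can leave a tuple without repetition, and these two
    deletions agree up to order. *)
Lemma xs_tbd_repeat (f : seq V -> bool) P :
  (forall P P', perm_eq P P' -> f P = f P') -> (forall P, ~~ uniq P -> f P = false) ->
  ~~ uniq P -> xs f (tbd P) = false.
Proof.
elim: P f => [|x P IH] f //= fp fu; rewrite negb_and negbK xs_cons xs_map.
case: (boolP (uniq P)) => [uP|nP] xP; last first.
  rewrite fu // (IH (f \o cons x)) // => [Q Q' pQ|Q nQ] /=; first by apply: fp; rewrite perm_cons.
  by apply: fu; rewrite /= (negbTE nQ) andbF.
rewrite orbF in xP; rewrite xs_tbd_uniq // /xs (bigD1_seq x) //= (fp (x :: rem x P) P); last first.
  by rewrite perm_sym perm_to_rem.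
rewrite addbA addbb big1_seq // => y /andP[yx yP]; apply: fu => /=.
by rewrite mem_rem_uniq // !inE eq_sym yx xP.
Qed.

Lemma cross_repeatl kap P Q : ~~ uniq P -> cross kap P Q = false.
Proof. by move=> nP; rewrite /cross cat_uniq (negbTE nP). Qed.

(** Reversing the signs of the vectors of [Q] turns a common point of two open simplices into a
    positive dependency. *)
Lemma cross_rem kap P Q x : uniq (P ++ Q) -> x \in P ->
  cross kap (rem x P) Q =
  positive_face (fun y i => if y \in P then kap y i else - kap y i) (P ++ Q) x.
Proof.
rewrite /cross => uPQ xP; have /and3P[uP PQ uQ] : [&& uniq P, ~~ has (mem P) Q & uniq Q].
  by rewrite -cat_uniq.
have nQ y : y \in Q -> y \notin P by move=> yQ; apply: contra PQ => yP; apply/hasP; exists y.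
have -> : uniq (rem x P ++ Q).
  rewrite cat_uniq rem_uniq // uQ andbT /=; apply: contra PQ => /hasP [y yQ /mem_rem yP].
  by apply/hasP; exists y.
rewrite /= /positive_face; apply: asbool_equiv_eq.
have sumE nu i : nu x = 0 ->
    \sum_(y <- P ++ Q) nu y * (if y \in P then kap y i else - kap y i) =
    \sum_(y <- rem x P) nu y * kap y i - \sum_(y <- Q) nu y * kap y i.
  move=> nx; rewrite big_cat /=; congr (_ + _); last first.
    rewrite -sumrN big_seq [RHS]big_seq; apply: eq_bigr => y /nQ/negbTE ->.
    by rewrite mulrN.
  rewrite (perm_big _ (perm_to_rem xP)) big_cons /= nx mul0r add0r.
  by rewrite big_seq [RHS]big_seq; apply: eq_bigr => y /mem_rem ->.
split=> [[w [h1 h2]]|[nu [dep nx npos]]].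
  pose nu y := if y == x then 0 else w y.
  have nx : nu x = 0 by rewrite /nu eqxx.
  exists nu; split=> //.
    move=> i iN; rewrite sumE // [X in X - _](_ : _ = \sum_(y <- rem x P) w y * kap y i); last first.
      rewrite big_seq [RHS]big_seq; apply: eq_bigr => y; rewrite mem_rem_uniq // !inE => /andP[yx _].
      by rewrite /nu (negbTE yx).
    rewrite h2 // (_ : \sum_(y <- Q) nu y * _ = \sum_(y <- Q) w y * kap y i) ?subrr //.
    rewrite big_seq [RHS]big_seq; apply: eq_bigr => y yQ.
    by rewrite /nu; case: eqP => // e; have := nQ y yQ; rewrite e xP.
  move=> y yE yx; rewrite /nu (negbTE yx); apply: h1; move: yE.
  by rewrite !mem_cat mem_rem_uniq // !inE yx.
exists nu; split=> [y|i iN]; last by apply/eqP; rewrite -subr_eq0 -sumE // dep.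
rewrite mem_cat mem_rem_uniq // !inE => h; apply: npos.
  by rewrite mem_cat; case/orP: h => [/andP[_ ->]|->]; rewrite ?orbT.
by case/orP: h => [/andP[]//|/nQ]; apply: contraNneq => ->.
Qed.

Lemma positive_face_opp kap kap' E x : {in E, forall y i, kap' y i = - kap y i} ->
  positive_face kap E x = positive_face kap' E x.
Proof.
move=> h; have e nu i : \sum_(y <- E) nu y * kap' y i = - \sum_(y <- E) nu y * kap y i.
  rewrite -sumrN big_seq [RHS]big_seq; apply: eq_bigr => y yE; by rewrite h // mulrN.
apply: asbool_equiv_eq; split=> -[nu [h1 h2 h3]]; exists nu; split=> // i iN.
  by rewrite e h1 // oppr0.
by apply/eqP; rewrite -oppr_eq0 -e h1.
Qed.

Lemma perm_positive_face kap E E' x : perm_eq E E' ->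
  positive_face kap E x = positive_face kap E' x.
Proof.
move=> pE; apply: asbool_equiv_eq; split=> -[nu [h1 h2 h3]]; exists nu; split=> //.
- by move=> i iN; rewrite -(perm_big _ pE) h1.
- by move=> y; rewrite -(perm_mem pE); apply: h3.
- by move=> i iN; rewrite (perm_big _ pE) h1.
- by move=> y; rewrite (perm_mem pE); apply: h3.
Qed.

(** The dimensions of [P] and [Q] add up to [n + 1], so generically the simplices meet in a segment
    or not at all, and a segment has two ends, each on the boundary of one of them. Tuples with a
    repeated vertex contribute nothing to either side. *)
Lemma cross_tbd kap L P Q : general_position n kap L -> {subset P <= L} -> {subset Q <= L} ->
  {in P, forall x, x \notin Q} -> (size P + size Q = n.+3)%N ->
  xs (fun P' => cross kap P' Q) (tbd P) = xs (cross kap P) (tbd Q).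
Proof.
move=> gL PL QL PQ sPQ.
case: (boolP (uniq P)) => uP; last first.
  rewrite (@xs_tbd_repeat (fun P' => cross kap P' Q)) //.
  - by rewrite xs0 // => S; rewrite cross_repeatl.
  - by move=> *; apply: perm_cross.
  - by move=> P' nP; rewrite cross_repeatl.
case: (boolP (uniq Q)) => uQ; last first.
  rewrite (@xs_tbd_repeat (cross kap P)) //.
  - by rewrite xs0 // => S; rewrite crossC cross_repeatl.
  - by move=> Q1 Q2 pQ; rewrite ![cross kap P _]crossC; apply: perm_cross.
  - by move=> P' nP; rewrite crossC cross_repeatl.
have PQ' : ~~ has (mem P) Q by apply/hasPn => y yQ; apply/negP => /PQ; rewrite yQ.
have uPQ : uniq (P ++ Q) by rewrite cat_uniq uP uQ PQ'.
have pQP : perm_eq (Q ++ P) (P ++ Q) by apply/permPl; exact: perm_catC.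
have uQP : uniq (Q ++ P) by rewrite uniq_catC.
pose kap' y i := if y \in P then kap y i else - kap y i.
have QP y : y \in Q -> y \notin P by move=> yQ; apply/negP => /PQ; rewrite yQ.
rewrite !xs_tbd_uniq //.
rewrite (@eq_xs_in _ _ (positive_face kap' (P ++ Q)) P); last first.
  by apply/Forall_inP => x xP; rewrite cross_rem.
rewrite (@eq_xs_in _ (fun x => cross kap P (rem x Q)) (positive_face kap' (P ++ Q)) Q); last first.
  apply/Forall_inP => x xQ; rewrite crossC cross_rem // (perm_positive_face _ _ pQP).
  apply: positive_face_opp => y; rewrite mem_cat /kap' => /orP[yP|yQ] i.
    by rewrite yP (negbTE (PQ _ yP)) opprK.
  by rewrite yQ (negbTE (QP _ yQ)).
have sgn y i : kap' y i = (if y \in P then 1 else -1) * kap y i.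
  by rewrite /kap'; case: ifP => _; ring.
have g' : general_position n kap' (P ++ Q).
  move=> S uS SPQ sS lam dep x xS.
  have SL : {subset S <= L} by move=> y /SPQ; rewrite mem_cat => /orP[/PL|/QL].
  have dep' : dependency n kap S (fun y => lam y * (if y \in P then 1 else -1)).
    by move=> i iN; rewrite -[RHS](dep i iN); apply: eq_bigr => y _; rewrite sgn mulrA.
  have /eqP := gL S uS SL sS _ dep' x xS.
  by rewrite mulf_eq0 => /orP[/eqP //|]; case: ifP; rewrite ?oppr_eq0 oner_eq0.
apply/eqP; rewrite -[_ == _]negbK -negb_add -xs_cat.
by rewrite positive_faces_even // size_cat.
Qed.
End Crossing.
End GeneralPosition.

Module VanKampenNumber.
Import all_boot all_order all_algebra boolp zify ConstrainedMaps GeneralPosition.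
Close Scope R_scope.
Local Open Scope nat_scope.

(** * The van Kampen number *)

Section DoubleCounting.
Variables (I : finType).
Implicit Types (A t s r : {set I}).

Lemma disjoint_setU1 w A t : [disjoint w |: A & t] = (w \notin t) && [disjoint A & t].
Proof. by rewrite -setI_eq0 setIUl setU_eq0 !setI_eq0 disjoints1. Qed.

(** After exchanging the sums, each [t] is counted once for every vertex outside [A :|: t]. *)
Lemma sum_outside A (P : pred {set I}) (g : {set I} -> bool) :
  (forall t, P t -> [disjoint A & t] -> ~~ odd #|~: (A :|: t)|) ->
  \big[addb/false]_(w | w \notin A) \big[addb/false]_(t | P t && [disjoint w |: A & t]) g t = false.
Proof.
move=> ev.
rewrite (exchange_big_dep (fun t => P t && [disjoint A & t])) /=; last first.
  by move=> w t _ /andP[-> h]; apply: disjointWl h; apply: subsetUr.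
apply: big1 => t /andP[Pt At].
rewrite (eq_bigl (fun w => w \in ~: (A :|: t))); last first.
  by move=> w; rewrite !inE Pt /= disjoint_setU1 At andbT negb_or.
by rewrite odd_sum_const (negbTE (ev t Pt At)) andbF.
Qed.

(** A set of [j] vertices arises as [t :\ w] once for every vertex [w] outside it and outside [A],
    so this is [sum_outside] again. *)
Lemma sum_facets A j (g : {set I} -> bool) : ~~ odd (#|I| - #|A| - j) ->
  \big[addb/false]_(t : {set I} | (#|t| == j.+1) && [disjoint A & t])
    \big[addb/false]_(w in t) g (t :\ w) = false.
Proof.
move=> ev.
have card_out t : #|t| == j -> [disjoint A & t] -> ~~ odd #|~: (A :|: t)|.
  move=> /eqP ct dt; rewrite cardsCs setCK cardsU disjoint_setI0 // cards0 subn0 ct.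
  by rewrite subnDA.
rewrite -[RHS](sum_outside (A := A) (P := fun t => #|t| == j) g card_out).
rewrite (exchange_big_dep (fun w => w \notin A)) /=; last first.
  by move=> t w /andP[_ dt] wt; rewrite (disjointFl dt).
apply: eq_bigr => w wA.
rewrite (reindex_onto (fun t => w |: t) (fun t => t :\ w)) /=; last first.
  by move=> t /andP[_ wt]; rewrite setD1K.
apply: eq_big => [t|t /andP[_ /eqP ->] //].
rewrite setU11 andbT disjoint_setU1 [X in X && _ = _]andbC.
case: (boolP (w \in t)) => wt.
  rewrite andbF; apply/negP => /andP[_ /eqP e].
  by have := setD11 w (w |: t); rewrite e wt.
rewrite setU1K // eqxx andbT cardsU1 wt add1n eqSS andbC /=; congr andb.
by rewrite disjoint_sym disjoint_setU1 wA disjoint_sym.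
Qed.
End DoubleCounting.

(** * Invariance under chain homotopies *)

Section Invariance.
Variables (R : realFieldType) (k : nat) (V : eqType).
Let n := k.*2.
Let m := n.+3.
Let I := 'I_m.
Variables (kap : V -> nat -> R) (L : seq V) (ter : {set I} -> pred V).
Hypotheses (gL : general_position n kap L)
  (terL : forall s x, ter s x -> x \in L)
  (ter_mono : forall (s t : {set I}) x, s \subset t -> ter s x -> ter t x)
  (ter_disj : forall (s t : {set I}) x, [disjoint s & t] -> ter s x -> ~~ ter t x).

Definition crossc (c1 c2 : seq (seq V)) := xs (fun P => xs (cross n kap P) c2) c1.

Lemma crosscC c1 c2 : crossc c1 c2 = crossc c2 c1.
Proof.
rewrite /crossc xs_exchange; apply: eq_xs => P; apply: eq_xs => Q; exact: crossC.
Qed.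

Lemma crosscl c1 c1' c2 : ceq c1 c1' -> crossc c1 c2 = crossc c1' c2.
Proof. by move=> h; apply: h. Qed.

Lemma crosscr c1 c2 c2' : ceq c2 c2' -> crossc c1 c2 = crossc c1 c2'.
Proof. by move=> h; rewrite crosscC (crosscl _ h) crosscC. Qed.

Lemma crossc_catl c1 c1' c2 : crossc (c1 ++ c1') c2 = crossc c1 c2 (+) crossc c1' c2.
Proof. exact: xs_cat. Qed.

Lemma crossc_catr c1 c2 c2' : crossc c1 (c2 ++ c2') = crossc c1 c2 (+) crossc c1 c2'.
Proof. by rewrite !(crosscC c1) crossc_catl. Qed.

Lemma crossc0l c : crossc [::] c = false. Proof. exact: xs_nil. Qed.
Lemma crossc0r c : crossc c [::] = false. Proof. by rewrite crosscC crossc0l. Qed.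

Definition tuples_in j (s : {set I}) (c : seq (seq V)) :=
  List.Forall (fun P : seq V => size P = j /\ all (ter s) P) c.

Lemma crossc_cbd (s t : {set I}) i j c1 c2 : [disjoint s & t] -> tuples_in i s c1 -> tuples_in j t c2 ->
  i + j = m -> crossc (cbd c1) c2 = crossc c1 (cbd c2).
Proof.
move=> st h1 h2 ij; rewrite /crossc xs_cbd.
apply: eq_xs_in; apply: List.Forall_impl h1 => P [sP tP].
rewrite xs_exchange xs_cbd; apply: eq_xs_in; apply: List.Forall_impl h2 => Q [sQ tQ].
apply: (cross_tbd gL).
- by move=> x /(allP tP)/terL.
- by move=> x /(allP tQ)/terL.
- move=> x /(allP tP) xs; apply/negP => /(allP tQ); apply/negP; exact: ter_disj xs.
- by rewrite sP sQ.
Qed.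

(** The rank condition selects one of the two orders of an unordered pair. *)
Definition good (p : {set I} * {set I}) :=
  [&& #|p.1| == k.+1, #|p.2| == k.+1, [disjoint p.1 & p.2] & enum_rank p.1 < enum_rank p.2].

Definition vkn (phi : {set I} -> seq (seq V)) :=
  \big[addb/false]_(p | good p) crossc (phi p.1) (phi p.2).

Definition vk_pair (s t : {set I}) := [&& #|s| == k.+1, #|t| == k.+1 & [disjoint s & t]].

Lemma sum_good (F : {set I} -> {set I} -> bool) :
  \big[addb/false]_(p | good p) (F p.1 p.2 (+) F p.2 p.1) =
  \big[addb/false]_s \big[addb/false]_(t | vk_pair s t) F s t.
Proof.
rewrite pair_big_dep /= big_split /=.
rewrite [RHS](bigID (fun p : {set I} * {set I} => enum_rank p.1 < enum_rank p.2)) /=; congr addb.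
  by apply: eq_bigl => -[s t]; rewrite /good /vk_pair /= -!andbA.
rewrite (reindex_inj (h := fun p : {set I} * {set I} => (p.2, p.1))); last by move=> [a b] [c d] [-> ->].
apply: eq_bigl => -[s t]; rewrite /good /vk_pair /= disjoint_sym.
case: (#|s| =P k.+1) => [cs|]; rewrite ?andbF //=; case: (#|t| == k.+1) => //=.
case: (boolP [disjoint s & t]) => //= dst.
rewrite -leqNgt [RHS]leq_eqVlt; case: (enum_rank t =P enum_rank s :> nat) => [/ord_inj/enum_rank_inj e|_] //=.
move: dst; rewrite e -setI_eq0 setIid => /eqP s0.
by rewrite s0 cards0 in cs.
Qed.

Lemma sum_good_delta (phi D : {set I} -> seq (seq V)) :
  (forall s t, vk_pair s t -> crossc (D s) (D t) = false) ->
  \big[addb/false]_s \big[addb/false]_(t | vk_pair s t) crossc (D s) (phi t) = false ->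
  vkn (fun s => phi s ++ D s) = vkn phi.
Proof.
move=> DD h; rewrite /vkn.
rewrite (eq_bigr (fun p => crossc (phi p.1) (phi p.2) (+)
  (crossc (D p.1) (phi p.2) (+) crossc (D p.2) (phi p.1)))).
  by rewrite big_split /= (sum_good (fun s t => crossc (D s) (phi t))) h addbF.
move=> [s t] /= /and4P[cs ct dst _]; rewrite !crossc_catl !crossc_catr DD ?addbF.
  by rewrite [crossc (phi s) (D t)]crosscC -addbA; congr addb; rewrite addbC.
exact/and3P.
Qed.

Definition chain_map (phi : {set I} -> seq (seq V)) := forall s : {set I}, 0 < #|s| <= k.+1 ->
  ceq (cbd (phi s)) (flatten [seq phi (s :\ x) | x <- enum s]).

Definition carried (phi : {set I} -> seq (seq V)) j := forall s : {set I}, #|s| <= k.+1 ->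
  tuples_in (#|s| + j) s (phi s).

(** What a chain homotopy equal to [c] on the face [r] and zero elsewhere adds to a chain map. *)
Definition change (c : seq (seq V)) (r s : {set I}) : seq (seq V) :=
  if s == r then cbd c else if (r \subset s) && (#|s| == #|r|.+1) then c else [::].

(** Only faces [r] with [k] or [k + 1] vertices affect the pairs counted. In both cases a new term
    is counted once for every vertex outside two disjoint faces, one with [k] and one with [k + 1]
    vertices; of the [2k + 3] vertices two remain, an even number. *)
Lemma elementary_change phi (c : seq (seq V)) (r : {set I}) :
  chain_map phi -> carried phi 0 -> r != set0 -> (#|r| <= k.+1 -> tuples_in #|r|.+1 r c) ->
  vkn (fun s => phi s ++ change c r s) = vkn phi.
Proof.
move=> cm car r0 hc; set D := change c r.
have Dnil (s : {set I}) : ~~ (r \subset s) -> D s = [::].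
  by rewrite /D /change => h; case: eqP => [e|_]; [rewrite e subxx in h | rewrite (negbTE h)].
apply: sum_good_delta.
  move=> s t /and3P[_ _ dst].
  case: (boolP (r \subset s)) => rs; last by rewrite Dnil // crossc0l.
  rewrite (Dnil t) ?crossc0r //; apply: contraNN r0 => rt.
  by rewrite -subset0 -(disjoint_setI0 dst) subsetI rs.
case: (ltngtP #|r| k.+1) => [|rk|rk].
- rewrite ltnS leq_eqVlt => /predU1P [rk|rk].
    have tc : tuples_in k.+1 r c by rewrite -rk; apply: hc; rewrite rk.
    rewrite -[RHS](sum_outside (A := r) (P := fun t => #|t| == k.+1) (fun t => crossc c (phi t))).
      rewrite (bigID (fun s : {set I} => (r \subset s) && (#|s| == k.+1))) /= [X in _ (+) X]big1 ?addbF.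
        rewrite (reindex_onto (fun w : I => w |: r) (fun s => odflt ord0 [pick w in s :\: r])) /=.
          apply: eq_big => [w|w /andP[/andP[_ cw] _]].
            case: (boolP (w \in r)) => wr /=.
              rewrite (setUidPr _) ?sub1set // rk.
              by rewrite subxx /= ltn_eqF.
            rewrite subsetUr cardsU1 wr rk add1n eqxx /=; case: pickP => [w'|].
              by rewrite !inE => /andP[/negbTE -> /=]; rewrite orbF.
            by move/(_ w); rewrite !inE wr eqxx.
          have wr : w \notin r by apply: contraTN cw => wr; rewrite (setUidPr _) ?sub1set // rk ltn_eqF.
          apply: eq_big => [t|t _]; first by rewrite /vk_pair cw.
          rewrite /D /change ifN; last by apply: contraNneq wr => <-; rewrite setU11.
          by rewrite subsetUr rk cw.
        move=> s /andP[rs /eqP cs]; case: pickP => [w|h] /=.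
          rewrite inE => /andP[wr ws]; apply/eqP; rewrite eqEcard subUset sub1set ws rs /=.
          by rewrite cardsU1 wr cs rk.
        have : #|s :\: r| = 0 by apply: eq_card0.
        by rewrite cardsD (setIidPr rs) cs rk; lia.
      move=> s; rewrite negb_and => h; apply: big1 => t /and3P[/eqP cs ct dst].
      move: h; rewrite cs eqxx orbF => /Dnil ->; exact: crossc0l.
    move=> t /eqP ct drt; rewrite cardsCs setCK cardsU disjoint_setI0 // cards0 card_ord rk ct.
    by rewrite (_ : _ - _ = 2) // /m /n; lia.
  apply: big1 => s _; apply: big1 => t /and3P[/eqP cs _ _].
  rewrite /D /change; case: eqP => [e|_]; first by move: rk; rewrite -e cs; lia.
  by rewrite cs eqSS; case: eqP => [e|_]; [move: rk; rewrite -e ltnn | rewrite andbF crossc0l].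
- apply: big1 => s _; apply: big1 => t /and3P[/eqP cs _ _].
  rewrite /D /change; case: eqP => [e|_]; first by move: rk; rewrite -e cs; lia.
  by rewrite cs; case: eqP => [e|_]; [move: rk; lia | rewrite andbF crossc0l].
have tc : tuples_in k.+2 r c by rewrite -rk; apply: hc; rewrite rk.
rewrite (bigD1 r) //= [X in _ (+) X]big1 ?addbF; last first.
  move=> s sr; apply: big1 => t /and3P[/eqP cs _ _].
  by rewrite /D /change (negbTE sr) cs rk; case: eqP => [|_]; [lia | rewrite andbF crossc0l].
rewrite /D /change eqxx.
rewrite -[RHS](sum_facets (A := r) (j := k) (fun t => crossc c (phi t))); last first.
  by rewrite card_ord rk (_ : _ - _ = 2) // /m /n; lia.
apply: eq_big => [t|t /and3P[_ /eqP ct drt]]; first by rewrite /vk_pair rk eqxx.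
(* Crossings of the boundary of [c] with [phi t] become crossings of [c] with the images of the
   facets of [t]. *)
rewrite (crossc_cbd drt tc (j := k.+1)).
- have tk : 0 < #|t| <= k.+1 by rewrite ct leqnn.
  rewrite (crosscr _ (cm t tk)) crosscC /crossc.
  rewrite (xs_flatten_enum _ (fun x => phi (t :\ x))).
  by apply: eq_bigr => w _; rewrite [RHS]crosscC.
- by have := car t; rewrite ct addn0; apply.
- by rewrite /m /n; lia.
Qed.

Lemma vkn_ceq phi phi' : (forall s : {set I}, #|s| = k.+1 -> ceq (phi s) (phi' s)) ->
  vkn phi = vkn phi'.
Proof.
move=> h; apply: eq_bigr => -[s t] /and4P[/= /eqP cs /eqP ct _ _].
by rewrite (crosscl _ (h s cs)) (crosscr _ (h t ct)).
Qed.

Lemma tuples_in_flatten (T : eqType) j s (F : T -> seq (seq V)) (l : seq T) :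
  {in l, forall x, tuples_in j s (F x)} -> tuples_in j s (flatten (map F l)).
Proof. by move=> h; apply: Forall_flatten; apply/Forall_inP. Qed.

Lemma tuples_in_cbd j s c : tuples_in j.+1 s c -> tuples_in j s (cbd c).
Proof.
move=> h; apply: Forall_flatten; apply: List.Forall_impl h => P [sP tP].
apply/Forall_inP => Q PQ; split.
  by have /Forall_inP /(_ Q PQ) := size_tbd P; rewrite sP => -[].
by apply/allP => x /(sub_tbd PQ) /(allP tP).
Qed.

Lemma tuples_in_sub j (s t : {set I}) c : s \subset t -> tuples_in j s c -> tuples_in j t c.
Proof.
move=> st; apply: List.Forall_impl => P [sP tP]; split=> //.
by apply/allP => x /(allP tP); apply: ter_mono.
Qed.

Section Homotopy.
Variables (phi h : {set I} -> seq (seq V)).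
Hypotheses (cm : chain_map phi) (car : carried phi 0) (carh : carried h 1).

(** [phi] changed by the homotopy [h] restricted to the faces in [S]; enlarging [S] by one face is
    an elementary change. *)
Definition phiS (S : {set {set I}}) (s : {set I}) : seq (seq V) :=
  phi s ++ (if s \in S then cbd (h s) else [::]) ++
  flatten [seq (if s :\ x \in S then h (s :\ x) else [::]) | x <- enum s].

Lemma xs_phiS f S s : xs f (phiS S s) = xs f (phi s) (+) (((s \in S) && xs f (cbd (h s))) (+)
  \big[addb/false]_(x in s) ((s :\ x \in S) && xs f (h (s :\ x)))).
Proof.
rewrite !xs_cat (xs_flatten_enum f (fun x => if s :\ x \in S then h (s :\ x) else [::])).
congr addb; congr addb; first by case: ifP; rewrite ?xs_nil.
by apply: eq_bigr => x _; case: ifP; rewrite ?xs_nil.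
Qed.

Lemma phiS_chain_map S : chain_map (phiS S).
Proof.
move=> s cs f; have cms := cm cs.
rewrite (xs_flatten_enum f (fun x => phiS S (s :\ x))).
under [RHS]eq_bigr do rewrite xs_phiS.
rewrite [RHS]big_split /=.
have <- : xs f (cbd (phi s)) = \big[addb/false]_(x in s) xs f (phi (s :\ x)).
  by rewrite cms (xs_flatten_enum f (fun x => phi (s :\ x))).
rewrite xs_cbd xs_phiS -xs_cbd; congr addb.
rewrite -xs_cbd cbd_cbd andbF big_split /=.
have -> : \big[addb/false]_(x in s) \big[addb/false]_(y in s :\ x)
    ((s :\ x :\ y \in S) && xs f (h (s :\ x :\ y))) = false.
  exact: (sbd_sbd0 s (fun t => (t \in S) && xs f (h t))).
by rewrite addbF; apply: eq_bigr => x _; rewrite -xs_cbd.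
Qed.

Lemma phiS_carried S : carried (phiS S) 0.
Proof.
move=> s cs; apply/Forall_cat; split; first exact: car.
apply/Forall_cat; split.
  case: ifP => _; last by constructor.
  by apply: tuples_in_cbd; have := carh cs; rewrite addn1 addn0.
apply: tuples_in_flatten => x; rewrite mem_enum => xs.
case: ifP => _; last by constructor.
apply: (tuples_in_sub (subD1set s x)).
have e : #|s :\ x| + 1 = #|s| by rewrite (cardsD1 x s) xs addnC.
by rewrite addn0 -e; apply: carh; move: cs; rewrite -e; lia.
Qed.

Lemma phiS_step (S : {set {set I}}) r s : r \in S -> ceq (phiS S s) (phiS (S :\ r) s ++ change (h r) r s).
Proof.
move=> rS f; rewrite xs_cat !xs_phiS.
have -> : xs f (change (h r) r s) = ((s == r) && xs f (cbd (h r))) (+)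
    \big[addb/false]_(x in s) ((s :\ x == r) && xs f (h r)).
  rewrite /change; case: eqP => [->|sr] /=.
    rewrite big1 ?addbF // => x xr; case: eqP => //= e.
    by have := setD11 x r; rewrite e xr.
  case: (boolP (r \subset s)) => rs /=; last first.
    rewrite xs_nil big1 // => x _; case: eqP => //= e.
    by rewrite -e subD1set in rs.
  case: eqP => cs.
    have /cards1P [x sx] : #|s :\: r| == 1 by rewrite cardsD (setIidPr rs) cs subSnn.
    have [xr xs] : x \notin r /\ x \in s.
      by have := set11 x; rewrite -sx inE => /andP[].
    have e : s :\ x = r.
      by apply/eqP; rewrite eq_sym eqEcard subsetD1 rs xr /=; move: (cardsD1 x s); rewrite xs cs add1n => -[->].
    rewrite (bigD1 x) //= e eqxx big1 ?addbF // => y /andP[ys yx]; case: eqP => //= e'.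
    have : y \in r by rewrite -e !inE yx.
    by rewrite -e' setD11.
  rewrite xs_nil big1 // => x xs; case: eqP => //= e.
  by case: cs; rewrite -e (cardsD1 x s) xs.
rewrite -addbA; congr addb.
rewrite (eq_bigr (fun x => ((s :\ x \in S :\ r) && xs f (h (s :\ x))) (+)
   ((s :\ x == r) && xs f (h r)))); last first.
  by move=> x _; rewrite in_setD1; case: eqP => [->|_]; rewrite ?rS /= ?addbF.
rewrite big_split /= in_setD1; set A := \big[addb/false]_(x in s) _; set B := \big[addb/false]_(x in s) _.
case: eqP => [->|_]; rewrite ?rS /= ?addbF ?addbA //.
by case: A; case: B; case: (xs _ _).
Qed.

(** The empty face must stay out of [S]: being part of every face, it could change both members of a
    pair at once. *)
Lemma vkn_phiS (S : {set {set I}}) : set0 \notin S -> vkn (phiS S) = vkn phi.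
Proof.
have [j] := ubnP #|S|; elim: j S => // j IH S; rewrite ltnS => cS S0.
case: (set_0Vmem S) => [S_0|[r rS]].
  apply: vkn_ceq => s _ f; rewrite xs_phiS S_0 inE big1 ?addbF // => x _.
  by rewrite inE.
rewrite (vkn_ceq (phi' := fun s => phiS (S :\ r) s ++ change (h r) r s)); last first.
  by move=> s _; apply: phiS_step.
rewrite elementary_change.
- apply: IH; first by rewrite (leq_trans _ cS) // [X in _ < X](cardsD1 r S) rS.
  by apply: contraNN S0 => /setD1P[].
- exact: phiS_chain_map.
- exact: phiS_carried.
- by apply: contraNneq S0 => <-.
- by move/carh; rewrite addn1.
Qed.

Lemma vkn_homotopy psi : h set0 = [::] ->
  (forall s : {set I}, #|s| = k.+1 -> forall f, xs f (cbd (h s)) (+)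
     \big[addb/false]_(x in s) xs f (h (s :\ x)) = xs f (phi s) (+) xs f (psi s)) ->
  vkn psi = vkn phi.
Proof.
move=> h0 hom; rewrite -(@vkn_phiS (~: [set set0])) ?inE ?eqxx //.
apply: vkn_ceq => s cs f; rewrite xs_phiS !inE -card_gt0 cs /=.
rewrite (eq_bigr (fun x => xs f (h (s :\ x)))); last first.
  by move=> x _; rewrite !inE; case: eqP => //= ->; rewrite h0 xs_nil.
by rewrite hom // addbA addbb.
Qed.
End Homotopy.
End Invariance.
End VanKampenNumber.

Module VanKampenFlores.
Import all_boot all_order all_algebra boolp ring lra zify.
Import ConstrainedMaps GeneralPosition VanKampenNumber.
Import Order.TTheory GRing.Theory Num.Theory.
Close Scope R_scope.
Local Open Scope ring_scope.

Lemma prod_lt0 (R : realDomainType) (J : finType) (P : pred J) (F : J -> R) :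
  (forall j, P j -> F j != 0) ->
  (\prod_(j | P j) F j < 0) = \big[addb/false]_(j | P j) (F j < 0).
Proof.
move=> F0; suff [] : \prod_(j | P j) F j != 0 /\
  (\prod_(j | P j) F j < 0) = \big[addb/false]_(j | P j) (F j < 0) by [].
apply: (big_rec2 (fun x b => x != 0 /\ (x < 0) = b)); first by rewrite oner_neq0 ltr10.
move=> j y b Pj [y0 e]; rewrite mulf_neq0 ?F0 //; split=> //; rewrite -e.
move: (F0 j Pj) y0; rewrite !neq_lt => /orP[h1|h1] /orP[h2|h2].
- by rewrite h1 h2 ltNge mulr_le0 ?ltW.
- by rewrite h1 [y < 0]ltNge (ltW h2) nmulr_rlt0.
- by rewrite h2 [F j < 0]ltNge (ltW h1) pmulr_rlt0.
- by rewrite !ltNge !ltW // mulr_gt0.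
Qed.

Lemma sum_gt_odd (v M : nat) : \big[addb/false]_(j < M) (v < j)%N = odd (M.-1 - v).
Proof.
elim: M => [|M IH]; first by rewrite big_ord0.
rewrite big_ord_recr /= IH; case: (ltnP v M) => h.
  by rewrite addbT -[in RHS](prednK (leq_ltn_trans (leq0n v) h)) subSn //; lia.
by rewrite addbF; congr odd; lia.
Qed.

Lemma count_alternating (u M : nat) :
  (\sum_(v < M) ((val v != u) && (odd v (+) (v < u))) = if M <= u then uphalf M else M./2)%N.
Proof.
elim: M => [|M IH]; first by rewrite big_ord0.
rewrite big_ord_recr /= IH; case: (ltngtP M u) => h /=.
- by rewrite uphalf_half addbT; case: (odd M) => /=; lia.
- by rewrite addbF uphalf_half addnC.
- by rewrite h addn0.
Qed.

(** * Crossings on the moment curve *)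

Section Moment.
Variables (R : realFieldType) (k : nat) (V : eqType).
Let n := k.*2.
Let m := n.+3.
Let I := 'I_m.
Variables (kap : V -> nat -> R) (f : I -> V).
Hypotheses (f_inj : injective f) (kapf : forall v i, kap (f v) i = (v%:R : R) ^+ i).

(* Up to a common factor, the inverse of [lagr u v] is the coefficient of [v] in the affine
   dependency of all points of the moment curve but [u]. *)
Definition lagr (u v : I) : R := \prod_(j : I | (j != u) && (j != v)) (v%:R - j%:R).

Lemma lagr_neq0 u v : lagr u v != 0.
Proof.
apply/prodf_neq0 => j /andP[_ jv]; rewrite subr_eq0 eqr_nat.
by apply: contraNneq jv => e; apply/eqP/val_inj.
Qed.

Lemma lagr_lt0 (u v : I) : v != u -> (lagr u v < 0) = odd v (+) (v < u)%N.
Proof.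
move=> vu; rewrite prod_lt0; last first.
  move=> j /andP[_ jv]; rewrite subr_eq0 eqr_nat.
  by apply: contraNneq jv => e; apply/eqP/val_inj.
rewrite (eq_bigr (fun j : I => (v < j)%N)); last by move=> j _; rewrite subr_lt0 ltr_nat.
have := sum_gt_odd v m; rewrite (bigD1 u) // (bigD1 v) //= ltnn => e.
have -> : odd v = odd (m.-1 - v)%N.
  by have := ltn_ord v; rewrite /m /n /= => h; rewrite oddB //= ?odd_double.
by rewrite -e addbC addbA addbb.
Qed.

Definition moment_dep (u : I) (mu : I -> R) :=
  forall i, (i <= n)%N -> \sum_(v | v != u) mu v * v%:R ^+ i = 0.

(** Tested against the polynomial with roots at all points but [u], [v] and [v0], whose degree is
    [m - 3 = n], the dependency retains two terms. *)
Lemma moment_depE u mu : moment_dep u mu -> exists c, forall v, v != u -> mu v * lagr u v = c.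
Proof.
move=> dep.
have dep_poly (p : {poly R}) : (size p <= n.+1)%N -> \sum_(v | v != u) mu v * p.[v%:R] = 0.
  move=> sp; under eq_bigr do rewrite (horner_coef_wide _ sp) mulr_sumr.
  rewrite exchange_big /= big1 // => i _.
  under eq_bigr do rewrite mulrCA.
  by rewrite -mulr_sumr dep ?mulr0 // -ltnS.
have [v0 v0u] : exists v0 : I, v0 != u.
  by exists (lift u ord0); rewrite eq_sym neq_lift.
exists (mu v0 * lagr u v0) => v vu; case: (eqVneq v v0) => [->//|vv0].
pose p : {poly R} := \prod_(j : I | [&& j != u, j != v & j != v0]) ('X - (j%:R)%:P).
have sp : (size p <= n.+1)%N.
  rewrite /p -big_filter size_prod_XsubC size_filter.
  rewrite ltnS -sum1_count.
  have : (\sum_(j : I) 1 = m)%N by rewrite sum1_card card_ord.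
  rewrite (bigD1 u) // (bigD1 v) //= (bigD1 v0) /=; last by rewrite v0u eq_sym.
  rewrite /m => -[].
  set a := (\sum_(_ | _) _)%N; set b := (\sum_(_ <- _ | _) _)%N.
  suff -> : a = b by move=> <-.
  rewrite /a /b; apply: eq_bigl => j; by rewrite -!andbA.
have pE w w' : w != w' -> p.[w%:R] = \prod_(j : I | [&& j != u, j != v & j != v0]) (w%:R - j%:R).
  by move=> _; rewrite horner_prod; apply: eq_bigr => j _; rewrite hornerXsubC.
have e1 : lagr u v = (v%:R - v0%:R) * p.[v%:R].
  rewrite (pE v v0) // /lagr (bigD1 v0) ?v0u 1?eq_sym //=; congr (_ * _).
  by apply: eq_bigl => j; rewrite -!andbA.
have e0 : lagr u v0 = (v0%:R - v%:R) * p.[v0%:R].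
  rewrite (pE v0 v) 1?eq_sym // /lagr (bigD1 v) ?vu //=; congr (_ * _).
  by apply: eq_bigl => j; rewrite -!andbA; congr andb; rewrite andbC.
have := dep_poly p sp; rewrite (bigD1 v) //= (bigD1 v0) ?v0u 1?eq_sym //= big1 ?addr0.
  move=> e; rewrite e1 e0; apply/eqP; rewrite -subr_eq0.
  suff -> : mu v * ((v%:R - v0%:R) * p.[v%:R]) - mu v0 * ((v0%:R - v%:R) * p.[v0%:R]) =
     (v%:R - v0%:R) * (mu v * p.[v%:R] + mu v0 * p.[v0%:R]) by rewrite e mulr0.
  ring.
move=> w /andP[/andP[wu wv] wv0]; rewrite horner_prod (bigD1 w) /=; last by rewrite wu wv.
by rewrite hornerXsubC subrr mul0r mulr0.
Qed.

Lemma sum_mapf (s : {set I}) (w : V -> R) i :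
  \sum_(x <- map f (enum s)) w x * kap x i = \sum_(v in s) w (f v) * v%:R ^+ i.
Proof. by rewrite big_map big_enum /=; apply: eq_bigr => v _; rewrite kapf. Qed.

(** A nonzero dependency exists because there are [n + 2] vectors in dimension [n + 1]; by
    [moment_depE] it is proportional to the inverses. *)
Lemma moment_dep_lagr u : moment_dep u (fun v => (lagr u v)^-1).
Proof.
have uE : uniq (map f (enum (~: [set u]))) by rewrite map_inj_uniq ?enum_uniq.
have sE : size (map f (enum (~: [set u]))) = n.+2.
  by rewrite size_map -cardE cardsC1 card_ord.
have [|lam [dep [x]]] := @exists_dependency R n V kap _ uE; first by rewrite sE.
move=> /mapP [v]; rewrite mem_enum !inE => vu -> lv.
have dep' : moment_dep u (fun v => lam (f v)).
  move=> i iN; have := dep i iN; rewrite sum_mapf => e; rewrite -[RHS]e.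
  by apply: eq_bigl => w; rewrite !inE.
have [c hc] := moment_depE dep'.
have c0 : c != 0 by rewrite -(hc v vu) mulf_neq0 ?lagr_neq0.
move=> i iN; apply: (mulfI c0); rewrite mulr0 -[RHS](dep' i iN) mulr_sumr.
by apply: eq_bigr => w wu; rewrite mulrA -(hc w wu) mulfK ?lagr_neq0.
Qed.

(** With the points other than [u] numbered from 0, these are the even positions, where [lagr] is
    negative: one half of the alternating Radon partition. *)
Definition alt (u : I) : {set I} := [set v | (v != u) && (odd v (+) (v < u)%N)].
Definition alt' (u : I) : {set I} := [set v | (v != u) && ~~ (odd v (+) (v < u)%N)].

Lemma card_alt u : #|alt u| = k.+1.
Proof.
rewrite -sum1dep_card big_mkcond /= -[RHS](_ : (if m <= u then uphalf m else m./2) = _)%N.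
  by rewrite -count_alternating; apply: eq_bigr => v _; rewrite -val_eqE; case: ifP.
rewrite leqNgt ltn_ord /m /n. have -> : k.*2.+3 = (1 + k.+1.*2)%N by lia. by rewrite (half_bit_double _ true).
Qed.

Lemma disjoint_alt u : [disjoint alt u & alt' u].
Proof.
rewrite -setI_eq0; apply/eqP/setP => v; rewrite !inE.
by case: (v != u) => //=; rewrite andbN.
Qed.

Lemma alt_cover u : alt u :|: alt' u = ~: [set u].
Proof. by apply/setP => v; rewrite !inE -andb_orr orbN andbT. Qed.

Lemma card_alt' u : #|alt' u| = k.+1.
Proof.
have : #|alt u :|: alt' u| = n.+2 by rewrite alt_cover cardsC1 card_ord.
rewrite cardsU (disjoint_setI0 (disjoint_alt u)) cards0 subn0 card_alt /n; lia.
Qed.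

Definition fset (s : {set I}) := map f (enum s).

Lemma uniq_fset (s t : {set I}) : [disjoint s & t] -> uniq (fset s ++ fset t).
Proof.
move=> dst; rewrite -map_cat map_inj_uniq // cat_uniq !enum_uniq andbT /=.
by apply/hasPn => x; rewrite !mem_enum => xt; rewrite (disjointFl dst).
Qed.

Lemma cross_alt u : cross n kap (fset (alt u)) (fset (alt' u)).
Proof.
rewrite /cross uniq_fset ?disjoint_alt //=; apply/asboolP.
pose w x := if [pick v | f v == x] is Some v then `|(lagr u v)^-1| else 0.
have wf v : w (f v) = `|(lagr u v)^-1|.
  by rewrite /w; case: pickP => [v' /eqP/f_inj -> //|/(_ v)]; rewrite eqxx.
exists w; split=> [x|i iN].
  rewrite mem_cat => /orP[] /mapP [v _ ->]; by rewrite wf normr_gt0 invr_eq0 lagr_neq0.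
rewrite !sum_mapf; have := moment_dep_lagr u iN.
rewrite (bigID (fun v => v \in alt u)) /= => /eqP; rewrite addr_eq0 => /eqP e.
transitivity (- \sum_(v | (v != u) && (v \in alt u)) (lagr u v)^-1 * v%:R ^+ i).
  rewrite -sumrN; apply: eq_big => v; rewrite !inE ?andbA ?andbb // => /andP[vu h].
  by rewrite wf -mulNr ltr0_norm // invr_lt0 lagr_lt0.
rewrite e opprK; apply: eq_big => v; rewrite !inE; first by case: (v != u).
case: (boolP (v != u)) => //= vu h.
by rewrite wf gtr0_norm // invr_gt0 lt0r lagr_neq0 leNgt lagr_lt0.
Qed.

(** The [n + 2] points other than [u] have one affine dependency up to a factor, and its signs
    determine the two sides of a crossing up to exchange. *)
Lemma cross_moment u (s t : {set I}) : s :|: t = ~: [set u] -> [disjoint s & t] ->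
  cross n kap (fset s) (fset t) -> (s = alt u /\ t = alt' u) \/ (s = alt' u /\ t = alt u).
Proof.
move=> stu dst /andP[_ /asboolP [w [wpos wdep]]].
have stP v : (v \in s) || (v \in t) = (v != u).
  by have := congr1 (fun A : {set I} => v \in A) stu; rewrite !inE.
have wp v : v != u -> 0 < w (f v).
  by rewrite -stP => h; apply: wpos; rewrite mem_cat !mem_map // !mem_enum.
pose mu v := if v \in s then w (f v) else - w (f v).
have dep : moment_dep u mu.
  move=> i iN; rewrite (bigID (fun v => v \in s)) /=; have := wdep i iN; rewrite !sum_mapf => e.
  rewrite [X in X + _](eq_big (fun v => v \in s) (fun v => w (f v) * v%:R ^+ i)); first last.
  - by move=> v /andP[_ vs]; rewrite /mu vs.
  - by move=> v; case vs: (v \in s); rewrite ?andbT ?andbF // -stP vs.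
  rewrite e [X in _ + X](eq_big (fun v => v \in t) (fun v => - (w (f v) * v%:R ^+ i))).
  - by rewrite sumrN subrr.
  - move=> v; rewrite -stP; case vs: (v \in s); rewrite ?andbT ?andbF //=.
    by rewrite (disjointFr dst vs).
  - by move=> v /andP[_ vs]; rewrite /mu (negbTE vs) mulNr.
have [c hc] := moment_depE dep.
have mun v : v != u -> mu v != 0.
  by move=> vu; rewrite /mu; case: ifP => _; rewrite ?oppr_eq0 gt_eqF ?wp.
have c0 : c != 0.
  have vu : lift u ord0 != u by rewrite eq_sym neq_lift.
  by rewrite -(hc _ vu) mulf_neq0 ?lagr_neq0 ?mun.
have mulr_lt0' v : v != u -> (mu v < 0) = (v \notin s).
  move=> vu; rewrite /mu; case: ifP => vs; first by rewrite ltNge ltW ?wp.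
  by rewrite oppr_lt0 wp.
have key v : v != u -> (v \notin s) = (c < 0) (+) (lagr u v < 0).
  move=> vu; rewrite -mulr_lt0' // -(hc v vu).
  have := prod_lt0 (J := bool) (P := predT) (F := fun b => if b then mu v else lagr u v).
  rewrite !big_bool /= => -> //; first by rewrite -addbA addbb addbF.
  by case; rewrite ?mun ?lagr_neq0.
have tE v : v != u -> (v \in t) = (v \notin s).
  move=> vu; have := stP v; rewrite vu; case vs: (v \in s) => //= _.
  by rewrite (disjointFr dst vs).
case cl: (c < 0); [left|right]; split; apply/setP => v; rewrite !inE;
  (case: (eqVneq v u) => [->|vu] /=; first by have := stP u; rewrite eqxx; case: (u \in s); case: (u \in t)).
- by rewrite -lagr_lt0 // -[v \in s]negbK key // cl negbK.
- by rewrite tE // key // cl lagr_lt0.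
- by rewrite -lagr_lt0 // -[v \in s]negbK key // cl.
- by rewrite tE // key // cl lagr_lt0.
Qed.

(** Two disjoint [k]-faces miss exactly one vertex, each vertex is missed by exactly one crossing
    pair, and the number [2k + 3] of vertices is odd. *)
Lemma vkn_moment : vkn kap (fun s => [:: fset s]) = true.
Proof.
pose miss (p : {set I} * {set I}) (u : I) := u \notin p.1 :|: p.2.
rewrite /vkn (eq_bigr (fun p => \big[addb/false]_(u : I | miss p u) cross n kap (fset p.1) (fset p.2))).
  rewrite (exchange_big_dep predT) //=.
  rewrite (eq_bigr (fun=> true)); first by rewrite odd_sum_const card_ord /m /n /= odd_double.
  move=> u _.
  pose p0 := if (enum_rank (alt u) < enum_rank (alt' u))%N then (alt u, alt' u) else (alt' u, alt u).
  rewrite (bigD1 p0) /=; last first.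
    rewrite /good /miss /p0; case: ltnP => h /=; rewrite !card_alt !card_alt' !eqxx /=.
      by rewrite h disjoint_alt alt_cover !inE eqxx.
    rewrite disjoint_sym disjoint_alt setUC alt_cover !inE eqxx andbT /=.
    rewrite ltn_neqAle h andbT; apply/eqP => /ord_inj/enum_rank_inj e.
    by have := disjoint_alt u; rewrite e -setI_eq0 setIid -cards_eq0 card_alt.
  rewrite big1 ?addbF; first by rewrite /p0; case: ifP => _; rewrite ?cross_alt // crossC cross_alt.
  move=> [s t] /andP[/andP[/and4P[/= /eqP cs /eqP ct dst lt] mu] ne].
  apply/negP => hc.
  have stu : s :|: t = ~: [set u].
    apply/eqP; rewrite eqEcard cardsU disjoint_setI0 // cards0 subn0 cs ct cardsC1 card_ord.
    have {}mu : u \notin s :|: t := mu.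
    rewrite subsetC sub1set in_setC mu /= /m /n; lia.
  have [[e1 e2]|[e1 e2]] := cross_moment stu dst hc; move: ne; rewrite /p0; case: ifPn => h.
  - by rewrite e1 e2 eqxx.
  - by case/negP: h; rewrite -e1 -e2.
  - by rewrite -e1 -e2 in h; have := ltn_trans lt h; rewrite ltnn.
  - by rewrite e1 e2 eqxx.
move=> p /and4P[/eqP cs /eqP ct dst _].
rewrite /crossc !xs1 odd_sum_const.
rewrite (_ : #|[pred u | miss p u]| = 1%N) ?andbT //.
rewrite -[LHS](_ : #|~: (p.1 :|: p.2)| = _); last by apply: eq_card => u; rewrite in_setC.
by rewrite cardsCs setCK cardsU disjoint_setI0 // cards0 subn0 cs ct card_ord /m /n; lia.
Qed.
End Moment.

Lemma eq_general_position (R : realFieldType) n (V : eqType) (kap kap' : V -> nat -> R) L :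
  {in L, forall x, kap x =1 kap' x} -> general_position n kap L -> general_position n kap' L.
Proof.
move=> e gL S uS SL sS lam dep; apply: gL => // i iN.
rewrite -[RHS](dep i iN) big_seq [RHS]big_seq; apply: eq_bigr => x /SL xL.
by rewrite e.
Qed.

Lemma perturb_general_position (R : realFieldType) n (V : eqType) (kap : V -> nat -> R)
    (L L2 : seq V) (e : R) :
  uniq (L2 ++ L) -> general_position n kap L -> 0 < e -> {in L2, forall x, kap x 0%N = 1} ->
  exists kap', [/\ forall x, x \notin L2 -> kap' x = kap x,
    {in L2, forall x, kap' x 0%N = 1 /\ forall i, (i <= n)%N -> `|kap' x i - kap x i| < e} &
    general_position n kap' (L2 ++ L)].
Proof.
elim: L2 => [|y L2 IH] /=; first by move=> _ gL _ _; exists kap.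
move=> /andP[yL u] gL e0 k1.
have [|kap1 [k1_out k1_in g1]] := IH u gL e0.
  by move=> x xL2; apply: k1; rewrite inE xL2 orbT.
have yL2 : y \notin L2 by move: yL; rewrite mem_cat negb_or => /andP[].
have y1 : kap y 0%N = 1 by apply: k1; rewrite mem_head.
have [|kap' [h1 h2 h3 h4]] := extend_general_position u yL g1 (c := kap1 y) _ e0.
  by rewrite k1_out.
exists kap'; split=> //.
  by move=> x; rewrite inE negb_or => /andP[xy xL2]; rewrite h1 // k1_out.
move=> x; rewrite inE; case: (eqVneq x y) => [-> _|xy /= xL2].
  by rewrite h2 k1_out //; split=> // i /h3; rewrite k1_out.
by rewrite h1 //; apply: k1_in.
Qed.

(** * The homological van Kampen-Flores theorem *)

Section VanKampenFlores.
Variables (R : realFieldType) (k : nat) (W : eqType).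
Let n := k.*2.
Let m := n.+3.
Let I := 'I_m.
Variables (c : W -> nat -> R) (phi : {set I} -> seq (seq W)) (e : R).
Hypotheses (c1 : forall x, c x 0%N = 1) (e0 : 0 < e) (phi0 : phi set0 = [:: [::]])
  (phi_map : chain_map phi)
  (phi_size : forall s : {set I}, (#|s| <= k.+1)%N -> {in phi s, forall P, size P = #|s|})
  (phi_disj : forall s t : {set I}, (#|s| <= k.+1)%N -> (#|t| <= k.+1)%N -> [disjoint s & t] ->
     forall P Q, P \in phi s -> Q \in phi t -> forall x, x \in P -> x \notin Q).

(** Besides the given points: an apex for each face, for the cones of the homotopy, and a point of
    the moment curve for each vertex, for the standard map [psi]. *)
Let V := (W + ({set I} + I))%type.
Let apex (s : {set I}) : V := inr (inl s).
Let base (v : I) : V := inr (inr v).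

(* The vertices that tuples over [s] may use; disjointness of these sets for disjoint faces is
   what the fresh points [apex] and [base] are for. *)
Definition ter (s : {set I}) (x : V) : bool :=
  match x with
  | inl p => [exists r : {set I}, [&& r \subset s, (#|r| <= k.+1)%N & p \in flatten (phi r)]]
  | inr (inl r) => (r != set0) && (r \subset s)
  | inr (inr v) => v \in s
  end.

Lemma ter_mono (s t : {set I}) x : s \subset t -> ter s x -> ter t x.
Proof.
move=> st; case: x => [p|[r|v]] /=.
- move=> /existsP [r /and3P[rs cr pr]]; apply/existsP; exists r.
  by rewrite (subset_trans rs st) cr.
- by move=> /andP[-> rs]; apply: subset_trans st.
- exact: (subsetP st).
Qed.

Lemma ter_disj (s t : {set I}) x : [disjoint s & t] -> ter s x -> ~~ ter t x.
Proof.
move=> st; case: x => [p|[r|v]] /=.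
- move=> /existsP [r /and3P[rs cr /flattenP [P Pr pP]]]; apply/existsP => -[r' /and3P[rt cr' /flattenP [Q Qr pQ]]].
  have rr' : [disjoint r & r'] by apply: disjointWl rs (disjointWr rt st).
  by have := phi_disj cr cr' rr' Pr Qr pP; rewrite pQ.
- move=> /andP[r0 rs]; rewrite r0 /=; apply: contraNN r0 => rt.
  by rewrite -subset0 -(disjoint_setI0 st) subsetI rs.
- by move=> vs; rewrite (disjointFr st vs).
Qed.

Let phiV (s : {set I}) : seq (seq V) := map (map inl) (phi s).
Let psi (s : {set I}) : seq (seq V) := [:: fset base s].

Lemma phiV_map : chain_map phiV.
Proof.
move=> s cs f; rewrite cbd_map xs_map phi_map // !xs_flatten.
by apply: eq_xs => x; rewrite xs_map.
Qed.

Lemma base_inj : injective base. Proof. by move=> a b []. Qed.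

Lemma psi_bd (s : {set I}) f : xs f (cbd (psi s)) = \big[addb/false]_(x in s) xs f (psi (s :\ x)).
Proof.
have us : uniq (fset base s) by rewrite map_inj_uniq ?enum_uniq //; apply: base_inj.
rewrite /cbd /= cats0 xs_tbd_uniq // xs_map /xs big_enum; apply: eq_bigr => x _.
rewrite big_seq1 /= rem_filter // filter_map; congr (f (map _ _)).
rewrite /enum_mem -filter_predI; apply: eq_filter => y /=.
by rewrite !inE (inj_eq base_inj).
Qed.

(** [phiV s], [psi s] and the homotopy on the boundary of [s] add up to a cycle, which the cone from
    the apex of [s] fills. Nothing obstructs the cones, as vertices are abstract and may be placed
    anywhere. The counter [j] stands for the number of vertices of [s]. *)
Fixpoint hom_rec j (s : {set I}) : seq (seq V) :=
  if j is j'.+1 then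
    map (cons (apex s)) (phiV s ++ psi s ++ flatten [seq hom_rec j' (s :\ x) | x <- enum s])
  else [::].
Definition hom (s : {set I}) := hom_rec #|s| s.

Lemma hom0 : hom set0 = [::].
Proof. by rewrite /hom cards0. Qed.

Lemma homE (s : {set I}) : s != set0 ->
  hom s = map (cons (apex s)) (phiV s ++ psi s ++ flatten [seq hom (s :\ x) | x <- enum s]).
Proof.
rewrite -card_gt0 /hom; case cs: #|s| => [//|j] _ /=.
suff -> : [seq hom_rec j (s :\ x) | x <- enum s] =
    [seq hom_rec #|s :\ x| (s :\ x) | x <- enum s] by [].
apply/eq_in_map => x; rewrite mem_enum => xs.
by move: cs; rewrite (cardsD1 x s) xs add1n => -[->].
Qed.

Lemma hom_homotopy (s : {set I}) : (#|s| <= k.+1)%N -> forall f, xs f (cbd (hom s)) (+)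
   \big[addb/false]_(x in s) xs f (hom (s :\ x)) = xs f (phiV s) (+) xs f (psi s).
Proof.
have [j] := ubnP #|s|; elim: j s => // j IH s; rewrite ltnS => sj sk f.
have [->|s0] := eqVneq s set0.
  rewrite hom0 xs_cbd xs_nil big1 /=; last by move=> x; rewrite inE.
  rewrite /phiV phi0 /psi /= !xs1 /fset.
  by rewrite (_ : enum _ = [::]) ?addbb //; apply: size0nil; rewrite -cardE cards0.
rewrite (homE s0) xs_cbd_cone !xs_cat (xs_flatten_enum f (fun x => hom (s :\ x))).
set g := f \o cons (apex s).
(* The boundary of a cone is its base plus the cone over the boundary of the base, so it remains to
   see that the base is a cycle. *)
suff h0 : xs g (cbd (phiV s ++ psi s ++ flatten [seq hom (s :\ x) | x <- enum s])) = false.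
  by rewrite h0 addbF -!addbA addbb addbF.
rewrite xs_cbd !xs_cat -(xs_cbd g (phiV s)) -(xs_cbd g (psi s)) psi_bd phiV_map; last by rewrite card_gt0 s0.
rewrite (xs_flatten_enum g (fun x => phiV (s :\ x))).
rewrite (xs_flatten_enum _ (fun x => hom (s :\ x))).
rewrite addbA -!big_split /=.
have hx x : x \in s -> xs (fun P => xs g (tbd P)) (hom (s :\ x)) =
    (xs g (phiV (s :\ x)) (+) xs g (psi (s :\ x))) (+)
    \big[addb/false]_(y in s :\ x) xs g (hom (s :\ x :\ y)).
  move=> xs; have cx : (#|s :\ x|.+1 = #|s|)%N by rewrite (cardsD1 x s) xs.
  rewrite -xs_cbd -(IH (s :\ x)) ?addbK //; last by rewrite ltnW // cx.
  by rewrite cx.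
rewrite (eq_bigr (fun x => \big[addb/false]_(y in s :\ x) xs g (hom (s :\ x :\ y)))).
  exact: (sbd_sbd0 s (fun t => xs g (hom t))).
by move=> x xs; rewrite hx // addbA addbb.
Qed.

Lemma phiV_carried : carried ter phiV 0.
Proof.
move=> s sk; rewrite addn0; apply/Forall_map/Forall_inP => P Ps; split.
  by rewrite size_map; apply: phi_size.
rewrite all_map; apply/allP => x xP /=; apply/existsP; exists s.
by rewrite subxx sk; apply/flattenP; exists P.
Qed.

Lemma psi_carried (s : {set I}) : tuples_in ter #|s| s (psi s).
Proof.
constructor=> //; split; first by rewrite size_map -cardE.
by rewrite all_map; apply/allP => x /=; rewrite mem_enum.
Qed.

Lemma hom_carried : carried ter hom 1.
Proof.
move=> s; have [j] := ubnP #|s|; elim: j s => // j IH s; rewrite ltnS => sj sk.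
have [->|s0] := eqVneq s set0; first by rewrite hom0; constructor.
rewrite (homE s0) addn1; apply/Forall_map.
have : tuples_in ter #|s| s (phiV s ++ psi s ++ flatten [seq hom (s :\ x) | x <- enum s]).
  apply/Forall_cat; split; first by have := phiV_carried sk; rewrite addn0.
  apply/Forall_cat; split; first exact: psi_carried.
  apply: tuples_in_flatten => x; rewrite mem_enum => xs.
  have cx : (#|s :\ x| + 1 = #|s|)%N by rewrite (cardsD1 x s) xs addnC.
  rewrite -cx; apply: (tuples_in_sub ter_mono (subD1set s x)); apply: IH; lia.
apply: List.Forall_impl => P [sP tP]; split; first by rewrite /= sP.
by rewrite /= tP s0 subxx.
Qed.

Definition vertices : seq W :=
  flatten (flatten (map phi [seq s : {set I} <- enum {set I} | (#|s| <= k.+1)%N])).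

Theorem van_kampen_flores : exists kap : W -> nat -> R,
  {in vertices, forall x,
     kap x 0%N = 1 /\ forall i, (i <= n)%N -> `|kap x i - c x i| < e} /\
  exists s t : {set I}, [/\ #|s| = k.+1, #|t| = k.+1, [disjoint s & t] &
    exists P Q, [/\ P \in phi s, Q \in phi t & cross n kap P Q]].
Proof.
set Z := vertices.
(* The points of the moment curve are in general position and stay fixed, as [vkn_moment] requires;
   the given points and the apexes, which start at the origin, get perturbed. *)
pose kap0 (x : V) i : R := match x with
  | inl p => c p i | inr (inl _) => (i == 0%N)%:R | inr (inr v) => v%:R ^+ i end.
pose L := map base (enum I).
pose L2 : seq V := map inl (undup Z) ++ map apex (enum {set I}).
have inl_inj : injective (inl : W -> V) by move=> x y [].
have apex_inj : injective apex by move=> x y [].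
have uL : uniq (L2 ++ L).
  have u1 : uniq (map (inl : W -> V) (undup Z)) by rewrite map_inj_uniq ?undup_uniq.
  have u2 : uniq (map apex (enum {set I})) by rewrite map_inj_uniq ?enum_uniq.
  have u3 : uniq L by rewrite map_inj_uniq ?enum_uniq //; exact: base_inj.
  rewrite /L2 !cat_uniq u1 u2 u3 /= !andbT; apply/andP; split; apply/hasPn => _ /mapP [v _ ->].
    by apply/negP => /mapP [].
  by rewrite mem_cat; apply/negP => /orP[] /mapP [].
have gL : general_position n kap0 L.
  pose t (x : V) : R := if x is inr (inr v) then v%:R else 0.
  apply: (@eq_general_position _ _ _ (fun x i => t x ^+ i)).
    by move=> _ /mapP [v _ ->].
  apply: moment_general_position => _ _ /mapP [v _ ->] /mapP [w _ ->] /= /eqP.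
  by rewrite eqr_nat => /eqP e'; congr base; apply: val_inj.
have [|kap [k_out k_in g]] := perturb_general_position uL gL e0.
  move=> x; rewrite mem_cat => /orP[] /mapP [y _ ->] //=; exact: c1.
have terL s x : ter s x -> x \in L2 ++ L.
  case: x => [p|[r|v]] h; rewrite !mem_cat.
  - apply/orP; left; apply/orP; left; apply: map_f; rewrite mem_undup.
    have /existsP [r /and3P[_ cr /flattenP [P Pr pP]]] := h.
    apply/flattenP; exists P => //; apply/flattenP; exists (phi r) => //.
    by apply: map_f; rewrite mem_filter cr mem_enum.
  - by rewrite (@map_f _ _ apex) ?mem_enum ?orbT.
  - by rewrite (@map_f _ _ base) ?mem_enum ?orbT.
have kap_base v i : kap (base v) i = v%:R ^+ i.
  rewrite k_out // mem_cat; apply/negP => /orP[] /mapP [] //.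
exists (fun x => kap (inl x)); split.
  by move=> x xZ; have [] := k_in (inl x); rewrite // mem_cat map_f ?mem_undup.
have : vkn kap phiV = true.
  rewrite -(vkn_moment base_inj kap_base) -/psi; symmetry.
  apply: (vkn_homotopy g terL ter_mono ter_disj phiV_map phiV_carried hom_carried hom0).
  by move=> s cs; apply: hom_homotopy; rewrite cs.
case: (boolP [exists p : {set I} * {set I}, good p && crossc k kap (phiV p.1) (phiV p.2)]).
  move=> /existsP [[s t] /andP[/and4P[/= /eqP cs /eqP ct dst _] h]] _.
  exists s, t; split=> //; move: h; rewrite /crossc xs_map.
  have [h _|] := boolP (has (fun P => has (fun Q => cross n (fun x => kap (inl x)) P Q) (phi t)) (phi s)).
    by case/hasP: h => P Ps /hasP [Q Qt h]; exists P, Q.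
  move=> /hasPn h; rewrite /xs big1_seq // => P /= /h /hasPn h'.
  rewrite big1_seq // => _ /= /mapP [Q /h' hQ ->].
  apply: contraNF hQ => /andP[u /asboolP [w [w0 wE]]]; apply/andP; split.
    by move: u; rewrite -map_cat map_inj_uniq.
  apply/asboolP; exists (fun x => w (inl x)); split.
    by move=> x xPQ; apply: w0; rewrite -map_cat map_f.
  by move=> i /wE; rewrite !big_map.
move=> /existsPn h; rewrite /vkn big1 // => p gp; have := h p; rewrite gp /=.
by move/negbTE.
Qed.
End VanKampenFlores.
End VanKampenFlores.

Module Compactness.
Import ssreflect Reals Lra Lia Classical FunctionalExtensionality.
Unset Implicit Arguments.
Local Open Scope R_scope.

(** * Compactness of the standard simplex *)

Lemma supdist_lt n x y e : 0 < e ->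
  supdist n x y < e <-> forall i, (i < n)%nat -> Rabs (x i - y i) < e.
Proof.
move=> e0; elim: n => [|n IH] /=; first by split=> // _; lia.
split=> [h i ni|h].
  have hm : supdist n x y < e /\ Rabs (x n - y n) < e by apply/Rmax_Rlt.
  have [->|ne] := Nat.eq_dec i n; first by case: hm.
  by apply: (proj1 IH (proj1 hm)); lia.
by apply: Rmax_lub_lt; [apply/IH => i ni; apply: h; lia|apply: h; lia].
Qed.

(** [A t e] is to be read as: scale [e] is good at [t]. The supremum of those [x] for which one
    scale serves all of [[0, x]] is 1 and is attained. *)
Lemma segment_compactness (A : R -> R -> Prop) :
  (forall t e e', 0 < e' <= e -> A t e -> A t e') ->
  (forall t, 0 <= t <= 1 -> exists e, 0 < e /\ forall s, 0 <= s <= 1 -> Rabs (s - t) < e -> A s e) ->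
  exists e, 0 < e /\ forall s, 0 <= s <= 1 -> A s e.
Proof.
move=> mono loc.
pose E x := 0 <= x <= 1 /\ exists e, 0 < e /\ forall s, 0 <= s <= x -> A s e.
have E0 : E 0.
  split; first lra; have [|e [e0 he]] := loc 0; first lra.
  exists e; split=> // s sx; apply: he; first lra.
  by rewrite Rabs_pos_eq; lra.
have [c [ub lub]] : {c | is_lub E c}.
  apply: completeness; last by exists 0.
  by exists 1 => x [h _]; lra.
have c0 : 0 <= c by apply: ub.
have c1 : c <= 1 by apply: lub => x [h _]; lra.
have [e [e0 he]] := loc c (conj c0 c1).
have [x [Ex xc]] : exists x, E x /\ c - e < x.
  apply: NNPP => h; have : c <= c - e; last lra.
  by apply: lub => x Ex; apply: Rnot_lt_le => hx; apply: h; exists x.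
have xlec := ub x Ex.
case: Ex => [[x0 x1] [e' [e'0 he']]].
have ext z : x <= z <= 1 -> z < c + e -> E z.
  move=> hz zc; split; first lra; exists (Rmin e e'); split; first exact: Rmin_glb_lt.
  have min_pos := Rmin_glb_lt _ _ _ e0 e'0.
  move=> s hs; have [sx|sx] := Rle_lt_dec s x.
    by apply: (mono _ e'); [split=> //; apply: Rmin_r|apply: he'; lra].
  apply: (mono _ e); first by split=> //; apply: Rmin_l.
  by apply: he; first lra; apply: Rabs_def1; lra.
have c_1 : c = 1.
  have [//|lt] : c = 1 \/ c < 1 by lra.
  have : E (Rmin 1 (c + e / 2)).
    apply: ext; last by have := Rmin_r 1 (c + e / 2); lra.
    by split; [apply: Rmin_glb; lra|apply: Rmin_l].
  have lt2 : c < c + e / 2 by lra.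
  move/ub => h1; have h2 := Rmin_glb_lt 1 (c + e / 2) c lt lt2; lra.
have [_ [e2 [e20 he2]]] : E 1 by apply: ext; lra.
by exists e2.
Qed.

Definition cube n (x : point) := forall i, ((i < n)%nat -> 0 <= x i <= 1) /\ ((n <= i)%nat -> x i = 0).

Definition upd (x : point) n t : point := fun i => if Nat.eqb i n then t else x i.

Lemma cube_compactness n (A : point -> R -> Prop) :
  (forall t e e', 0 < e' <= e -> A t e -> A t e') ->
  (forall x, cube n x -> exists e, 0 < e /\
     forall u, cube n u -> supdist n u x < e -> A u e) ->
  exists e, 0 < e /\ forall u, cube n u -> A u e.
Proof.
elim: n A => [|n IH] A mono loc.
  have cz : cube 0 zero_point by move=> i; split=> //; lia.
  have [e [e0 he]] := loc _ cz; exists e; split=> // u cu.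
  have -> : u = zero_point by apply: functional_extensionality => i; apply: (proj2 (cu i)); lia.
  by apply: he.
have [||e [e0 he]] := segment_compactness (fun t e => forall u, cube (S n) u -> u n = t -> A u e).
- by move=> t e e' h hA u cu ut; apply: mono h _; apply: hA.
- move=> t ht.
  have [||e [e0 he]] := IH (fun v e => forall u, cube (S n) u -> upd u n 0 = v -> Rabs (u n - t) < e -> A u e).
  + move=> v e e' h hA u cu uv ut; apply: (mono _ _ _ h); apply: hA => //; lra.
  + move=> v cv.
    have cx : cube (S n) (upd v n t).
      move=> i; rewrite /upd; case: (Nat.eqb_spec i n) => [->|ne]; first by split=> //; lia.
      by split=> h; apply cv; lia.
    have [e [e0 he]] := loc _ cx; exists e; split=> // v' cv' vv' u cu uv' ut.
    apply: he => //; apply/(supdist_lt _ _ _ _ e0) => i hi; rewrite /upd.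
    case: (Nat.eqb_spec i n) => [->//|ne].
    have := proj1 (supdist_lt _ _ _ _ e0) vv' i; rewrite -uv' /upd.
    by case: (Nat.eqb_spec i n) => // _; apply; lia.
  exists e; split=> // s hs st u cu us; apply: (he (upd u n 0)) => //; last by rewrite us.
  move=> i; rewrite /upd; case: (Nat.eqb_spec i n) => [->|ne]; first by split=> //; lia.
  by split=> h; apply cu; lia.
by exists e; split=> // u cu; apply: (he (u n)) => //; apply: (proj1 (cu n)); lia.
Qed.

Lemma sum_first_dist n x y e : 0 < e -> supdist n x y < e ->
  Rabs (sum_first n x - sum_first n y) <= INR n * e.
Proof.
move=> e0 /(supdist_lt _ _ _ _ e0); elim: n => [|n IH] h.
  by rewrite /= Rminus_diag Rabs_R0; lra.
rewrite S_INR /=.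
have h1 : Rabs (sum_first n x - sum_first n y) <= INR n * e.
  by apply: IH => i hi; apply: h; lia.
have h2 := h n (le_n _).
have -> : sum_first n x + x n - (sum_first n y + y n) =
  (sum_first n x - sum_first n y) + (x n - y n) by ring.
have := Rabs_triang (sum_first n x - sum_first n y) (x n - y n); lra.
Qed.

Lemma sum_first_ge n x : (forall i, (i < n)%nat -> 0 <= x i) ->
  0 <= sum_first n x /\ forall i, (i < n)%nat -> x i <= sum_first n x.
Proof.
elim: n => [|n IH] h /=; first by split; [lra|lia].
have [|h1 h2] := IH; first by move=> i hi; apply: h; lia.
have hn := h n (le_n _); split; first lra.
move=> i hi; have [->|ne] := Nat.eq_dec i n; first lra.
have lt : (i < n)%nat by lia.
by have := h2 i lt; lra.
Qed.

Lemma simplex_cube k t : std_simplex k t -> cube (S k) t.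
Proof.
move=> [h1 [h2 h3]] i; split=> hi; last by apply: h2; lia.
have [|_ h] := sum_first_ge (S k) t; first by move=> j hj; apply: h1; lia.
by split; [apply: h1; lia|rewrite -h3; apply: h].
Qed.

Lemma simplex_compactness k (A : point -> R -> Prop) :
  (forall t e e', 0 < e' <= e -> A t e -> A t e') ->
  (forall x, std_simplex k x -> exists e, 0 < e /\
     forall u, std_simplex k u -> supdist (S k) u x < e -> A u e) ->
  exists e, 0 < e /\ forall u, std_simplex k u -> A u e.
Proof.
move=> mono loc.
have [||e [e0 he]] := cube_compactness (S k) (fun u e => std_simplex k u -> A u e).
- by move=> t e e' h hA su; apply: mono h _; apply: hA.
- move=> x cx; have [sx|nsx] := classic (std_simplex k x).
    by have [e [e0 he]] := loc x sx; exists e; split=> // u _ ux su; apply: he.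
  have x1 : sum_first (S k) x <> 1.
    move=> h; apply: nsx; split; first by move=> i hi; apply cx; lia.
    by split=> // i hi; apply cx; lia.
  have a0 : 0 < Rabs (sum_first (S k) x - 1) by apply: Rabs_pos_lt; lra.
  have n0 : 0 < INR (S k) + 1 by have := pos_INR (S k); lra.
  (* Within this distance the coordinate sum changes by less than its difference from 1, so there is
     no point of the simplex; the added 1 makes the estimate strict. *)
  exists (Rabs (sum_first (S k) x - 1) / (INR (S k) + 1)).
  have e0 := Rdiv_lt_0_compat _ _ a0 n0; split=> // u _ ux [_ [_ su]].
  have := sum_first_dist _ _ _ _ e0 ux; rewrite su Rabs_minus_sym.
  set a := Rabs _ in a0 e0 *.
  have : a / (INR (S k) + 1) * (INR (S k) + 1) = a by field; lra.
  rewrite Rmult_plus_distr_l Rmult_1_r; lra.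
by exists e; split=> // u su; apply: he => //; apply: simplex_cube.
Qed.

Lemma simplex_uniform_continuity d X k s e : sing_simplex d X k s -> 0 < e ->
  exists de, 0 < de /\ forall t u, std_simplex k t -> std_simplex k u ->
    supdist (S k) t u < de -> supdist d (s t) (s u) < e.
Proof.
move=> [_ [_ sc]] e0.
have [||de [de0 hd]] := simplex_compactness k (fun t de => forall u, std_simplex k u ->
    supdist (S k) t u < de -> supdist d (s t) (s u) < e).
- move=> t e1 e2 h hA u su tu; apply: hA => //; lra.
- move=> x sx; have e2 : 0 < e / 2 by lra.
  have [de [de0 hd]] := sc x sx (e / 2) e2; exists (de / 2); split; first lra.
  have de20 : 0 < de / 2 by lra.
  move=> t st tx u su tu.
  have h1 : supdist d (s t) (s x) < e / 2.
    apply: hd => //; apply/(supdist_lt _ _ _ _ de0) => i hi.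
    by have := proj1 (supdist_lt _ _ _ _ de20) tx i hi; lra.
  have h2 : supdist d (s u) (s x) < e / 2.
    apply: hd => //; apply/(supdist_lt _ _ _ _ de0) => i hi.
    have := proj1 (supdist_lt _ _ _ _ de20) tx i hi.
    have := proj1 (supdist_lt _ _ _ _ de20) tu i hi.
    move=> a b; apply: Rabs_def1; move: (Rabs_def2 _ _ a) (Rabs_def2 _ _ b); lra.
  apply/(supdist_lt _ _ _ _ e0) => i hi.
  have := proj1 (supdist_lt _ _ _ _ e2) h1 i hi.
  have := proj1 (supdist_lt _ _ _ _ e2) h2 i hi.
  move=> a b; apply: Rabs_def1; move: (Rabs_def2 _ _ a) (Rabs_def2 _ _ b); lra.
by exists de; split=> // t u st su; apply: hd.
Qed.

(** Compactness is used twice: a point outside the image of [t] has positive distance from it, and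
    this distance is bounded below along [s]. *)
Lemma simplices_apart d X Y k l s t : sing_simplex d X k s -> sing_simplex d Y l t ->
  (forall x, X x -> ~ Y x) ->
  exists e, 0 < e /\ forall x y, std_simplex k x -> std_simplex l y -> ~ supdist d (s x) (t y) < e.
Proof.
move=> [sX [_ sc]] [tY [_ tc]] XY.
have step p : X p -> inRd d p -> exists e, 0 < e /\
    forall y, std_simplex l y -> ~ supdist d p (t y) < e.
  move=> Xp dp.
  have [||e [e0 he]] := simplex_compactness l (fun y e => ~ supdist d p (t y) < e).
  - move=> y e1 e2 h; lra.
  - move=> y ly; have [Yt dt] := tY y ly.
    (* Distances involve the first [d] coordinates only; the others vanish at both points. *)
    have ne : exists i, (i < d)%nat /\ p i <> t y i.
      apply: NNPP => h; apply: (XY p) => //; suff -> : p = t y by [].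
      apply: functional_extensionality => i; have [lt|ge] := Nat.lt_ge_cases i d.
        by apply: NNPP => ne; apply: h; exists i.
      by rewrite dp ?dt.
    have [i [hi pi]] := ne.
    pose e := Rabs (p i - t y i) / 2.
    have e0 : 0 < e by apply: Rdiv_lt_0_compat; [apply: Rabs_pos_lt; lra|lra].
    have [de [de0 hd]] := tc y ly e e0.
    exists (Rmin e de); split; first exact: Rmin_glb_lt.
    move=> u lu uy h.
    have h1 : supdist d (t u) (t y) < e.
      by apply: hd => //; apply: Rlt_le_trans uy _; apply: Rmin_r.
    have h2 : supdist d p (t u) < e by apply: Rlt_le_trans h _; apply: Rmin_l.
    have a := proj1 (supdist_lt _ _ _ _ e0) h1 i hi.
    have b := proj1 (supdist_lt _ _ _ _ e0) h2 i hi.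
    have : Rabs (p i - t y i) < 2 * e; last by rewrite /e; lra.
    apply: Rabs_def1; move: (Rabs_def2 _ _ a) (Rabs_def2 _ _ b); lra.
  by exists e.
have [||e [e0 he]] := simplex_compactness k (fun x e => forall y, std_simplex l y ->
    ~ supdist d (s x) (t y) < e).
- move=> x e1 e2 h hA y ly /(fun h' => Rlt_le_trans _ _ _ h' (proj2 h)); exact: hA.
- move=> x kx; have [Xs ds] := sX x kx; have [e [e0 he]] := step _ Xs ds.
  have e20 : 0 < e / 2 by lra.
  have [de [de0 hd]] := sc x kx (e / 2) e20.
  exists (Rmin (e / 2) de); split; first exact: Rmin_glb_lt.
  move=> u ku ux y ly h; apply: (he y ly).
  have h1 : supdist d (s u) (s x) < e / 2.
    by apply: hd => //; apply: Rlt_le_trans ux _; apply: Rmin_r.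
  have h2 : supdist d (s u) (t y) < e / 2 by apply: Rlt_le_trans h _; apply: Rmin_l.
  apply/(supdist_lt _ _ _ _ e0) => i hi.
  have a := proj1 (supdist_lt _ _ _ _ e20) h1 i hi.
  have b := proj1 (supdist_lt _ _ _ _ e20) h2 i hi.
  apply: Rabs_def1; move: (Rabs_def2 _ _ a) (Rabs_def2 _ _ b); lra.
by exists e; split=> // x y kx; apply: he.
Qed.
End Compactness.

Module HellyNumber.
Import all_boot all_order all_algebra boolp Rstruct ring lra zify.
Import ConstrainedMaps GeneralPosition VanKampenNumber VanKampenFlores Compactness.
Import Order.TTheory GRing.Theory Num.Theory.
Close Scope R_scope.
Local Open Scope ring_scope.
Local Notation R := Rdefinitions.R.

(** * Barycentric subdivision *)

Definition bary (P : seq point) : point := fun i => (\sum_(v <- P) v i) / (size P)%:R.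

(** Cones from the barycentre over the subdivided facets; the counter is the length of the tuple. *)
Fixpoint sd_rec j (P : seq point) : seq (seq point) :=
  if j is j'.+1 then map (cons (bary P)) (flatten (map (sd_rec j') (tbd P))) else [:: [::]].

Definition sd P := sd_rec (size P) P.

Definition sdc (c : seq (seq point)) := flatten (map sd c).

Lemma map_Forall (S T : Type) (f g : S -> T) (l : seq S) :
  List.Forall (fun x => f x = g x) l -> map f l = map g l.
Proof. by elim=> //= x l' -> _ ->. Qed.

Lemma sdE v P : sd (v :: P) = map (cons (bary (v :: P))) (sdc (tbd (v :: P))).
Proof.
rewrite /sd /sdc [size _]/= /sd_rec -/sd_rec; congr (map _ (flatten _)).
apply: map_Forall; apply: List.Forall_impl (size_tbd (v :: P)) => Q /= [sQ].
by rewrite /sd sQ.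
Qed.

Lemma xs_sdc f c : xs f (sdc c) = xs (fun P => xs f (sd P)) c.
Proof. exact: xs_flatten. Qed.

(** [sd P] is a cone over [sdc (tbd P)], which is a cycle by induction, so the boundary of the cone
    is its base. *)
Lemma cbd_sd P : ceq (cbd (sd P)) (sdc (tbd P)).
Proof.
have [j] := ubnP (size P); elim: j P => // j IH [|v P]; first by [].
rewrite ltnS => sP f; rewrite sdE xs_cbd_cone.
set g := f \o cons _; suff -> : xs g (cbd (sdc (tbd (v :: P)))) = false by rewrite addbF.
rewrite xs_cbd xs_sdc.
rewrite (@eq_xs_in _ _ (fun Q => xs g (sdc (tbd Q)))).
  transitivity (xs (fun P => xs g (sd P)) (cbd (tbd (v :: P)))); last exact: tbd_tbd.
  by rewrite xs_cbd; apply: eq_xs => Q; rewrite xs_sdc.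
apply: List.Forall_impl (size_tbd (v :: P)) => Q /= [sQ].
by rewrite -xs_cbd; apply: IH; rewrite sQ.
Qed.

Lemma cbd_sdc c : ceq (cbd (sdc c)) (sdc (cbd c)).
Proof.
move=> f; rewrite xs_cbd !xs_sdc !xs_cbd; apply: eq_xs => P.
by rewrite -xs_cbd cbd_sd xs_sdc.
Qed.

Lemma cbd_iter_sdc N c : ceq (cbd (iter N sdc c)) (iter N sdc (cbd c)).
Proof.
elim: N => //= N IH f; rewrite cbd_sdc !xs_sdc; exact: IH.
Qed.

Lemma iter_sdc_nil N : iter N sdc [:: [::]] = [:: [::]].
Proof. by elim: N => //= N ->. Qed.

Lemma sd_map (g : point -> point) : (forall P, bary (map g P) = g (bary P)) ->
  forall P, sd (map g P) = map (map g) (sd P).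
Proof.
move=> gb P; have [j] := ubnP (size P); elim: j P => // j IH [|v P]; first by [].
rewrite ltnS => sP.
have h : List.Forall (fun Q => sd (map g Q) = map (map g) (sd Q)) (tbd (v :: P)).
  by apply: List.Forall_impl (size_tbd (v :: P)) => Q /= [sQ]; apply: IH; rewrite sQ.
have sdc_h : sdc (map (map g) (tbd (v :: P))) = map (map g) (sdc (tbd (v :: P))).
  by rewrite /sdc; elim: h => //= Q c -> _ ->; rewrite map_cat.
transitivity (map (cons (bary (map g (v :: P)))) (sdc (tbd (map g (v :: P))))); first exact: sdE.
by rewrite sdE gb tbd_map sdc_h -!map_comp.
Qed.

Lemma iter_sdc_map (g : point -> point) N c : (forall P, bary (map g P) = g (bary P)) ->
  iter N sdc (map (map g) c) = map (map g) (iter N sdc c).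
Proof.
move=> gb; elim: N => //= N ->; rewrite /sdc map_flatten -!map_comp; congr flatten.
by apply: eq_map => P /=; apply: sd_map.
Qed.

Lemma sd_size P : List.Forall (fun Q => size Q = size P) (sd P).
Proof.
have [j] := ubnP (size P); elim: j P => // j IH [|v P]; first by constructor.
rewrite ltnS => sP; rewrite sdE; apply/Forall_map/Forall_flatten.
apply: List.Forall_impl (size_tbd (v :: P)) => Q /= [sQ].
by rewrite -sQ; apply: List.Forall_impl (IH Q _) => [Q' /= -> //|]; rewrite sQ.
Qed.

Lemma tbd_Forall (T : Type) (C : T -> Prop) P :
  List.Forall C P -> List.Forall (List.Forall C) (tbd P).
Proof.
elim=> [|v P' Cv CP IH] /=; constructor=> //; apply/Forall_map.
by apply: List.Forall_impl IH => Q; constructor.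
Qed.

(** Empty tuples are excluded: their barycentre is the origin, which lies outside the standard
    simplex. *)
Definition bary_closed (C : point -> Prop) :=
  forall v P, List.Forall C (v :: P) -> C (bary (v :: P)).

Lemma sd_Forall C P : bary_closed C -> List.Forall C P -> List.Forall (List.Forall C) (sd P).
Proof.
move=> Cb; have [j] := ubnP (size P); elim: j P => // j IH [|v P]; first by constructor.
rewrite ltnS => sP CP; rewrite sdE; apply/Forall_map.
have : List.Forall (List.Forall C) (sdc (tbd (v :: P))).
  apply: Forall_flatten.
  apply: List.Forall_impl (List.Forall_and (size_tbd (v :: P)) (tbd_Forall CP)) => Q /= [[sQ] CQ].
  by apply: IH => //; rewrite sQ.
by apply: List.Forall_impl => Q CQ; constructor=> //; apply: Cb.
Qed.

Lemma iter_sdc_Forall C N c : bary_closed C ->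
  List.Forall (List.Forall C) c -> List.Forall (List.Forall C) (iter N sdc c).
Proof.
move=> Cb Cc; elim: N => //= N IH; apply: Forall_flatten.
by apply: List.Forall_impl IH => P; apply: sd_Forall.
Qed.

Definition diam_le (D : R) (P : seq point) :=
  List.Forall (fun u : point => List.Forall (fun v : point => forall i, `|u i - v i| <= D) P) P.

Lemma sum_le_Forall (T : Type) (F : T -> R) D P : List.Forall (fun x => F x <= D) P ->
  \sum_(x <- P) F x <= (size P)%:R * D.
Proof.
elim=> [|x P' h _ IH]; first by rewrite big_nil mul0r.
by rewrite big_cons /= -natr1 mulrDl mul1r addrC lerD.
Qed.

Lemma bary_sub v P (x : point) i : bary (v :: P) i - x i =
  (\sum_(w <- v :: P) (w i - x i)) / (size (v :: P))%:R.
Proof.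
have -> : \sum_(w <- v :: P) (w i - x i) = \sum_(w <- v :: P) w i - x i * (size (v :: P))%:R.
  by rewrite sumrB big_const_seq count_predT iter_addr_0 mulr_natr.
by rewrite mulrBl mulfK // pnatr_eq0.
Qed.

Lemma dist_bary_le v P (x : point) i D : List.Forall (fun w : point => `|w i - x i| <= D) (v :: P) ->
  `|bary (v :: P) i - x i| <= D.
Proof.
move=> h; rewrite bary_sub normrM normfV normr_nat ler_pdivrMr ?ltr0n //.
by rewrite (le_trans (ler_norm_sum _ _ _)) // mulrC; apply: sum_le_Forall.
Qed.

Lemma Forall_split (T : Type) (C : T -> Prop) P : List.Forall C P ->
  forall x, List.In x P -> C x.
Proof. by move=> h; apply/List.Forall_forall. Qed.

(** In the average of the differences to [x] the term of [x] itself is zero, which leaves at most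
    [K] out of [K + 1] terms. *)
Lemma dist_bary_vertex v P (K : nat) (D : R) (x : point) i : 0 <= D -> (size (v :: P) <= K.+1)%N ->
  diam_le D (v :: P) -> List.In x (v :: P) ->
  `|bary (v :: P) i - x i| <= K%:R / K.+1%:R * D.
Proof.
move=> D0 sP dP xP.
have dx := Forall_split dP xP.
have [A [B e]] := List.in_split x (v :: P) xP.
have dAB : List.Forall (fun w : point => `|w i - x i| <= D) (A ++ B).
  have : List.Forall (fun w : point => `|w i - x i| <= D) (A ++ x :: B).
    by rewrite -[A ++ _]e; apply: List.Forall_impl dx => w /(_ i); rewrite distrC.
  by move/Forall_cat => [hA] /List.Forall_cons_iff [_ hB]; apply/Forall_cat.
have e' : v :: P = A ++ x :: B := e.
rewrite bary_sub e' big_cat big_cons /= subrr add0r -big_cat /= normrM normfV normr_nat.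
have s0 : 0 < (size (A ++ x :: B))%:R :> R by rewrite ltr0n size_cat /= addnS.
rewrite ler_pdivrMr // (le_trans (ler_norm_sum _ _ _)) // (le_trans (sum_le_Forall dAB)) //.
have -> : (size (A ++ x :: B))%:R = (size (A ++ B))%:R + 1 :> R.
  by rewrite !size_cat /= addnS natr1.
have sK : (size (A ++ B))%:R <= K%:R :> R.
  by rewrite ler_nat; move: sP; rewrite e' !size_cat /= addnS ltnS.
rewrite -[leRHS]mulrA [D * _]mulrC mulrA; apply: ler_wpM2r => //.
rewrite mulrAC ler_pdivlMr ?ltr0n // -natr1; lra.
Qed.

Lemma diam_le_sub D P Q : List.incl Q P -> diam_le D P -> diam_le D Q.
Proof.
move=> QP /List.Forall_forall h; apply/List.Forall_forall => u /QP/h /List.Forall_forall h'.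
by apply/List.Forall_forall => v /QP/h'.
Qed.

Lemma tbd_incl (T : Type) (P : seq T) : List.Forall (fun Q => List.incl Q P) (tbd P).
Proof.
elim: P => [|v P IH] /=; constructor; first by move=> x; right.
apply/Forall_map; apply: List.Forall_impl IH => Q QP x /= [->|/QP]; by [left|right].
Qed.

Lemma sd_diam K D P : 0 <= D -> (size P <= K.+1)%N -> diam_le D P ->
  List.Forall (diam_le (K%:R / K.+1%:R * D)) (sd P).
Proof.
move=> D0; have [j] := ubnP (size P); elim: j P => // j IH [|v P]; first by do 2!constructor.
set r := _ * D; rewrite ltnS => sP sK dP; rewrite sdE; apply/Forall_map/Forall_flatten.
have r0 : 0 <= r by rewrite mulr_ge0 // divr_ge0.
apply: List.Forall_impl (List.Forall_and (size_tbd (v :: P)) (tbd_incl (v :: P))) => Q /= [[sQ] QP].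
have dQ : List.Forall (diam_le r) (sd Q).
  by apply: IH (diam_le_sub QP dP); rewrite sQ // ltnW.
(* The ball of radius [r] around the barycentre contains the vertices of [Q] and is closed under
   barycentres, hence it contains all vertices of the subdivision of [Q]. *)
pose C (x : point) := forall i, `|bary (v :: P) i - x i| <= r.
have Cb : bary_closed C.
  move=> w S CS i; rewrite distrC; apply: dist_bary_le.
  by apply: List.Forall_impl CS => x /(_ i); rewrite distrC.
have CQ : List.Forall (List.Forall C) (sd Q).
  apply: sd_Forall => //; apply/List.Forall_forall => x /QP xP i.
  exact: (dist_bary_vertex (K := K)).
apply: List.Forall_impl (List.Forall_and dQ CQ) => S [dS CS].
constructor; first by constructor=> // i; rewrite subrr normr0.
apply/List.Forall_forall => x xS; constructor.
  by move=> i; rewrite distrC; apply: (Forall_split CS).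
exact: (Forall_split dS).
Qed.

Lemma iter_sdc_size N c j : List.Forall (fun P => size P = j) c ->
  List.Forall (fun P => size P = j) (iter N sdc c).
Proof.
move=> h; elim: N => //= N IH; apply: Forall_flatten; apply: List.Forall_impl IH => P <-.
exact: sd_size.
Qed.

Lemma iter_sdc_diam N K D c : 0 <= D -> List.Forall (fun P => (size P <= K.+1)%N) c ->
  List.Forall (diam_le D) c ->
  List.Forall (diam_le ((K%:R / K.+1%:R) ^+ N * D)) (iter N sdc c).
Proof.
move=> D0 sc dc; elim: N => [|N IH]; first by rewrite expr0 mul1r.
rewrite exprS -mulrA /=; apply: Forall_flatten.
have sN : List.Forall (fun P => (size P <= K.+1)%N) (iter N sdc c).
  elim: (N) => //= N' IHN; apply: Forall_flatten; apply: List.Forall_impl IHN => P sP.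
  by apply: List.Forall_impl (sd_size P) => Q ->.
apply: List.Forall_impl (List.Forall_and sN IH) => P [sP dP].
by apply: sd_diam => //; rewrite mulr_ge0 // exprn_ge0 // divr_ge0.
Qed.

(** * Affine approximation of singular simplices *)

Definition unit_pt (j : nat) : point := fun i => (i == j)%:R.
Definition verts k : seq point := map unit_pt (iota 0 k.+1).

Lemma sum_firstE n (t : point) : sum_first n t = \sum_(i < n) t i.
Proof. by elim: n => [|n IH] /=; rewrite ?big_ord0 // big_ord_recr /= IH. Qed.

Lemma std_simplexP k t : std_simplex k t <->
  [/\ forall i, (i <= k)%N -> 0 <= t i, forall i, (k < i)%N -> t i = 0 &
      \sum_(i < k.+1) t i = 1].
Proof.
rewrite /std_simplex sum_firstE; split=> [[h1 [h2 h3]]|[h1 h2 h3]].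
  split=> // i; first by move=> /ssrnat.leP/h1/RleP.
  by move=> /ssrnat.ltP/h2.
split; first by move=> i /ssrnat.leP/h1/RleP.
by split=> // i /ssrnat.ltP/h2.
Qed.

Lemma eq_sum_Forall (T : Type) (F G : T -> R) P : List.Forall (fun x => F x = G x) P ->
  \sum_(x <- P) F x = \sum_(x <- P) G x.
Proof. by elim=> [|x P' e _ IH]; rewrite ?big_nil // !big_cons e IH. Qed.

Lemma sum_ge0_Forall (T : Type) (F : T -> R) P : List.Forall (fun x => 0 <= F x) P ->
  0 <= \sum_(x <- P) F x.
Proof. by elim=> [|x P' e _ IH]; rewrite ?big_nil // big_cons addr_ge0. Qed.

Lemma std_simplex_bary k : bary_closed (std_simplex k).
Proof.
move=> v P CP; apply/std_simplexP; split.
- move=> i ik; rewrite divr_ge0 //; apply: sum_ge0_Forall.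
  by apply: List.Forall_impl CP => w /std_simplexP [h _ _]; apply: h.
- move=> i ik; rewrite /bary (@eq_sum_Forall _ _ (fun=> 0)) ?big1 ?mul0r //.
  by apply: List.Forall_impl CP => w /std_simplexP [_ h _]; apply: h.
- rewrite /bary -mulr_suml exchange_big /= (@eq_sum_Forall _ _ (fun=> 1)).
    by rewrite big_const_seq count_predT iter_addr_0 divff // pnatr_eq0.
  by apply: List.Forall_impl CP => w /std_simplexP [_ _ h].
Qed.

Lemma verts_simplex k : List.Forall (std_simplex k) (verts k).
Proof.
apply/Forall_map/Forall_inP => j; rewrite mem_iota add0n ltnS => /andP[_ jk].
apply/std_simplexP; split=> [i _|i ki|]; rewrite /unit_pt ?ler0n //.
  by case: eqP => // e; move: ki; rewrite e ltnNge jk.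
rewrite (bigD1 (Ordinal (jk : j < k.+1)%N)) //= eqxx big1 ?addr0 // => i.
by rewrite -val_eqE /= => /negbTE ->.
Qed.

Lemma verts_diam k : diam_le 1 (verts k).
Proof.
have h j j' i : `|unit_pt j i - unit_pt j' i| <= 1 :> R.
  rewrite /unit_pt; case: (i == j); case: (i == j');
    by rewrite ?subrr ?subr0 ?sub0r ?normrN ?normr1 ?normr0 ?ler01.
by apply/Forall_map/Forall_inP => j _; apply/Forall_map/Forall_inP => j' _ i.
Qed.

Definition sd_verts N k := iter N sdc [:: verts k].

Lemma sd_verts_simplex N k : List.Forall (List.Forall (std_simplex k)) (sd_verts N k).
Proof.
by apply: iter_sdc_Forall; [apply: std_simplex_bary|constructor=> //; apply: verts_simplex].
Qed.

Lemma size_verts k : size (verts k) = k.+1.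
Proof. by rewrite size_map size_iota. Qed.

Lemma sd_verts_size N k : List.Forall (fun P => size P = k.+1) (sd_verts N k).
Proof. by apply: iter_sdc_size; constructor; rewrite ?size_verts. Qed.

Lemma sd_verts_diam N k K : (k <= K)%N ->
  List.Forall (diam_le ((K%:R / K.+1%:R) ^+ N)) (sd_verts N k).
Proof.
move=> kK; rewrite -[X in diam_le X]mulr1; apply: iter_sdc_diam => //.
  by constructor; rewrite ?size_verts.
by constructor=> //; apply: verts_diam.
Qed.

Lemma face_incl_bary j P : bary (map (face_incl j) P) = face_incl j (bary P).
Proof.
apply: funext => i; rewrite /bary size_map big_map /face_incl.
case: ifP => // _; case: ifP => // _.
by rewrite big1 ?mul0r.
Qed.

Lemma face_incl_unit j i : face_incl j (unit_pt i) = unit_pt (if (i < j)%N then i else i.+1).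
Proof.
apply: funext => a; rewrite /face_incl /unit_pt.
case: (PeanoNat.Nat.ltb_spec a j) => h1.
  case: (ltnP i j) => h2 //; congr (_%:R); congr nat_of_bool; apply/eqP/eqP; lia.
case: (PeanoNat.Nat.eqb_spec a j) => h2.
  case: (ltnP i j) => h3; rewrite (_ : (_ == _) = false) //; apply/eqP; lia.
by case: (ltnP i j) => h3; congr (_%:R); congr nat_of_bool; apply/eqP/eqP; lia.
Qed.

Lemma iota0S n : iota 0 n.+1 = 0%N :: map S (iota 0 n).
Proof. by rewrite /= (iotaDl 1 0). Qed.

Lemma tbd_cons (T : Type) (x : T) P : tbd (x :: P) = P :: map (cons x) (tbd P).
Proof. by []. Qed.

Lemma xs_tbd_map (T : Type) (f : seq T -> bool) (F : nat -> T) n :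
  xs f (tbd (map F (iota 0 n.+1))) =
  xs (fun j => f (map (fun i => F (if (i < j)%N then i else i.+1)) (iota 0 n))) (iota 0 n.+1).
Proof.
elim: n f F => [|n IH] f F; first by rewrite /= !xs1.
rewrite [in LHS](iota0S n.+1) map_cons -map_comp tbd_cons xs_cons xs_map IH.
rewrite [in RHS](iota0S n.+1) [in RHS]xs_cons [in RHS]xs_map; congr addb.
apply: eq_xs => j; rewrite [f \o _]/comp [in RHS]/comp; congr f.
rewrite [in RHS]iota0S /= -map_comp; congr (_ :: _); apply: eq_map => i /=.
by rewrite ltnS; case: ifP.
Qed.

(** The vertex tuples of the piecewise affine map that agrees with [s] on the vertices of the [N]-th
    subdivision. *)
Definition approx N k (s : point -> point) : seq (seq point) := map (map s) (sd_verts N k).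

Lemma approx0_bd N s f : xs f (cbd (approx N 0 s)) = f [::].
Proof.
rewrite cbd_map xs_map cbd_iter_sdc (_ : cbd [:: verts 0] = [:: [::]]) //.
by rewrite iter_sdc_nil xs1.
Qed.

Lemma iter_sdc_xs N f c : xs f (iter N sdc c) = xs (fun P => xs f (iter N sdc [:: P])) c.
Proof.
elim: N f c => [|N IH] f c /=; first by apply: eq_xs => P; rewrite xs1.
by rewrite xs_sdc IH; apply: eq_xs => P; rewrite xs_sdc.
Qed.

Lemma bdry1 k s : bdry k [:: s] = map (fun j => face k j s) (iota 0 k.+1).
Proof.
have seqE m n : List.seq m n = iota m n by elim: n m => //= n IH m; rewrite IH.
by rewrite /bdry [LHS]List.app_nil_r seqE.
Qed.

(** Face inclusions preserve barycentres, so the subdivision of a simplex induces on each facet the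
    subdivision of that facet. *)
Lemma approx_bd N k s f : xs f (cbd (approx N k.+1 s)) =
  xs (fun s' => xs f (approx N k s')) (bdry k.+1 [:: s]).
Proof.
rewrite cbd_map xs_map cbd_iter_sdc [cbd _]cats0 iter_sdc_xs xs_tbd_map.
rewrite bdry1 xs_map.
have e j : iter N sdc [:: [seq unit_pt (if (i < j)%N then i else i.+1) | i <- iota 0 k.+1]] =
    map (map (face_incl j)) (sd_verts N k).
  rewrite -iter_sdc_map; last exact: face_incl_bary.
  congr (iter N sdc [:: _]); rewrite /verts -map_comp; apply: eq_map => i /=.
  by rewrite face_incl_unit.
have e' j : xs (f \o map s) (iter N sdc [:: [seq unit_pt (if (i < j)%N then i else i.+1) | i <- iota 0 k.+1]]) =
    xs f (approx N k (face k.+1 j s)).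
  rewrite e /approx !xs_map; apply: eq_xs_in; apply: List.Forall_impl (sd_verts_simplex N k) => P hP.
  rewrite /= -map_comp; congr f; apply: map_Forall; apply: List.Forall_impl hP => t ht.
  by rewrite /face /=; have -> : pdec (std_simplex k t) by apply/pdecP.
by apply: eq_xs => j; rewrite e'.
Qed.

(** * The Helly number *)

(** Equality of points is decided classically; the alias carries the structure that membership and
    repetition in tuples require. *)
Definition pt : Type := point.
HB.instance Definition _ := gen_eqMixin pt.

Lemma In_mem (T : eqType) (x : T) (l : seq T) : x \in l <-> List.In x l.
Proof.
elim: l => //= y l IH; rewrite inE; split=> [/predU1P [->|/IH]|[->|/IH ->]]; [by left|by right| |].
- by rewrite eqxx.
- by rewrite orbT.
Qed.

Lemma In_flatten_map (S T : Type) (F : S -> seq T) l y :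
  List.In y (flatten (map F l)) -> exists2 x, List.In x l & List.In y (F x).
Proof.
elim: l => //= x l IH /List.in_app_iff [h|/IH [x' h1 h2]]; first by exists x => //; left.
by exists x' => //; right.
Qed.

Lemma In_map (S T : Type) (F : S -> T) l y :
  List.In y (map F l) -> exists2 x, List.In x l & y = F x.
Proof.
elim: l => //= x l IH [<-|/IH [x' h1 h2]]; first by exists x => //; left.
by exists x' => //; right.
Qed.

Lemma list_min (T : Type) (P : T -> R -> Prop) (l : seq T) :
  (forall x e e', 0 < e' <= e -> P x e -> P x e') ->
  (forall x, List.In x l -> exists2 e, 0 < e & P x e) ->
  exists2 e, 0 < e & forall x, List.In x l -> P x e.
Proof.
move=> mono; elim: l => [_|x l IH h]; first by exists 1; rewrite ?ltr01.
have [e1 e10 h1] := h x (or_introl erefl).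
have [|e2 e20 h2] := IH; first by move=> y yl; apply: h; right.
have e0 : 0 < Num.min e1 e2 by rewrite lt_min e10.
exists (Num.min e1 e2) => // y [<-|/h2 hy].
  by apply: mono h1; rewrite e0 ge_min lexx.
by apply: mono hy; rewrite e0 ge_min lexx orbT.
Qed.

Lemma supdist_ltP n (x y : point) (e : R) : 0 < e ->
  Rdefinitions.Rlt (supdist n x y) e <-> forall i, (i < n)%N -> `|x i - y i| < e.
Proof.
move=> /RltP e0; rewrite (supdist_lt n x y e e0); split=> h i.
  by move=> /ssrnat.ltP /h /RltP; rewrite RabsE.
by move=> /ssrnat.ltP /h; rewrite -RabsE => /RltP.
Qed.

Lemma exists_small_power (r de : R) : 0 <= r < 1 -> 0 < de -> exists N, r ^+ N < de.
Proof.
move=> /andP[r0 r1] /RltP de0.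
have [|N hN] := Rfunctions.pow_lt_1_zero r _ de de0.
  by apply/RltP; rewrite RabsE ger0_norm.
exists N; have := hN N (le_n _) => /RltP; rewrite RabsE RpowE.
by rewrite ger0_norm // exprn_ge0.
Qed.

Lemma weighted_dist (T : eqType) (w kap : T -> R) (P : seq T) (p e : R) :
  {in P, forall x, 0 < w x} -> {in P, forall x, `|kap x - p| <= e} ->
  `|\sum_(x <- P) w x * kap x - (\sum_(x <- P) w x) * p| <= (\sum_(x <- P) w x) * e.
Proof.
move=> w0 h; rewrite mulr_suml -sumrB (le_trans (ler_norm_sum _ _ _)) // mulr_suml.
rewrite big_seq [leRHS]big_seq; apply: ler_sum => x xP.
by rewrite -mulrBr normrM gtr0_norm ?w0 // ler_wpM2l ?h // ltW ?w0.
Qed.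

(** * Contradiction for [2k + 3] vertices *)

Section NoCarriedMap.
Variables (d k b : nat).
Let m := k.*2.+3.
Let I := 'I_m.
Variables (X : {set I} -> pset) (g : {set I} -> chain).
Hypotheses (dk : (d <= k.*2)%N) (sX : good_system d k b X) (cg : carried_map d k X g).

Lemma g_simplex (s : {set I}) : (0 < #|s| <= k.+1)%N ->
  forall u, List.In u (g s) -> sing_simplex d (X s) #|s|.-1 u.
Proof. by move=> hs; apply/List.Forall_forall; apply: cmap_chain cg _ hs. Qed.

Definition bounded_face (s : {set I}) := (0 < #|s| <= k.+1)%N.

Lemma uniformly_apart : exists2 e : R, 0 < e &
  forall s t : {set I}, bounded_face s -> bounded_face t -> [disjoint s & t] ->
  forall u v, List.In u (g s) -> List.In v (g t) ->
  forall x y, std_simplex #|s|.-1 x -> std_simplex #|t|.-1 y ->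
    ~ Rdefinitions.Rlt (supdist d (u x) (v y)) e.
Proof.
pose Q (s t : {set I}) (u v : point -> point) (e : R) :=
  forall x y, std_simplex #|s|.-1 x -> std_simplex #|t|.-1 y ->
    ~ Rdefinitions.Rlt (supdist d (u x) (v y)) e.
have Qm s t u v e e' : 0 < e' <= e -> Q s t u v e -> Q s t u v e'.
  move=> /andP[_ /RleP ee] h x y hx hy h'; apply: (h x y hx hy).
  exact: RIneq.Rlt_le_trans h' ee.
have [|e e0 h] := @list_min _ (fun s e => forall t : {set I}, bounded_face s -> bounded_face t ->
  [disjoint s & t] -> forall u v, List.In u (g s) -> List.In v (g t) -> Q s t u v e) (enum {set I})
  (fun s e e' he h t hs ht st u v hu hv => Qm s t u v e e' he (h t hs ht st u v hu hv)).
  move=> s _.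
  have [|e e0 h] := @list_min _ (fun t e => bounded_face s -> bounded_face t ->
    [disjoint s & t] -> forall u v, List.In u (g s) -> List.In v (g t) -> Q s t u v e) (enum {set I})
    (fun t e e' he h hs ht st u v hu hv => Qm s t u v e e' he (h hs ht st u v hu hv)).
    move=> t _.
    have [[hs ht]|ne] := pselect (bounded_face s /\ bounded_face t); last first.
      by exists 1; rewrite ?ltr01 // => hs ht; case: ne.
    have [st|ne] := boolP [disjoint s & t]; last by exists 1; rewrite ?ltr01.
    have [|e e0 h] := @list_min _ (fun u e => forall v, List.In v (g t) -> Q s t u v e) (g s)
      (fun u e e' he h v hv => Qm s t u v e e' he (h v hv)).
      move=> u us.
      have [|e e0 h] := @list_min _ (fun v e => Q s t u v e) (g t)
        (fun v e e' he h => Qm s t u v e e' he h).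
        move=> v vt.
        have [e [/RltP e0 h]] := simplices_apart _ _ _ _ _ _ _ (g_simplex hs us) (g_simplex ht vt)
           (sys_disj sX st).
        by exists e.
      by exists e.
    by exists e => // _ _ _ u v us vt; apply: h.
  by exists e => // t; apply: h; apply/In_mem; rewrite mem_enum.
by exists e => // s t; apply: h; apply/In_mem; rewrite mem_enum.
Qed.

Lemma uniformly_continuous (e : R) : 0 < e -> exists2 de : R, 0 < de &
  forall s : {set I}, bounded_face s -> forall u, List.In u (g s) ->
  forall x y, std_simplex #|s|.-1 x -> std_simplex #|s|.-1 y ->
    Rdefinitions.Rlt (supdist #|s| x y) de -> Rdefinitions.Rlt (supdist d (u x) (u y)) e.
Proof.
move=> e0.
pose Q (s : {set I}) (u : point -> point) (de : R) :=
  forall x y, std_simplex #|s|.-1 x -> std_simplex #|s|.-1 y ->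
    Rdefinitions.Rlt (supdist #|s| x y) de -> Rdefinitions.Rlt (supdist d (u x) (u y)) e.
have Qm s u a a' : 0 < a' <= a -> Q s u a -> Q s u a'.
  move=> /andP[_ /RleP aa] h x y hx hy h'; apply: (h x y hx hy).
  exact: RIneq.Rlt_le_trans h' aa.
have [|a a0 h] := @list_min _ (fun s a => bounded_face s -> forall u, List.In u (g s) -> Q s u a)
  (enum {set I}) (fun s a a' ha h hs u hu => Qm s u a a' ha (h hs u hu)).
  move=> s _; have [hs|ne] := boolP (bounded_face s); last by exists 1; rewrite ?ltr01.
  have [|a a0 h] := @list_min _ (fun u a => Q s u a) (g s) (fun u a a' ha h => Qm s u a a' ha h).
    move=> u us.
    have [a [/RltP a0 h]] := simplex_uniform_continuity _ _ _ _ _ (g_simplex hs us) (elimT RltP e0).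
    exists a => // x y hx hy; move: (h x y hx hy); rewrite prednK //; by case/andP: hs.
  by exists a.
by exists a => // s; apply: h; apply/In_mem; rewrite mem_enum.
Qed.

Section Approximation.
Variable N : nat.

Definition phi (s : {set I}) : seq (seq pt) :=
  if s == set0 then [:: [::]] else flatten (map (approx N #|s|.-1) (g s)).

Lemma phi_map : chain_map phi.
Proof.
move=> s hs f; rewrite (xs_flatten_enum f (fun x => phi (s :\ x))).
have s0 : s != set0 by rewrite -card_gt0; case/andP: hs.
rewrite {1}/phi (negbTE s0) xs_cbd xs_flatten.
rewrite (@eq_xs _ _ (fun u => xs f (cbd (approx N #|s|.-1 u)))); last by move=> u; rewrite xs_cbd.
case cs: #|s| => [|[|j]] /=; first by rewrite cs in hs.
  rewrite (@eq_xs _ _ (fun=> f [::])); last by move=> u; apply: approx0_bd.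
  (* On a vertex only the augmentation counts, which is tested with a constant functional. *)
  have := cmap_bdry cg hs (fun=> f [::]); rewrite cs /= xs_map /comp => ->.
  have /eqP /cards1P [x ->] := cs.
  by rewrite !big_set1 setDv (cmap0 cg) /phi eqxx !xs1.
rewrite (@eq_xs _ _ (fun u => xs (fun u' => xs f (approx N j u')) (bdry j.+1 [:: u]))); last first.
  by move=> u; apply: approx_bd.
rewrite -xs_bdry.
have := cmap_bdry cg hs (fun u' => xs f (approx N j u')); rewrite {1}cs /= => ->.
apply: eq_bigr => x xs.
have cx : #|s :\ x| = j.+1 by move: cs; rewrite (cardsD1 x s) xs add1n => -[].
by rewrite /phi -cards_eq0 cx xs_flatten.
Qed.

Lemma phiP (s : {set I}) P : bounded_face s -> P \in phi s ->
  exists u Q, [/\ List.In u (g s), List.In Q (sd_verts N #|s|.-1) & P = map u Q].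
Proof.
move=> /andP[s0 _] /In_mem; rewrite /phi -cards_eq0 eqn0Ngt s0 /= => h.
have [u us] := @In_flatten_map (point -> point) (seq point) _ _ _ h.
by move/(@In_map (seq point) (seq point)) => [Q hQ ->]; exists u, Q.
Qed.
End Approximation.

Lemma phi_empty N (s : {set I}) P x : P \in phi N s -> x \in P -> (0 < #|s|)%N.
Proof.
rewrite card_gt0 /phi; case: eqP => [_|//]; rewrite inE => /eqP ->.
by rewrite in_nil.
Qed.

Theorem no_carried_map : False.
Proof.
have [e e0 apart] := uniformly_apart.
(* Points of one tuple are less than [eta] apart and each coordinate moves by less than [eta], so a
   crossing point is within [2 * eta] of the vertices on either side; any [eta] with [4 * eta < e]
   will do. *)
pose eta := e / 10.
have eta0 : 0 < eta by rewrite divr_gt0.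
have [de de0 ucont] := uniformly_continuous eta0.
have [|N hN] := @exists_small_power (k%:R / k.+1%:R) de _ de0.
  by rewrite divr_ge0 //= ltr_pdivrMr ?ltr0n // mul1r ltr_nat.
have phi_pt s P x : bounded_face s -> P \in phi N s -> x \in P ->
    exists u t, [/\ List.In u (g s), std_simplex #|s|.-1 t & x = u t].
  move=> hs /(phiP hs) [u [Q [us hQ ->]]] /In_mem /(@In_map point point) [t tQ ->].
  exists u, t; split=> //.
  exact: (Forall_split (Forall_split (sd_verts_simplex N _) hQ) tQ).
have phi_diam s P x y : bounded_face s -> P \in phi N s -> x \in P -> y \in P ->
    Rdefinitions.Rlt (supdist d x y) eta.
  move=> hs /(phiP hs) [u [Q [us hQ ->]]].
  move=> /In_mem /(@In_map point point) [t tQ ->] /In_mem /(@In_map point point) [t' tQ' ->].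
  have hQs := Forall_split (sd_verts_simplex N _) hQ.
  apply: (ucont s hs u us _ _ (Forall_split hQs tQ) (Forall_split hQs tQ')).
  apply/(supdist_ltP _ _ _ de0) => i _.
  have sk : (#|s|.-1 <= k)%N by case/andP: hs; lia.
  have dQ := Forall_split (sd_verts_diam N sk) hQ.
  by apply: le_lt_trans hN; apply: (Forall_split (Forall_split dQ tQ) tQ').
have phi_sz (s : {set I}) : (#|s| <= k.+1)%N -> {in phi N s, forall P, size P = #|s|}.
  move=> sk P Ps; have [s0|s0] := posnP #|s|.
    move: Ps; rewrite /phi -cards_eq0 s0 inE => /eqP -> //.
  have hs : bounded_face s by rewrite /bounded_face s0.
  have [u [Q [us hQ ->]]] := phiP hs Ps.
  by rewrite size_map (Forall_split (sd_verts_size N _) hQ) prednK.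
have phi_dj (s t : {set I}) : (#|s| <= k.+1)%N -> (#|t| <= k.+1)%N -> [disjoint s & t] ->
     forall P Q, P \in phi N s -> Q \in phi N t -> forall x, x \in P -> x \notin Q.
  move=> sk tk st P Q Ps Qt x xP; apply/negP => xQ.
  have hs : bounded_face s by rewrite /bounded_face (phi_empty Ps xP).
  have ht : bounded_face t by rewrite /bounded_face (phi_empty Qt xQ).
  have [u [a [us ha e1]]] := phi_pt _ _ _ hs Ps xP.
  have [v [a' [vt ha' e2]]] := phi_pt _ _ _ ht Qt xQ.
  apply: (apart s t hs ht st u v us vt a a' ha ha').
  by apply/(supdist_ltP _ _ _ e0) => i _; rewrite -e1 -e2 subrr normr0.
(* The homogenizing 1 comes first and shifts the coordinates by one. As [d <= k.*2], all coordinates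
   of [R^d] are among those of [R^(2k)]. *)
pose c (x : pt) (i : nat) : R := if i is i'.+1 then x i' else 1.
have phi_0 : phi N set0 = [:: [::]] by rewrite /phi eqxx.
have [kap [kap_near [s [t [cs ct st [P [Q [Ps Qt]]]]]]]] :=
  van_kampen_flores (c := c) (fun=> erefl) eta0 phi_0 (phi_map N) phi_sz phi_dj.
move=> /andP[_ /asboolP [w [w0 wE]]].
have hs : bounded_face s by rewrite /bounded_face cs leqnn.
have ht : bounded_face t by rewrite /bounded_face ct leqnn.
have near (r : {set I}) S x : bounded_face r -> S \in phi N r -> x \in S ->
    kap x 0%N = 1 /\ forall i, (i < d)%N -> `|kap x i.+1 - x i| < eta.
  move=> hr Sr xS; have [|h1 h2] := kap_near x.
    apply/flattenP; exists S => //; apply/flattenP; exists (phi N r) => //.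
    by apply: map_f; rewrite mem_filter mem_enum andbT; case/andP: hr.
  split=> // i id; apply: (h2 i.+1); exact: leq_trans id dk.
have [p pP] : exists p, p \in P.
  have := phi_sz s; rewrite cs => /(_ (leqnn _) P Ps); case: (P) => // p P' _.
  by exists p; rewrite mem_head.
have [q qQ] : exists q, q \in Q.
  have := phi_sz t; rewrite ct => /(_ (leqnn _) Q Qt); case: (Q) => // q Q' _.
  by exists q; rewrite mem_head.
have far : exists2 i, (i < d)%N & e <= `|p i - q i|.
  apply: contrapT => h.
  have [u [a [us ha e1]]] := phi_pt _ _ _ hs Ps pP.
  have [v [a' [vt ha' e2]]] := phi_pt _ _ _ ht Qt qQ.
  apply: (apart s t hs ht st u v us vt a a' ha ha').
  apply/(supdist_ltP _ _ _ e0) => i id; rewrite -e1 -e2 ltNge; apply/negP => h'.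
  by apply: h; exists i.
have [i id pq] := far.
have wP : {in P, forall x, 0 < w x} by move=> x xP; apply: w0; rewrite mem_cat xP.
have wQ : {in Q, forall x, 0 < w x} by move=> x xQ; apply: w0; rewrite mem_cat xQ orbT.
have sumW (r : {set I}) S : bounded_face r -> S \in phi N r ->
    \sum_(x <- S) w x * kap x 0%N = \sum_(x <- S) w x.
  move=> hr Sr; rewrite big_seq [RHS]big_seq; apply: eq_bigr => x xS.
  by rewrite (near r S x hr Sr xS).1 mulr1.
have WE : \sum_(x <- P) w x = \sum_(x <- Q) w x.
  by rewrite -(sumW s P hs Ps) -(sumW t Q ht Qt) wE.
have W0 : 0 < \sum_(x <- P) w x.
  rewrite (perm_big _ (perm_to_rem pP)) big_cons ltr_wpDr ?wP //.
  by rewrite big_seq sumr_ge0 // => x xP; rewrite ltW // wP // (mem_rem xP).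
have close (r : {set I}) S x0 : bounded_face r -> S \in phi N r -> x0 \in S ->
    {in S, forall x, `|kap x i.+1 - x0 i| <= 2 * eta}.
  move=> hr Sr x0S x xS; have h1 := (near r S x hr Sr xS).2 i id.
  have /(supdist_ltP _ _ _ eta0) /(_ i id) h2 := phi_diam r S x x0 hr Sr xS x0S.
  rewrite -(subrK (x i) (kap x i.+1)) -addrA (le_trans (ler_normD _ _)) //.
  have -> : 2 * eta = eta + eta by ring.
  by rewrite lerD // ltW.
have h1 := weighted_dist wP (close s P p hs Ps pP).
have h2 := weighted_dist wQ (close t Q q ht Qt qQ).
have wi := wE i.+1 (leq_trans id dk).
rewrite wi WE in h1; rewrite WE in W0.
set W := \sum_(x <- Q) w x in h1 h2 W0; set K := \sum_(x <- Q) _ in h1 h2.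
(* Both sides of the crossing have total weight [W], by coordinate 0, and the same weighted sum [K],
   by coordinate [i.+1]. *)
have : W * `|p i - q i| <= W * (4 * eta).
  rewrite -[X in X * `|_|](gtr0_norm W0) -normrM.
  have -> : W * (p i - q i) = (K - W * q i) - (K - W * p i) by ring.
  rewrite (le_trans (ler_normB _ _)) //.
  have -> : W * (4 * eta) = W * (2 * eta) + W * (2 * eta) by ring.
  exact: lerD.
rewrite ler_pM2l // => h3.
have := le_trans pq h3; rewrite leNgt => /negP; apply.
rewrite /eta; lra.
Qed.
End NoCarriedMap.

Theorem helly_bound (b d : nat) : exists h : nat, forall F : seq pset,
  (forall G, proper_subfam G F -> forall i, (i < Nat.div (d + 1) 2)%N -> rbetti_le d (inter d G) i b) ->
  helly_le d F h.
Proof.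
(* Half of [d] rounded up, so that [d] is [2k] or [2k - 1]. *)
pose k := Nat.div (d + 1) 2.
have dk : (d <= k.*2)%N.
  have := PeanoNat.Nat.div_mod_eq (d + 1) 2; have := PeanoNat.Nat.mod_upper_bound (d + 1) 2.
  rewrite -/k; lia.
have [n0 hn0] := @constrained_map d b k k (leqnn k) k.*2.+3.
(* The 1 is for families with nonempty intersection, whose Helly number is 1 by convention. *)
exists (maxn 1 n0) => F hF; split=> [_|eF G nG GF eG mG].
  by apply/ssrnat.leP; rewrite leq_maxl.
apply/ssrnat.leP; rewrite leqNgt; apply/negP => hG.
have [||X [g [sX cg]]] := hn0 G nG eG mG.
- move=> G' [GG [U [UG UG']]] i ik; apply: hF => //; split; first by move=> V /GG/GF.
  by exists U; split=> //; apply: GF.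
- by apply: leq_trans (ltnW hG); apply: leq_maxr.
exact: no_carried_map dk sX cg.
Qed.
End HellyNumber.

From Stdlib Require Import Reals List Arith.

Theorem theorem1 :
  forall b d : nat, exists h : nat,
    forall F : list pset,
      NoDup F ->
      (forall U, In U F -> forall x, U x -> inRd d x) ->
      (forall G, proper_subfam G F ->
         forall i : nat, (i < (d + 1) / 2)%nat -> rbetti_le d (inter d G) i b) ->
      helly_le d F h.
Proof.
intros b d; destruct (HellyNumber.helly_bound b d) as [h hh].
exists h; intros F _ _ hF; apply hh; intros G GF i hi.
apply hF; [exact GF|]; exact (ssrbool.elimT ssrnat.ltP hi).
Qed.
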